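(* Let $P\in\Psi^q(\mathbb{T}^n_\theta)$, $q\in\mathbb{C}$, be elliptic with $m:=\Re q>0$ and $\mathrm{Sp}(P)\ne\mathbb{C}$. Then all the spectral projections $\Pi_\lambda(P)$, $\lambda\in\mathrm{Sp}(P)$, are smoothing operators.
   Context: Noncommutative torus. Let $n\ge 2$ and let $\theta=(\theta_{jk})$ be a real antisymmetric $n\times n$ matrix. $C(\mathbb{T}^n_\theta)$ is the universal $C^*$-algebra (norm $\|\cdot\|$) generated by unitaries $U_1,\dots,U_n$ with $U_kU_j=e^{2i\pi\theta_{jk}}U_jU_k$. Put $U^k=U_1^{k_1}\cdots U_n^{k_n}$, $k\in\mathbb{Z}^n$. $\tau$ is the trace with $\tau(U^k)=1$ if $k=0$ and $0$ otherwise. $L_2(\mathbb{T}^n_\theta)$ is the Hilbert space completion for $(u|v)=\tau(uv^* )$; $(U^k)_{k}$ is an orthonormal basis, and $C(\mathbb{T}^n_\theta)$ acts by left multiplication. $C^\infty(\mathbb{T}^n_\theta)=\{\sum_k u_kU^k:\ (u_k)\text{ rapidly decaying}\}$ is a Fréchet $*$-algebra with semi-norms $\|\delta^\beta u\|$, where $\delta_j(U^k)=k_jU^k$ and $\delta^\beta=\delta_1^{\beta_1}\cdots\delta_n^{\beta_n}$. $\mathscr{D}'(\mathbb{T}^n_\theta)$ is its strong topological dual (with $C^\infty\subset L_2\subset\mathscr{D}'$ via $\langle u,v\rangle=\tau(uv)$), and for $s\in\mathbb{R}$, $W_2^s(\mathbb{T}^n_\theta)=\{u\in\mathscr{D}':\sum_k(1+|k|^2)^s|u_k|^2<\infty\}$,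 $u_k=\langle u,(U^k)^*\rangle$. Symbols and operators. $C^\infty(\mathbb{T}^n_\theta\times V)=C^\infty(V;C^\infty(\mathbb{T}^n_\theta))$ for $V\subseteq\mathbb{R}^n$ open. $S_q(\mathbb{T}^n_\theta\times\mathbb{R}^n)$, $q\in\mathbb{C}$: $\rho\in C^\infty(\mathbb{T}^n_\theta\times(\mathbb{R}^n\setminus0))$ with $\rho(t\xi)=t^q\rho(\xi)$, $t>0$. $S^q(\mathbb{T}^n_\theta\times\mathbb{R}^n)$: $\rho\in C^\infty(\mathbb{T}^n_\theta\times\mathbb{R}^n)$ for which there are $\rho_{q-j}\in S_{q-j}$, $j\ge0$, such that for all $N,\alpha,\beta$ there is $C$ with $\|\delta^\alpha\partial_\xi^\beta(\rho-\sum_{j<N}\rho_{q-j})(\xi)\|\le C|\xi|^{\Re q-N-|\beta|}$ for $|\xi|\ge1$. $P_\rho(\sum_ku_kU^k)=\sum_ku_k\rho(k)U^k$, which extends continuously to $\mathscr{D}'(\mathbb{T}^n_\theta)$ and to $W_2^{s+\Re q}\to W_2^s$; $\Psi^q(\mathbb{T}^n_\theta)=\{P_\rho:\rho\in S^q\}$. $\rho_q$ (depending only on $P_\rho$) is the principal symbol; $P_\rho$ is elliptic if $\rho_q(\xi)$ is invertible for all $\xi\ne0$. A linear operator is smoothing if it extends to a continuous linear operator $\mathscr{D}'(\mathbb{T}^n_\theta)\to C^\infty(\mathbb{T}^n_\theta)$. Spectral notions. $P$ is regarded as a closed unbounded operator on $L_2(\mathbb{T}^n_\theta)$ with domain $W_2^m(\mathbb{T}^n_\theta)$.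 As $\mathrm{Sp}(P)\neq\mathbb{C}$, $\mathrm{Sp}(P)$ is a discrete set of eigenvalues of finite multiplicity. For $\lambda\in\mathrm{Sp}(P)$, $\Pi_\lambda(P)=\frac1{2i\pi}\int_{|\zeta-\lambda|=r}(\zeta-P)^{-1}d\zeta$, where $r>0$ is such that $\lambda$ is the only eigenvalue of $P$ in $|\zeta-\lambda|\le r$. *)

(* Defs.v *)
From HB Require Import structures.
From mathcomp Require Import all_boot all_order all_algebra.
From mathcomp Require Import finmap.
From mathcomp Require Import all_classical all_reals all_analysis.
From mathcomp Require Import showcase.summability.
From mathcomp Require Import complex.

Set Implicit Arguments.
Unset Strict Implicit.
Unset Printing Implicit Defensive.

Import Order.TTheory GRing.Theory Num.Theory.
Import numFieldNormedType.Exports.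

Local Open Scope classical_set_scope.
Local Open Scope ring_scope.
Local Open Scope complex_scope.

(* The product of a C*-algebra is a field of the mixin and is written [x ** y]:
   the library has no structure of normed algebra, and HB does not allow a join
   of its rings and its normed modules other than the numeric domains. *)
HB.mixin Record CompleteNormedModule_isCStar (R : realType) A
    of CompleteNormedModule R[i] A := {
  aone : A;
  amul : A -> A -> A;
  star : A -> A;
  amulA : associative amul;
  amul1l : left_id aone amul;
  amul1r : right_id aone amul;
  amul_linearl : forall y : A, linear (amul ^~ y);
  amul_linearr : forall x : A, linear (amul x);
  amul_norm : forall x y : A, `|amul x y| <= `|x| * `|y|;
  starK : involutive star;
  star_semilinear : forall (a : R[i]) (x y : A),
    star (a *: x + y) = a^* *: star x + star y;
  starM : forall x y : A, star (amul x y) = amul (star y) (star x);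
  cstar_identity : forall x : A, `|amul (star x) x| = `|x| ^+ 2
}.

#[short(type="cstarType")]
HB.structure Definition CStar (R : realType) :=
  { A of CompleteNormedModule R[i] A & CompleteNormedModule_isCStar R A }.

Notation "x ** y" := (amul x y) (at level 40, left associativity) : ring_scope.

HB.instance Definition _ (R : realType) (A : cstarType R) :=
  Monoid.isLaw.Build A aone amul (@amulA R A) (@amul1l R A) (@amul1r R A).

HB.mixin Record CompleteNormedModule_isHilbert (R : realType) V
    of CompleteNormedModule R[i] V := {
  ip : V -> V -> R[i];
  ip_scalar : forall y : V, scalar (ip ^~ y);
  ip_conj : forall x y : V, ip y x = (ip x y)^*;
  ip_norm : forall x : V, ip x x = `|x| ^+ 2
}.

#[short(type="hilbertType")]
HB.structure Definition Hilbert (R : realType) :=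
  { V of CompleteNormedModule R[i] V & CompleteNormedModule_isHilbert R V }.

Definition expi {R : realType} (t : R) : R[i] := cos t +i* sin t.

Definition unitary {R : realType} {A : cstarType R} (u : A) :=
  star u ** u = aone /\ u ** star u = aone.

Definition torus_relations {R : realType} {n : nat} (theta : 'M[R]_n)
    {A : cstarType R} (U : 'I_n -> A) :=
  (forall j, unitary (U j)) /\
  (forall j k, U k ** U j = expi (2 * pi * theta j k) *: (U j ** U k)).

(** Integer powers of a unitary, [u ^ (- m) = (star u) ^ m]. *)
Definition upow {R : realType} {A : cstarType R} (u : A) (z : int) : A :=
  match z with Posz m => iter m (amul u) aone
          | Negz m => iter m.+1 (amul (star u)) aone end.

Definition monomial {R : realType} {n : nat} {A : cstarType R}
    (U : 'I_n -> A) (k : 'rV[int]_n) : A :=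
  \big[amul/aone]_(i < n) upow (U i) (k 0 i).

(** The universal C*-algebra generated by [U_1, ..., U_n], with its trace.
    The universal property determines the algebra up to isomorphism, and the
    values of the trace on the monomials determine the trace. *)
Record ncTorus (R : realType) (n : nat) (theta : 'M[R]_n) := NCTorus {
  nct_alg :> cstarType R;
  nct_gen : 'I_n -> nct_alg;
  nct_relations : torus_relations theta nct_gen;
  nct_generated : forall S : set nct_alg, closed S -> S aone ->
    (forall (a : R[i]) x y, S x -> S y -> S (a *: x + y)) ->
    (forall x y, S x -> S y -> S (x ** y)) ->
    (forall x, S x -> S (star x)) ->
    (forall j, S (nct_gen j)) -> S = setT;
  nct_universal : forall (B : cstarType R) (V : 'I_n -> B),
    torus_relations theta V ->
    exists phi : {linear nct_alg -> B},
      [/\ phi aone = aone,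
          forall x y, phi (x ** y) = phi x ** phi y,
          forall x, phi (star x) = star (phi x) &
          forall j, phi (nct_gen j) = V j];
  trace : nct_alg -> R[i];
  trace_scalar : scalar trace;
  trace_continuous : continuous (trace : nct_alg -> R[i]^o);
  traceC : forall x y, trace (x ** y) = trace (y ** x);
  trace_monomial : forall k, trace (monomial nct_gen k) = (k == 0)%:R
}.

Definition enorm {R : realType} {n : nat} (x : 'rV[R]_n) : R :=
  Num.sqrt (\sum_(i < n) x 0 i ^+ 2).

Definition zvec (R : realType) {n : nat} (k : 'rV[int]_n) : 'rV[R]_n :=
  map_mx intr k.

Section SmoothElements.
Variables (R : realType) (n : nat) (theta : 'M[R]_n) (T : ncTorus theta).

Definition Uk (k : 'rV[int]_n) : T := monomial (@nct_gen _ _ _ T) k.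

Definition coef (u : T) (k : 'rV[int]_n) : R[i] := trace (u ** star (Uk k)).

Definition rapid (c : 'rV[int]_n -> R[i]) :=
  forall N : nat, exists M : R[i], forall k,
    ((1 + enorm (zvec R k)) ^+ N)%:C * `|c k| <= M.

Definition smooth (u : T) := exists2 c, rapid c &
  (partial_sum (fun k => c k *: Uk k) @ totally --> u).

Definition smooth_pred : {pred T} := fun u => `[< smooth u >].

Lemma smooth_submod : GRing.submod_closed smooth_pred.
Proof.
split.
  apply/asboolP; exists (fun=> 0).
    by move=> N; exists 0 => k; rewrite normr0 mulr0.
  have -> : partial_sum (fun k => 0 *: Uk k) = fun=> 0.
    apply/funext => F; rewrite /partial_sum big1// => k _.
    by rewrite scale0r.
  have FF := @totally_filter 'rV[int]_n.
  exact: cvg_cst.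
move=> a u v /asboolP[c cr cu] /asboolP[d dr dv]; apply/asboolP.
exists (fun k => a * c k + d k).
  move=> N; have [M1 H1] := cr N; have [M2 H2] := dr N.
  exists (`|a| * M1 + M2) => k.
  apply: (le_trans (y := `|a| * (((1 + enorm (zvec R k)) ^+ N)%:C * `|c k|)
     + ((1 + enorm (zvec R k)) ^+ N)%:C * `|d k|)).
    rewrite mulrCA -mulrDr ler_wpM2l//.
      by rewrite lecR exprn_ge0// addr_ge0// sqrtr_ge0.
    by rewrite (le_trans (ler_normD _ _))// normrM.
  by apply: lerD => //; apply: ler_wpM2l.
have -> : partial_sum (fun k => (a * c k + d k) *: Uk k) =
  (fun F => a *: partial_sum (fun k => c k *: Uk k) F
    + partial_sum (fun k => d k *: Uk k) F).
  apply/funext => F; rewrite /partial_sum scaler_sumr -big_split/=.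
  by apply: eq_bigr => k _; rewrite scalerDl scalerA.
have FF := @totally_filter 'rV[int]_n.
by apply: cvgD => //; apply: cvgZr.
Qed.

HB.instance Definition _ :=
  GRing.isSubmodClosed.Build R[i] T smooth_pred smooth_submod.

Record cinf := Cinf { cinf_val :> T; _ : cinf_val \in smooth_pred }.

HB.instance Definition _ := [isSub for cinf_val].
HB.instance Definition _ := [Choice of cinf by <:].
HB.instance Definition _ := [SubChoice_isSubLmodule of cinf by <:].

End SmoothElements.

Arguments smooth_pred {R n theta} T.
Arguments Cinf {R n theta T}.

Section Torus.
Variables (R : realType) (n : nat) (theta : 'M[R]_n) (T : ncTorus theta).

(** Applied below only to elements which do lie in C^oo: the monomials
    (U^k)^* and the sums of series with rapidly decaying coefficients. *)
Definition to_cinf (u : T) : cinf T := insubd 0 u.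

(** delta_j (sum_k u_k U^k) = sum_k k_j u_k U^k *)
Definition delta (j : 'I_n) (u : cinf T) : cinf T :=
  to_cinf (sum (fun k : 'rV[int]_n => ((k 0 j)%:~R * coef u k) *: Uk T k)).

Definition mindex := 'I_n -> nat.

Definition msize (a : mindex) : nat := (\sum_(i < n) a i)%N.

Definition mdelta (a : mindex) (u : cinf T) : cinf T :=
  foldr (fun i => iter (a i) (delta i)) u (enum 'I_n).

Definition snorm (a : mindex) (u : cinf T) : R[i] := `|mdelta a u : T|.

(** Elements of [cinf T -> R[i]] stand for distributions when they satisfy
    [distribution]; <v, u> is [v u]. *)
Definition distribution (v : cinf T -> R[i]) :=
  scalar v /\
  forall (u0 : cinf T) (e : R[i]), 0 < e ->
    exists (N : nat) (d : R[i]), 0 < d /\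
      forall u, (forall a, (msize a <= N)%N -> snorm a (u - u0) < d) ->
        `|v u - v u0| < e.

Definition bounded_cinf (B : set (cinf T)) :=
  forall a, exists M : R[i], forall u, B u -> snorm a u <= M.

(** The basic neighborhoods of the strong topology of the dual are the
    [dist_near B e v0], for [B] bounded and [0 < e]. *)
Definition dist_near (B : set (cinf T)) (e : R[i]) (v0 v : cinf T -> R[i]) :=
  forall u, B u -> `|v u - v0 u| < e.

Definition alg_dist (x : T) : cinf T -> R[i] := fun u => trace (x ** u).

Definition continuous_endo (P : (cinf T -> R[i]) -> (cinf T -> R[i])) :=
  [/\ forall v, distribution v -> distribution (P v),
      forall (a : R[i]) v w, distribution v -> distribution w ->
        P (fun u => a * v u + w u) = (fun u => a * P v u + P w u) &
      forall v0 B e, distribution v0 -> bounded_cinf B -> 0 < e ->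
        exists B' d, [/\ bounded_cinf B', 0 < d &
          forall v, distribution v -> dist_near B' d v0 v ->
            dist_near B e (P v0) (P v)]].

Definition continuous_to_cinf (S : (cinf T -> R[i]) -> cinf T) :=
  (forall (a : R[i]) v w, distribution v -> distribution w ->
     S (fun u => a * v u + w u) = a *: S v + S w) /\
  (forall v0 b e, distribution v0 -> 0 < e ->
     exists B' d, [/\ bounded_cinf B', 0 < d &
       forall v, distribution v -> dist_near B' d v0 v ->
         snorm b (S v - S v0) < e]).

Definition sobolev (s : R) (v : cinf T -> R[i]) :=
  distribution v /\
  (\esum_(k in [set: 'rV[int]_n])
     ((1 + enorm (zvec R k) ^+ 2) `^ s
        * complex.Re `|v (to_cinf (star (Uk T k)))| ^+ 2)%:E < +oo)%E.

(** Functions on an open subset [V] of R^n with values in C^oo are represented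
    by total functions, whose values outside [V] are irrelevant. *)
Definition has_pderiv (f : 'rV[R]_n -> cinf T) (i : 'I_n) (xi : 'rV[R]_n)
    (w : cinf T) :=
  forall a (e : R[i]), 0 < e -> \forall t \near (0 : R)^',
    snorm a ((t^-1)%:C *: (f (xi + t *: delta_mx 0 i) - f xi) - w) < e.

Definition pderiv (i : 'I_n) (f : 'rV[R]_n -> cinf T) : 'rV[R]_n -> cinf T :=
  fun xi => xget 0 [set w | has_pderiv f i xi w].

Definition mpderiv (b : mindex) (f : 'rV[R]_n -> cinf T) :
    'rV[R]_n -> cinf T :=
  foldr (fun i => iter (b i) (pderiv i)) f (enum 'I_n).

Definition cinf_continuous_at (f : 'rV[R]_n -> cinf T) (xi : 'rV[R]_n) :=
  forall a (e : R[i]), 0 < e -> \forall x \near xi, snorm a (f x - f xi) < e.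

Definition smooth_on (V : set 'rV[R]_n) (f : 'rV[R]_n -> cinf T) :=
  forall (s : seq 'I_n) xi, V xi ->
    cinf_continuous_at (foldr pderiv f s) xi /\
    forall i, exists w, has_pderiv (foldr pderiv f s) i xi w.

(** t^q = exp (q log t), for t > 0 *)
Definition cpow (t : R) (q : R[i]) : R[i] :=
  (t `^ complex.Re q)%:C * expi (complex.Im q * ln t).

Definition homogeneous_symbol (q : R[i]) (rho : 'rV[R]_n -> cinf T) :=
  smooth_on [set xi | xi != 0] rho /\
  forall t xi, 0 < t -> xi != 0 -> rho (t *: xi) = cpow t q *: rho xi.

(** [rho] is in S^q, with the asymptotic expansion sum_j [rhos j]. *)
Definition classical_symbol (q : R[i]) (rho : 'rV[R]_n -> cinf T)
    (rhos : nat -> 'rV[R]_n -> cinf T) :=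
  [/\ smooth_on setT rho,
      forall j, homogeneous_symbol (q - j%:R) (rhos j) &
      forall (N : nat) (a b : mindex), exists M : R, forall xi, 1 <= enorm xi ->
        snorm a (mpderiv b (fun x => rho x - \sum_(j < N) rhos j x) xi) <=
          (M * enorm xi `^ (complex.Re q - N%:R - (msize b)%:R))%:C].

Definition quantize (rho : 'rV[R]_n -> cinf T) (u : cinf T) : T :=
  sum (fun k => coef u k *: ((rho (zvec R k) : T) ** Uk T k)).

(** [P] is the continuous extension to the distributions of P_rho. *)
Definition is_pdo (rho : 'rV[R]_n -> cinf T)
    (P : (cinf T -> R[i]) -> (cinf T -> R[i])) :=
  continuous_endo P /\
  forall u : cinf T, P (alg_dist u) = alg_dist (quantize rho u).

Definition Psi (q : R[i]) (P : (cinf T -> R[i]) -> (cinf T -> R[i])) :=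
  exists rho rhos, classical_symbol q rho rhos /\ is_pdo rho P.

Definition principal_symbol (q : R[i])
    (P : (cinf T -> R[i]) -> (cinf T -> R[i])) (rho_q : 'rV[R]_n -> cinf T) :=
  exists rho rhos,
    [/\ classical_symbol q rho rhos, is_pdo rho P & rho_q = rhos 0%N].

Definition cinf_invertible (u : cinf T) :=
  exists w : cinf T, (u : T) ** w = aone /\ (w : T) ** u = aone.

Definition elliptic (q : R[i]) (P : (cinf T -> R[i]) -> (cinf T -> R[i])) :=
  exists rho_q, principal_symbol q P rho_q /\
    forall xi, xi != 0 -> cinf_invertible (rho_q xi).

End Torus.

Record L2completion (R : realType) (n : nat) (theta : 'M[R]_n)
    (T : ncTorus theta) := L2Completion {
  L2_space :> hilbertType R;
  L2_in : {linear T -> L2_space};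
  L2_ip : forall u v, ip (L2_in u) (L2_in v) = trace (u ** star v);
  L2_dense : dense (range L2_in)
}.

Section Riemann.
Variables (R : realType) (H : normedModType R[i]).

Definition tagged_partition (a b : R) (N : nat) (x t : nat -> R) :=
  [/\ x 0%N = a, x N = b &
      forall i, (i < N)%N -> x i <= t i <= x i.+1].

(** Convergence of the Riemann sums in operator norm. *)
Definition is_op_integral (F : R -> H -> H) (a b : R) (I : H -> H) :=
  forall e : R[i], 0 < e -> exists d : R, 0 < d /\
    forall N x t, tagged_partition a b N x t ->
      (forall i, (i < N)%N -> x i.+1 - x i < d) ->
      forall v, `|\sum_(i < N) (x i.+1 - x i)%:C *: F (t i) v - I v|
                  <= e * `|v|.

Definition op_integral (F : R -> H -> H) (a b : R) : H -> H :=
  xget (fun=> 0) [set I | is_op_integral F a b I].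

(** The integral of [F zeta] d zeta over |zeta - lambda| = r,
    counterclockwise. *)
Definition circle_integral (F : R[i] -> H -> H) (lambda : R[i]) (r : R) :
    H -> H :=
  op_integral (fun s v =>
      ('i * r%:C * expi s) *: F (lambda + r%:C * expi s) v) 0 (2 * pi).

End Riemann.

Section L2Operators.
Variables (R : realType) (n : nat) (theta : 'M[R]_n) (T : ncTorus theta).
Variable H : L2completion T.

(** The inclusion of L_2 in the distributions, which extends
    <u, v> = tau (u v) = (u | v^* ). *)
Definition L2_dist (x : H) : cinf T -> R[i] :=
  fun v => ip x (L2_in H (star (v : T))).

Definition L2_graph (P : (cinf T -> R[i]) -> (cinf T -> R[i])) (m : R)
    (x y : H) :=
  sobolev m (L2_dist x) /\ P (L2_dist x) = L2_dist y.

(** [S] is the bounded inverse of zeta - P. *)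
Definition is_resolvent (P : (cinf T -> R[i]) -> (cinf T -> R[i])) (m : R)
    (zeta : R[i]) (S : H -> H) :=
  [/\ linear S, continuous S,
      forall y, exists2 z, L2_graph P m (S y) z & zeta *: S y - z = y &
      forall x z, L2_graph P m x z -> S (zeta *: x - z) = x].

Definition spectrum (P : (cinf T -> R[i]) -> (cinf T -> R[i])) (m : R) :
    set R[i] :=
  [set zeta | ~ exists S, is_resolvent P m zeta S].

Definition resolvent (P : (cinf T -> R[i]) -> (cinf T -> R[i])) (m : R)
    (zeta : R[i]) : H -> H :=
  xget (fun=> 0) [set S | is_resolvent P m zeta S].

Definition isolating_radius (P : (cinf T -> R[i]) -> (cinf T -> R[i])) (m : R)
    (lambda : R[i]) (r : R) :=
  0 < r /\
  forall mu, spectrum P m mu -> `|mu - lambda| <= r%:C -> mu = lambda.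

Definition spectral_projection (P : (cinf T -> R[i]) -> (cinf T -> R[i]))
    (m : R) (lambda : R[i]) (r : R) : H -> H :=
  fun x => (2 * 'i * pi%:C)^-1 *: circle_integral (resolvent P m) lambda r x.

Definition smoothing (Q : H -> H) :=
  exists S : (cinf T -> R[i]) -> cinf T,
    continuous_to_cinf S /\ forall x, Q x = L2_in H (S (L2_dist x) : T).

End L2Operators.

(* Main.v *)
(** On Fourier series, [P] is the infinite matrix with columns [rho k ** U^k].
    For [k != 0] let [sig k] be the inverse of the principal symbol [rho_q] at
    [k]; it is [O(|k|^-m)] together with its Fourier coefficients, by compactness
    of the sphere and a perturbation argument in weighted Wiener algebras.
    The vector [sig k ** U^k] is an approximate preimage of [U^k] under [P], and
    the test function [(U^k)^* ** sig k] an approximate preimage of the [k]-th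
    coefficient under the transpose of [P]: since the symbol is evaluated at the
    column index in the first case and [sig] at the row index in the second one,
    the products of symbols are exact, and the error only involves the
    differences [rho j - rho_q k], which are [O((1 + |j - k|)^L |k|^(m-1))].
    Therefore, if [R] is the resolvent at a point [mu], both [R^J U^k] and the
    [k]-th coefficient of [R^J y] are [O(|k|^(- J min(1, m)))].

    Taking [mu] on the circle and iterating the resolvent identity,
    [R(z) = \sum_(i < 2 J) (mu - z)^i R^(i+1) + (mu - z)^(2 J) R^J R(z) R^J],
    where the polynomial part does not contribute to the integral. So the
    matrix entries of the projection decay rapidly in both indices, and an
    operator with this property is smoothing. *)

Require Import Defs.
From HB Require Import structures.
From mathcomp Require Import all_boot all_order all_algebra.
From mathcomp Require Import finmap.
From mathcomp Require Import all_classical all_reals all_analysis.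
From mathcomp Require Import showcase.summability.
From mathcomp Require Import complex.
From mathcomp Require Import ring lra zify.

Import Order.TTheory GRing.Theory Num.Theory.
Import numFieldNormedType.Exports.
Local Open Scope classical_set_scope.
Local Open Scope ring_scope.
Local Open Scope complex_scope.

Set Implicit Arguments.
Unset Strict Implicit.
Unset Printing Implicit Defensive.

(** * Norms and infinite sums *)

(** Symbols at different points do not commute, and [rho k ** U^k] carries the symbol on the left.
    This is why columns consume [sig] as a right inverse and rows consume it as a left inverse, each
    argument freezing the principal symbol at one index. Each application of the resolvent gains [m]
    orders where it meets the size of [sig k] and one order where it meets the remainder, hence the
    exponent [min(1, m)]. Two obstacles shape the rest. The domain of [P] is described by
    distributions, whereas [P] is explicit only on smooth elements; the row estimates therefore
    carry an additive error, which disappears after approximating in [L2] and using the continuity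
    of [P] against a single test function. And the projection is reached only through Riemann sums,
    so every bound has to be uniform in the number of nodes: with roots of unity as nodes, the
    polynomial part vanishes in each sum and not merely in the limit. In the remaining term one
    [R^J] gives decay in the row index, the other in the column index, and [R(z)] between them is
    only bounded in operator norm. *)

Section RealNorm.
Variable R : realType.

(** Norms over [R[i]] are themselves complex numbers, with a partial order. Taking the real part
    moves all estimates to a real field, with suprema and [lra]. *)
Definition nrm {V : normedZmodType R[i]} (x : V) : R := complex.Re `|x|.

Lemma nrmE (V : normedZmodType R[i]) (x : V) : `|x| = (nrm x)%:C.
Proof. by rewrite /nrm RRe_real// ger0_real. Qed.

Lemma nrm_ge0 (V : normedZmodType R[i]) (x : V) : 0 <= nrm x.
Proof. by rewrite -ler0c -nrmE. Qed.

Lemma nrm0 (V : normedZmodType R[i]) : nrm (0 : V) = 0.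
Proof. by rewrite /nrm normr0. Qed.

Lemma nrmN (V : normedZmodType R[i]) (x : V) : nrm (- x) = nrm x.
Proof. by rewrite /nrm normrN. Qed.

Lemma nrmB (V : normedZmodType R[i]) (x y : V) : nrm (x - y) = nrm (y - x).
Proof. by rewrite /nrm distrC. Qed.

Lemma nrmD (V : normedZmodType R[i]) (x y : V) : nrm (x + y) <= nrm x + nrm y.
Proof. by rewrite -lecR rmorphD /= -!nrmE ler_normD. Qed.

Lemma nrm_eq0 (V : normedZmodType R[i]) (x : V) : nrm x = 0 -> x = 0.
Proof. by move=> h; apply/eqP; rewrite -normr_eq0 nrmE h. Qed.

Lemma nrmM (x y : R[i]) : nrm (x * y) = nrm x * nrm y.
Proof. by apply: complexI; rewrite rmorphM /= -!nrmE normrM. Qed.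

Lemma nrmX (x : R[i]) k : nrm (x ^+ k) = nrm x ^+ k.
Proof. by apply: complexI; rewrite rmorphXn /= -!nrmE normrX. Qed.

Lemma nrmZ (V : normedModType R[i]) (a : R[i]) (x : V) :
  nrm (a *: x) = nrm a * nrm x.
Proof. by apply: complexI; rewrite rmorphM /= -!nrmE normrZ. Qed.

Lemma nrm_real (x : R) : nrm (x%:C) = `|x|.
Proof. by rewrite /nrm normc_def /= expr0n addr0 sqrtr_sqr. Qed.

Lemma nrm_i : nrm ('i : R[i]) = 1.
Proof. by rewrite /nrm normc_def /= expr0n expr1n add0r sqrtr1. Qed.

Lemma nrm1 : nrm (1 : R[i]) = 1.
Proof. by rewrite /nrm normr1. Qed.

Lemma nrm_sum (V : normedZmodType R[i]) (I : Type) (s : seq I) (P : pred I)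
    (f : I -> V) :
  nrm (\sum_(i <- s | P i) f i) <= \sum_(i <- s | P i) nrm (f i).
Proof.
by rewrite -lecR rmorph_sum /= -nrmE (le_trans (ler_norm_sum _ _ _))//;
  apply: ler_sum => i _; rewrite nrmE.
Qed.

Lemma nrm_le (V : normedZmodType R[i]) (x : V) (r : R) :
  (nrm x <= r) = (`|x| <= r%:C).
Proof. by rewrite nrmE lecR. Qed.

Lemma nrm_lt (V : normedZmodType R[i]) (x : V) (r : R) :
  (nrm x < r) = (`|x| < r%:C).
Proof. by rewrite nrmE ltcR. Qed.

Lemma le_ReC (x y : R[i]) : x <= y -> complex.Re x <= complex.Re y.
Proof. by rewrite lecE => /andP[]. Qed.

Lemma gt0_ReC (x : R[i]) : 0 < x -> x = (complex.Re x)%:C /\ 0 < complex.Re x.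
Proof.
move=> x0; split; first by rewrite RRe_real// gtr0_real.
by move: x0; rewrite ltcE => /andP[].
Qed.

Lemma le_epsilon (x y : R) : (forall e, 0 < e -> x <= y + e) -> x <= y.
Proof. by move=> h; apply/ler_addgt0Pr. Qed.

End RealNorm.

Section Sums.
Variable R : realType.

(** For nonnegative [g] this is summability with total at most [M], expressed through finite partial
    sums only. *)
Definition bsum {K : choiceType} (g : K -> R) (M : R) :=
  forall A : {fset K}, \sum_(k <- A) g k <= M.

(** Unconditional convergence along finite subsets, in epsilon form; [hassum_cvg] identifies it with
    the filter convergence behind [smooth] and [sum]. *)
Definition hassum {K : choiceType} {V : normedZmodType R[i]} (f : K -> V)
    (x : V) :=
  forall e : R, 0 < e -> exists A : {fset K}, forall B : {fset K},
    (A `<=` B)%fset ->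
    nrm (\sum_(k <- B) f k - x) < e.

Section Zmod.
Variables (K : choiceType) (V W : normedZmodType R[i]).
Implicit Types (f g : K -> V) (x y : V).

Lemma eq_hassum f g x : f =1 g -> hassum f x -> hassum g x.
Proof. by move=> /funext ->. Qed.

Lemma morphB_sum (A : V -> W) (I : Type) (s : seq I) (f : I -> V) :
  {morph A : y z / y - z} -> A (\sum_(i <- s) f i) = \sum_(i <- s) A (f i).
Proof.
move=> AB; have A0 : A 0 = 0 by rewrite -(subrr 0) AB subrr.
by apply: (big_morph A) => // y z;
  rewrite -{1}(opprK z) AB -(sub0r z) AB A0 sub0r opprK.
Qed.

Lemma hassum_map (A : V -> W) (C : R) f x : {morph A : y z / y - z} ->
  (forall y, nrm (A y) <= C * nrm y) ->
  hassum f x -> hassum (fun k => A (f k)) (A x).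
Proof.
move=> AB AC fx e e0.
have C0 : 0 < `|C| + 1 by rewrite ltr_wpDl.
have [S hS] := fx (e / (`|C| + 1)) (divr_gt0 e0 C0).
exists S => B SB; rewrite -morphB_sum// -AB (le_lt_trans (AC _))//.
have := hS B SB; rewrite ltr_pdivlMr// => h; apply: le_lt_trans h.
rewrite mulrC ler_wpM2l ?nrm_ge0//.
by rewrite (le_trans (ler_norm _))// lerDl.
Qed.

Lemma hassumD f g x y : hassum f x -> hassum g y ->
  hassum (fun k => f k + g k) (x + y).
Proof.
move=> fx gy e e0.
have e2 : 0 < e / 2 by rewrite divr_gt0.
have [A hA] := fx _ e2; have [B hB] := gy _ e2.
exists (A `|` B)%fset => C; rewrite fsubUset => /andP[AC BC].
rewrite big_split /= opprD addrACA (le_lt_trans (nrmD _ _))//.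
by rewrite [e]splitr ltrD ?hA ?hB.
Qed.

Lemma hassumN f x : hassum f x -> hassum (fun k => - f k) (- x).
Proof.
move=> fx e e0; have [A hA] := fx _ e0; exists A => B AB.
by rewrite sumrN -opprD nrmN hA.
Qed.

Lemma hassumB f g x y : hassum f x -> hassum g y ->
  hassum (fun k => f k - g k) (x - y).
Proof. by move=> fx gy; apply: hassumD => //; apply: hassumN. Qed.

Lemma nrm_lt_eq0 x : (forall e, 0 < e -> nrm x < e) -> x = 0.
Proof.
move=> h; apply: nrm_eq0; apply/eqP; rewrite eq_le nrm_ge0 andbT.
by apply: le_epsilon => e /h /ltW; rewrite add0r.
Qed.

Lemma hassum_uniq f x y : hassum f x -> hassum f y -> x = y.
Proof.
move=> fx fy; apply/eqP; rewrite -subr_eq0; apply/eqP;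
  apply: nrm_lt_eq0 => e e0.
have e2 : 0 < e / 2 by rewrite divr_gt0.
have [A hA] := fx _ e2; have [B hB] := fy _ e2.
rewrite -(subrKA (\sum_(k <- (A `|` B)%fset) f k)) (le_lt_trans (nrmD _ _))//.
by rewrite [e]splitr ltrD// ?[nrm (x - _)]nrmB ?hA ?hB// ?fsubsetUl ?fsubsetUr.
Qed.

Lemma hassum_fin f (A : {fset K}) : (forall k, k \notin A -> f k = 0) ->
  hassum f (\sum_(k <- A) f k).
Proof.
move=> fA e e0; exists A => B AB.
by rewrite (big_fset_incl _ AB) ?subrr ?nrm0// => k _ /fA.
Qed.

Lemma hassum1 (j : K) (x : V) : hassum (fun k => if k == j then x else 0) x.
Proof.
have := @hassum_fin (fun k => if k == j then x else 0) [fset j]%fset.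
rewrite big_seq_fset1 eqxx; apply => k; rewrite in_fset1 => /negbTE -> //.
Qed.

Lemma hassum_le f x (g : K -> R) (M : R) : hassum f x ->
  (forall k, nrm (f k) <= g k) -> bsum g M -> nrm x <= M.
Proof.
move=> fx fg gM; apply: le_epsilon => e e0; have [A hA] := fx e e0.
rewrite -[x](subKr (\sum_(k <- A) f k)) (le_trans (nrmD _ _))// nrmN lerD//.
  rewrite (le_trans (nrm_sum _ _ _))// (le_trans _ (gM A))//.
  exact: ler_sum.
exact/ltW/hA.
Qed.

Lemma hassum_reindex (L : choiceType) (h : L -> K) (h' : K -> L) f x :
  cancel h h' -> cancel h' h -> hassum f x -> hassum (fun l => f (h l)) x.
Proof.
move=> hK h'K fx e e0; have [A hA] := fx e e0.
exists [fset h' k | k in A]%fset => B AB.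
have -> : \sum_(l <- B) f (h l) = \sum_(k <- [fset h l | l in B]%fset) f k.
  by rewrite big_imfset//= => l1 l2 _ _ /(congr1 h'); rewrite !hK.
apply: hA; apply/fsubsetP => k kA; apply/imfsetP => /=; exists (h' k) => //.
by apply: (fsubsetP AB); rewrite in_imfset.
Qed.

End Zmod.

Lemma lin_bounded (V W : normedModType R[i]) (A : V -> W) :
  linear A -> continuous A -> exists2 C : R, 0 < C & forall x,
    nrm (A x) <= C * nrm x.
Proof.
move=> Al Ac.
have A0 : A 0 = 0 by have := Al (-1) 0 0; rewrite scaler0 addr0 scaleN1r addNr.
have AZ a x : A (a *: x) = a *: A x.
  by rewrite -[a *: x]addr0 Al A0 addr0.
have /cvgrPdist_lt /(_ 1 ltr01) := Ac 0; rewrite A0 => h.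
have /nbhs_normP[d' /= /gt0_ReC[d'E d0]] : \forall x \near (0 : V),
  `|0 - A x| < 1 by [].
rewrite d'E; set d := complex.Re _ in d0 * => hd.
exists (2 / d); first by rewrite divr_gt0.
move=> x; have [->|x0] := eqVneq x 0; first by rewrite A0 !nrm0 mulr0.
have nx : 0 < nrm x by rewrite -ltcR -nrmE normr_gt0.
(* This factor gives [a x] the norm [d / 2], inside the ball of radius [d] on which [A] has norm
   below 1. *)
pose a := d / (2 * nrm x).
have a0 : 0 < a by rewrite divr_gt0// mulr_gt0.
have : nrm (A (a%:C *: x)) < 1.
  rewrite nrm_lt -normrN -sub0r; apply: hd;
    rewrite /ball_ /= sub0r normrN -nrm_lt.
  rewrite nrmZ nrm_real gtr0_norm// /a -mulrA invfM -mulrA mulVf ?gt_eqF//.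
  by rewrite mulr1 gtr_pMr// invf_lt1// ltr1n.
rewrite AZ nrmZ nrm_real gtr0_norm// mulrC -ltr_pdivlMr// => /ltW/le_trans;
  apply.
by rewrite mul1r /a invfM invrK mulrCA mulrA.
Qed.

Lemma hassum_cvg (K : choiceType) (V : normedModType R[i]) (f : K -> V) x :
  hassum f x <-> partial_sum f @ totally --> x.
Proof.
have FF := @totally_filter K.
have ps B : partial_sum f B = \sum_(k <- B) f k.
  by rewrite /partial_sum big_seq_fsetE.
split.
  move=> fx; apply/cvgrPdist_lt => e /gt0_ReC[-> /fx[A hA]].
  exists A => // B /= AB; rewrite distrC nrmE ltcR ps; exact: hA.
move=> /cvgrPdist_lt fx e e0; have e0c : 0 < e%:C by rewrite ltcR.
have [A _ hA] := fx _ e0c; exists A => B AB.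
by rewrite nrmB nrm_lt -ps; exact: hA.
Qed.

Lemma hassum_sum (K : choiceType) (V : normedModType R[i]) (f : K -> V) x :
  hassum f x -> summability.sum f = x.
Proof.
have FF := @totally_filter K.
by move=> /hassum_cvg; apply: cvg_lim; exact: norm_hausdorff.
Qed.

Lemma sum_fsetD (K : choiceType) (V : nmodType) (A B : {fset K}) (h : K -> V) :
  (A `<=` B)%fset ->
  \sum_(k <- B) h k = \sum_(k <- A) h k + \sum_(k <- (B `\` A)%fset) h k.
Proof.
move=> AB; rewrite (big_fsetID _ (mem A)) /=; congr (_ + _).
  congr bigop; congr enum_fset; apply/fsetP => k; rewrite !inE /=.
  by case: (boolP (k \in A)) => [/(fsubsetP AB) ->|]; rewrite ?andbF.
congr bigop; congr enum_fset; apply/fsetP => k; rewrite !inE /=.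
by rewrite andbC.
Qed.

(** A finite set that nearly attains the supremum of the partial sums of [g] leaves less than [e]
    for all other indices, so the partial sums of [f] are Cauchy. *)
Lemma hassum_ex (K : choiceType) (V : completeNormedModType R[i]) (f : K -> V)
    (g : K -> R) M :
  (forall k, nrm (f k) <= g k) -> bsum g M -> exists x, hassum f x.
Proof.
have FF := @totally_filter K.
move=> fg gM.
have ps B : partial_sum f B = \sum_(k <- B) f k.
  by rewrite /partial_sum big_seq_fsetE.
suff /cvg_ex[x fx] : cvg (partial_sum f @ totally) by exists x;
  apply/hassum_cvg.
apply: cauchy_cvg; apply: cauchy_exP => e /gt0_ReC[-> e0].
pose E := [set \sum_(k <- A) g k | A in [set: {fset K}]].
have supE : has_sup E.
  split; first by exists (\sum_(k <- fset0) g k), fset0.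
  by exists M => _ [A _ <-].
have [_ [A _ <-] hA] := sup_adherent e0 supE.
exists (partial_sum f A); exists A => // B /= AB.
rewrite -ball_normE /ball_ /= !ps -nrm_lt nrmB.
rewrite (sum_fsetD f AB) addrC addKr.
apply: (@le_lt_trans _ _ (\sum_(k <- (B `\` A)%fset) g k)).
  by rewrite (le_trans (nrm_sum _ _ _))// ler_sum.
rewrite -(ltrD2l (\sum_(k <- A) g k)) -(sum_fsetD g AB) -ltrBlDr.
apply: le_lt_trans hA; rewrite lerB// sup_upper_bound//.
by exists B.
Qed.

End Sums.

(** * Polynomial weights on the lattice *)

(** The l1 norm is preferred to the Euclidean one because the weight is then a positive natural
    number and its submultiplicativity is plain arithmetic. The comparison with [enorm] costs a
    factor [n.+1]. *)
Definition wt {n : nat} (k : 'rV[int]_n) : nat :=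
  (\sum_(i < n) `|k ord0 i|%N).+1.

(* [pw k s] is the weight [(1 + |k_1| + ... + |k_n|) ^ s]. It is locked because
   failed conversion tests between powers are very slow. *)
HB.lock Definition pw (R : realType) (n : nat) (k : 'rV[int]_n) (s : R) : R :=
  (wt k)%:R `^ s.
Arguments pw {R n}.

Section Weights.
Variables (R : realType).

(** Both comparisons are assumed so that the two signs of [s] are covered: a negative exponent
    exchanges the roles of [x] and [y]. *)
Lemma powR_compare (c x y s : R) : 0 < x -> 0 < y -> 1 <= c ->
  x <= c * y -> y <= c * x -> x `^ s <= c `^ `|s| * y `^ s.
Proof.
move=> x0 y0 c1 xy yx; have c0 : 0 < c by rewrite (lt_le_trans ltr01).
have [x0' y0' c0'] : [/\ 0 <= x, 0 <= y & 0 <= c] by rewrite !ltW.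
have [s0|s0] := leP 0 s.
  rewrite ger0_norm// -powRM//.
  by apply: ge0_ler_powR; rewrite ?nnegrE// mulr_ge0.
rewrite ltr0_norm// -[X in x `^ X]opprK -[X in y `^ X]opprK.
rewrite (powRN x (- s)) (powRN y (- s)).
rewrite ler_pdivlMr ?powR_gt0// mulrC ler_pdivrMr ?powR_gt0//.
rewrite -powRM//.
by apply: ge0_ler_powR; rewrite ?nnegrE ?mulr_ge0// oppr_ge0 ltW.
Qed.

Variable n : nat.
Implicit Types (k l : 'rV[int]_n) (s t : R).

Lemma wt0 : wt (0 : 'rV[int]_n) = 1%N.
Proof. by rewrite /wt big1// => i _; rewrite mxE. Qed.

Lemma wtN k : wt (- k) = wt k.
Proof. by congr S; apply: eq_bigr => i _; rewrite mxE abszN. Qed.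

Lemma wtD k l : (wt (k + l) <= wt k * wt l)%N.
Proof.
rewrite /wt; set a := (\sum_i _)%N; set b := (\sum_i _)%N;
  set c := (\sum_i _)%N.
suff abc : (a <= b + c)%N.
  by rewrite mulSn mulnS addSn ltnS (leq_trans abc)// addnA (addnC c) leq_addr.
by rewrite /a /b /c -big_split leq_sum// => i _; rewrite mxE /=; lia.
Qed.

Lemma pwE k s : pw k s = (wt k)%:R `^ s.
Proof. by rewrite pw.unlock. Qed.

Lemma wt_gt0 k : 0 < (wt k)%:R :> R. Proof. by rewrite ltr0n. Qed.
Hint Resolve wt_gt0 : core.

Lemma wt_ge1 k : 1 <= (wt k)%:R :> R. Proof. by rewrite ler1n. Qed.

Lemma pw_gt0 k s : 0 < pw k s. Proof. by rewrite pwE; exact: powR_gt0. Qed.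

Lemma pw_ge0 k s : 0 <= pw k s. Proof. by rewrite pwE; exact: powR_ge0. Qed.

Lemma pwD k s t : pw k (s + t) = pw k s * pw k t.
Proof. by rewrite !pwE powRD// (gt_eqF (wt_gt0 k)) implybT. Qed.

Lemma pw0 k : pw k 0 = 1 :> R. Proof. by rewrite pwE powRr0. Qed.

Lemma pw0l s : pw (0 : 'rV[int]_n) s = 1. Proof. by rewrite !pwE wt0 powR1. Qed.

Lemma pwN k s : pw (- k) s = pw k s. Proof. by rewrite !pwE wtN. Qed.

Lemma pwV k s : pw k (- s) = (pw k s)^-1. Proof. by rewrite !pwE powRN. Qed.

Lemma pw_nat k (N : nat) : pw k N%:R = ((wt k) ^ N)%:R :> R.
Proof. by rewrite !pwE powR_mulrn// natrX. Qed.

Lemma ler_pw k s t : s <= t -> pw k s <= pw k t.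
Proof. by move=> st; rewrite !pwE ler_powR// ler1n. Qed.

Lemma pw_le1 k s : s <= 0 -> pw k s <= 1.
Proof. by move=> /(ler_pw k); rewrite pw0. Qed.

Lemma pw_ge1 k s : 0 <= s -> 1 <= pw k s.
Proof. by move=> /(ler_pw k); rewrite pw0. Qed.

(** Peetre's inequality, from submultiplicativity and evenness of [wt]. It moves a weight from one
    index to another at the price of a power of their difference, which rapid decay off the diagonal
    can absorb. *)
Lemma pw_peetre k l s : pw (k + l) s <= pw l `|s| * pw k s.
Proof.
rewrite !pwE powR_compare ?wt_ge1//.
  by rewrite -natrM ler_nat mulnC wtD.
by rewrite -natrM ler_nat -{1}(addrK l k) mulnC -(wtN l) wtD.
Qed.

Lemma pw_peetreB k l s : pw k s <= pw (k - l) `|s| * pw l s.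
Proof. by rewrite -{1}(subrK l k) addrC pw_peetre. Qed.

End Weights.
#[export] Hint Extern 0 (is_true (0 <= pw _ _)) => exact: pw_ge0 : core.
#[export] Hint Extern 0 (is_true (0 < pw _ _)) => exact: pw_gt0 : core.
#[export] Hint Extern 0 (is_true (0 <= nrm _)) => exact: nrm_ge0 : core.

(** * Summability of the weights over the lattice *)

Section Summability.
Variable R : realType.

Definition inv_sqr (z : int) : R := (`|z|.+1%:R ^+ 2)^-1.

Lemma inv_sqr_ge0 z : 0 <= inv_sqr z. Proof. by rewrite invr_ge0 exprn_ge0. Qed.

Lemma sum_inv_sqr (M : nat) : \sum_(j < M.*2.+1) inv_sqr (j%:Z - M%:Z) <= 3.
Proof.
(* The sharper bound makes the induction close: the two new terms are [1 / (M + 2)^2] each, and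
   together they are at most [2 / (M + 1) - 2 / (M + 2)], which telescopes. *)
suff : \sum_(j < M.*2.+1) inv_sqr (j%:Z - M%:Z) <= 3 - 2 / M.+1%:R.
  by move/le_trans; apply; rewrite gerBl divr_ge0.
elim: M => [|M IH].
  by rewrite big_ord_recl big_ord0 /inv_sqr subrr absz0 expr1n invr1 addr0; lra.
rewrite doubleS big_ord_recr big_ord_recl /=.
rewrite (eq_bigr (fun i : 'I_(M.*2.+1) => inv_sqr (i%:Z - M%:Z))); last first.
  by move=> i _; congr inv_sqr; rewrite /bump /=; lia.
rewrite (_ : inv_sqr (0 - M.+1%:Z) = (M.+2%:R ^+ 2)^-1);
  last by rewrite sub0r /inv_sqr abszN.
rewrite (_ : inv_sqr _ = (M.+2%:R ^+ 2)^-1); last by rewrite /inv_sqr;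
  congr (_%:R ^+ 2)^-1; lia.
have : 2 * (M.+2%:R ^+ 2)^-1 <= 2 / M.+1%:R - 2 / M.+2%:R :> R.
  rewrite -mulrBr ler_pM2l//.
  have -> : M.+1%:R^-1 - M.+2%:R^-1 = (M.+1%:R * M.+2%:R)^-1 :> R.
    have : 0 < M.+1%:R :> R by rewrite ltr0n.
    rewrite -[M.+2%:R]natr1; set x := M.+1%:R => x0; field.
    by apply/andP; split; rewrite gt_eqF// ltr_wpDr.
  by rewrite lef_pV2 ?posrE ?mulr_gt0 ?exprn_gt0// expr2 ler_wpM2r ?ler_nat.
move: IH; move: (\sum_(i < _) _) (M.+2%:R ^- 2) (M.+1%:R^-1) (M.+2%:R^-1)
  => S a b c; lra.
Qed.

(** Since [wt k] is at least [1 + |k_i|] for each of the [n] coordinates, [(wt k)^(2 n)] is at least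
    the product of the [(1 + |k_i|)^2]. Over a box containing [A] the sum of the inverses factors
    into [n] one-dimensional sums, each at most 3. This is the origin of every [2 * n] and [3 ^+ n]
    below. *)
Lemma bsum_pw (n : nat) : bsum (fun k : 'rV[int]_n => pw k (- (2 * n)%:R) : R)
  (3 ^+ n).
Proof.
move=> A; pose M := (\sum_(k <- A) wt k)%N.
have AM k i : k \in A -> (`|k ord0 i| <= M)%N.
  move=> kA; rewrite /M (big_fsetD1 k)//= (leq_trans _ (leq_addr _ _))//.
  by rewrite /wt (bigD1 i)//= leqW// leq_addr.
pose h (f : {ffun 'I_n -> 'I_(M.*2.+1)}) : 'rV[int]_n :=
  \row_i ((f i)%:Z - M%:Z).
have hinj : injective h.
  move=> f g /rowP fg; apply/ffunP => i; apply: val_inj => /=.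
  by have := fg i; rewrite !mxE; lia.
pose G (k : 'rV[int]_n) : R := \prod_(i < n) inv_sqr (k ord0 i).
have G0 k : 0 <= G k by apply: prodr_ge0 => i _; exact: inv_sqr_ge0.
apply: (@le_trans _ _ (\sum_(k <- A) G k)).
  apply: ler_sum => k _; rewrite pwV pw_nat /G prodfV lef_pV2 ?posrE;
    last 2 first.
  - by rewrite ltr0n expn_gt0.
  - by apply: prodr_gt0 => i _; rewrite exprn_gt0.
  rewrite expnM !natrX.
  have -> : ((wt k)%:R ^+ 2) ^+ n = \prod_(i < n) ((wt k)%:R ^+ 2 : R).
    by rewrite prodr_const card_ord.
  apply: ler_prod => i _.
  rewrite !exprn_ge0//= lerXn2r ?nnegrE// ler_nat /wt (bigD1 i)//= ltnS.
  exact: leq_addr.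
have -> : 3 ^+ n = \prod_(i < n) (3 : R) by rewrite prodr_const card_ord.
apply: (@le_trans _ _ (\prod_(i < n) \sum_(j < M.*2.+1)
  inv_sqr (j%:Z - M%:Z))); last first.
  by apply: ler_prod => i _; rewrite sum_inv_sqr sumr_ge0// => j _;
    exact: inv_sqr_ge0.
rewrite bigA_distr_bigA /=.
have -> : \sum_(f : {ffun 'I_n ->
  'I_(M.*2.+1)}) \prod_i inv_sqr ((f i)%:Z - M%:Z)
    = \sum_(k <- [fset h f | f in {: {ffun 'I_n -> 'I_(M.*2.+1)}}]%fset) G k.
  rewrite big_imfset /=; last by move=> ? ? _ _; exact: hinj.
  rewrite big_enum /=; apply: eq_bigr => f _; apply: eq_bigr => i _.
  by rewrite mxE.
have AB : (A `<=` [fset h f | f in {: {ffun 'I_n -> 'I_(M.*2.+1)}}])%fset.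
  apply/fsubsetP => k kA; apply/imfsetP => /=.
  exists [ffun i => inord `|(k ord0 i + M%:Z)%R|%N] => //; apply/rowP => i.
  rewrite mxE ffunE; have := AM k i kA; move: (k ord0 i) => z zM.
  by rewrite inordK; [lia|rewrite -addnn; lia].
by rewrite (sum_fsetD _ AB) lerDl sumr_ge0.
Qed.

End Summability.

(** * Monomials *)

Section Algebra.
Variables (R : realType) (A : cstarType R).
Implicit Types (x y z u v : A) (a b c : R[i]).

Lemma amulDl x y z : (x + y) ** z = x ** z + y ** z.
Proof. by have := amul_linearl z 1 x y; rewrite !scale1r. Qed.

Lemma amulDr x y z : x ** (y + z) = x ** y + x ** z.
Proof. by have := amul_linearr x 1 y z; rewrite !scale1r. Qed.

Lemma amul0l x : 0 ** x = 0 :> A.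
Proof. by apply: (addrI (0 ** x)); rewrite -amulDl !addr0. Qed.

Lemma amul0r x : x ** 0 = 0 :> A.
Proof. by apply: (addrI (x ** 0)); rewrite -amulDr !addr0. Qed.

Lemma amulZl a x y : (a *: x) ** y = a *: (x ** y).
Proof. by have := amul_linearl y a x 0; rewrite !addr0 amul0l addr0. Qed.

Lemma amulZr a x y : x ** (a *: y) = a *: (x ** y).
Proof. by have := amul_linearr x a y 0; rewrite !addr0 amul0r addr0. Qed.

Lemma amulNl x y : (- x) ** y = - (x ** y).
Proof. by rewrite -[- x]scaleN1r amulZl scaleN1r. Qed.

Lemma amulNr x y : x ** (- y) = - (x ** y).
Proof. by rewrite -[- y]scaleN1r amulZr scaleN1r. Qed.

Lemma amulBl x y z : (x - y) ** z = x ** z - y ** z.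
Proof. by rewrite amulDl amulNl. Qed.

Lemma amulBr x y z : x ** (y - z) = x ** y - x ** z.
Proof. by rewrite amulDr amulNr. Qed.

Lemma nrm_amul x y : nrm (x ** y) <= nrm x * nrm y.
Proof. by rewrite nrm_le rmorphM /= -!nrmE amul_norm. Qed.

Lemma starD x y : star (x + y) = star x + star y.
Proof. by have := star_semilinear 1 x y; rewrite !scale1r rmorph1 scale1r. Qed.

Lemma star0 : star (0 : A) = 0.
Proof. by apply: (addrI (star 0)); rewrite -starD !addr0. Qed.

Lemma starZ a x : star (a *: x) = a^* *: star x.
Proof. by have := star_semilinear a x 0; rewrite star0 !addr0. Qed.

Lemma starB x y : star (x - y) = star x - star y.
Proof. by rewrite starD -scaleN1r starZ rmorphN rmorph1 scaleN1r. Qed.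

Lemma star1 : star (aone : A) = aone.
Proof. by rewrite -[LHS]amul1r -{2}(starK aone) -starM amul1r starK. Qed.

Lemma nrm_star x : nrm (star x) = nrm x.
Proof.
have le y : nrm y <= nrm (star y).
  have [->|y0] := eqVneq y 0; first by rewrite nrm0 nrm_ge0.
  have ny : 0 < nrm y by rewrite -ltcR -nrmE normr_gt0.
  rewrite -(ler_pM2r ny) -expr2 (le_trans _ (nrm_amul _ _))//.
  by rewrite -lecR -nrmE cstar_identity nrmE rmorphXn.
by apply/eqP; rewrite eq_le le andbT -{2}(starK x) le.
Qed.

Lemma nrm_unitary u : (aone : A) != 0 -> unitary u -> nrm u = 1.
Proof.
move=> one0 [uu _].
have sq y : star y ** y = aone -> nrm y ^+ 2 = nrm (aone : A).
  by move=> h; apply: complexI; rewrite rmorphXn /= -!nrmE -cstar_identity h.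
have n1 : nrm (aone : A) = 1.
  have := sq aone; rewrite star1 amul1l => /(_ erefl).
  have : nrm (aone : A) != 0 by apply: contraNneq one0 => /nrm_eq0 ->.
  by move=> h /eqP; rewrite expr2 -subr_eq0 -{3}[nrm _]mulr1 -mulrBr mulf_eq0
    (negbTE h) subr_eq0 => /eqP.
have := sq u uu; rewrite n1 => /eqP; rewrite sqrp_eq1 ?nrm_ge0//.
by move/eqP.
Qed.

(** Monomials are closed under product and star only up to a scalar of modulus one depending on
    [theta]. As only norms are estimated, the scalar can stay anonymous. *)
Definition phase_eq x y := exists2 c, nrm c = 1 & x = c *: y.

Lemma nrm_neq0 c : nrm c = 1 -> c != 0.
Proof. by move=> h; apply/eqP => c0; move: h; rewrite c0 nrm0 => /eqP;
  rewrite eq_sym oner_eq0. Qed.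

Lemma nrmVc c : nrm c = 1 -> nrm c^-1 = 1.
Proof.
move=> c1; have : nrm (c * c^-1) = 1 by rewrite divff ?nrm1// nrm_neq0.
by rewrite nrmM c1 mul1r.
Qed.

Lemma nrmJ c : nrm c^* = nrm c.
Proof. by rewrite /nrm normcJ. Qed.

Lemma phase_eq_refl x : phase_eq x x.
Proof. by exists 1; rewrite ?nrm1 ?scale1r. Qed.

Lemma phase_eq_sym x y : phase_eq x y -> phase_eq y x.
Proof.
by case=> c c1 ->; exists c^-1;
  rewrite ?nrmVc// scalerA mulVf ?scale1r ?nrm_neq0.
Qed.

Lemma phase_eq_trans y x z : phase_eq x y -> phase_eq y z -> phase_eq x z.
Proof.
move=> [c c1 ->] [d d1 ->]; exists (c * d); last by rewrite scalerA.
by rewrite nrmM c1 d1 mulr1.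
Qed.

Lemma phase_eqM x y x' y' : phase_eq x x' -> phase_eq y y' ->
  phase_eq (x ** y) (x' ** y').
Proof.
move=> [c c1 ->] [d d1 ->]; exists (c * d); first by rewrite nrmM c1 d1 mulr1.
by rewrite amulZl amulZr scalerA.
Qed.

Lemma phase_eq_star x y : phase_eq x y -> phase_eq (star x) (star y).
Proof. by move=> [c c1 ->]; exists c^*; rewrite ?nrmJ// starZ. Qed.

Lemma upow_nat_comm u (m : nat) : iter m (amul u)
  aone ** u = u ** iter m (amul u) aone.
Proof. by elim: m => [|m IH] /=; rewrite ?amul1l ?amul1r// -amulA IH. Qed.

Lemma upowS u (z : int) : unitary u -> upow u (z + 1) = upow u z ** u.
Proof.
move=> [uu _]; case: z => m.
  by rewrite -[1]/(1%:Z) -PoszD addn1 /= upow_nat_comm.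
case: m => [|m]; first by rewrite /= amul1r uu.
have -> : (Negz m.+1 + 1 = Negz m)%R by lia.
have -> : upow u (Negz m.+1) = iter m.+1 (amul (star u)) aone ** star u.
  by rewrite upow_nat_comm.
by rewrite -amulA uu amul1r.
Qed.

Lemma upowD u (z z' : int) : unitary u ->
  upow u (z + z') = upow u z ** upow u z'.
Proof.
move=> uu; have key w (m : nat) : upow u (w + m%:Z)
  = upow u w ** iter m (amul u) aone.
  elim: m w => [|m IH] w; first by rewrite addr0 /= amul1r.
  by rewrite -add1n PoszD addrA IH upowS//= amulA.
case: z' => m; first exact: key.
have inv (m' : nat) : iter m' (amul u) aone ** iter m' (amul (star u))
  aone = aone.
  elim: m' => [|m' IH] /=; first by rewrite amul1l.
  by rewrite -upow_nat_comm -amulA [u ** _]amulA (proj2 uu) amul1l IH.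
(* For a negative second exponent, [m.+1] factors [u] are split off [z]; they cancel against the
   factors [star u]. *)
rewrite -{2}(subrK m.+1%:Z z) key -amulA inv amul1r.
by congr upow; lia.
Qed.

Lemma unitaryM u v : unitary u -> unitary v -> unitary (u ** v).
Proof.
move=> [u1 u2] [v1 v2]; split; rewrite starM.
  by rewrite -amulA [star u ** _]amulA u1 amul1l v1.
by rewrite -amulA [v ** _]amulA v2 amul1l u2.
Qed.

Lemma unitary_star u : unitary u -> unitary (star u).
Proof. by move=> [u1 u2]; split; rewrite starK. Qed.

Lemma unitary1 : unitary (aone : A).
Proof. by split; rewrite star1 amul1l. Qed.

Lemma unitary_iter u m : unitary u -> unitary (iter m (amul u) aone).
Proof. by move=> uu; elim: m => [|m IH]; [exact: unitary1|exact: unitaryM]. Qed.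

Lemma unitary_upow u (z : int) : unitary u -> unitary (upow u z).
Proof.
by move=> uu; case: z => m; apply: unitary_iter => //; exact: unitary_star.
Qed.

Definition phase_comm x y := phase_eq (x ** y) (y ** x).

Lemma phase_comm_sym x y : phase_comm x y -> phase_comm y x.
Proof. exact: phase_eq_sym. Qed.

Lemma phase_commM x y z : phase_comm x z -> phase_comm y z ->
  phase_comm (x ** y) z.
Proof.
move=> xz yz; rewrite /phase_comm -amulA.
apply: (phase_eq_trans (phase_eqM (phase_eq_refl x) yz)); rewrite !amulA.
by apply: phase_eqM => //; exact: phase_eq_refl.
Qed.

Lemma phase_comm1 x : phase_comm aone x.
Proof. by rewrite /phase_comm amul1l amul1r; exact: phase_eq_refl. Qed.

Lemma phase_comm_star u x : unitary u -> phase_comm u x ->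
  phase_comm (star u) x.
Proof.
move=> [u1 u2] ux.
have : phase_eq (star u ** (u ** x) ** star u) (star u ** (x ** u) ** star u).
  by do 2?[apply: phase_eqM => //]; exact: phase_eq_refl.
by rewrite amulA u1 amul1l -!amulA u2 amul1r => /phase_eq_sym.
Qed.

Lemma phase_comm_upow u x (z : int) : unitary u -> phase_comm u x ->
  phase_comm (upow u z) x.
Proof.
move=> uu ux; case: z => m.
  elim: m => [|m IH]; [exact: phase_comm1|exact: phase_commM].
have ux' := phase_comm_star uu ux; rewrite /upow.
by elim: m.+1 => [|j IH]; [exact: phase_comm1|exact: phase_commM].
Qed.

(** Each factor [g i] is moved to the left past the remaining [f j], every exchange costing a
    phase. *)
Lemma phase_eq_bigM (I : eqType) (s : seq I) (f g : I -> A) :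
  (forall i j, phase_comm (f i) (g j)) ->
  phase_eq ((\big[amul/aone]_(i <- s) f i) ** (\big[amul/aone]_(i <- s) g i))
      (\big[amul/aone]_(i <- s) (f i ** g i)).
Proof.
move=> fg; elim: s => [|i s IH].
  by rewrite !big_nil amul1l; exact: phase_eq_refl.
rewrite !big_cons -amulA [X in phase_eq (_ ** X)]amulA -[f i ** g i ** _]amulA.
apply: phase_eqM; first exact: phase_eq_refl.
apply: (@phase_eq_trans (g i ** (\big[amul/aone]_(j <- s) f j)
  ** (\big[amul/aone]_(j <- s) g j))).
  apply: phase_eqM; last exact: phase_eq_refl.
  elim: s {IH} => [|j s IH]; first by rewrite !big_nil; exact: phase_comm1.
  by rewrite big_cons; exact: phase_commM.
by rewrite -amulA; apply: phase_eqM => //; exact: phase_eq_refl.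
Qed.

End Algebra.

Section Monomials.
Variables (R : realType) (n : nat) (theta : 'M[R]_n) (T : ncTorus theta).
Implicit Types (k l j : 'rV[int]_n) (u v : T).
Local Notation U := (Uk T).

Lemma U_unitary k : unitary (U k).
Proof.
rewrite /Uk /monomial; elim/big_rec: _ => [|i x _]; first exact: unitary1.
by apply: unitaryM; apply: unitary_upow; have [] := nct_relations T.
Qed.

Lemma gen_phase_comm (i i' : 'I_n) : phase_comm (nct_gen T i) (nct_gen T i').
Proof.
have [_ rel] := nct_relations T; rewrite /phase_comm rel;
  exists (expi (2 * pi * theta i' i)) => //.
by rewrite /nrm normc_def /= cos2Dsin2 sqrtr1.
Qed.

Lemma U_mul k l : phase_eq (U k ** U l) (U (k + l)).
Proof.
have [gu _] := nct_relations T.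
have -> : U (k + l) =
    \big[amul/aone]_(i < n) (upow (nct_gen T i) (k 0 i) ** upow (nct_gen T i)
      (l 0 i)).
  by apply: eq_bigr => i _; rewrite mxE upowD.
apply: phase_eq_bigM => i i'; apply: phase_comm_upow => //;
  apply: phase_comm_sym.
by apply: phase_comm_upow => //; exact: gen_phase_comm.
Qed.

Lemma U0 : U 0 = aone.
Proof. by rewrite /Uk /monomial big1// => i _; rewrite mxE. Qed.

Lemma trace1 : trace (aone : T) = 1.
Proof. by rewrite -U0 trace_monomial eqxx. Qed.

Lemma traceZ a u : trace (a *: u) = a * trace u.
Proof.
have tl := @trace_scalar _ _ _ T.
have t0 : trace (0 : T) = 0.
  by have := tl (-1) 0 0; rewrite scaler0 addr0 mulN1r addNr.
by have := tl a u 0; rewrite t0 !addr0.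
Qed.

Lemma traceD u v : trace (u + v) = trace u + trace v.
Proof. by have := @trace_scalar _ _ _ T 1 u v; rewrite scale1r mul1r. Qed.

Lemma traceN u : trace (- u) = - trace u.
Proof. by rewrite -scaleN1r traceZ mulN1r. Qed.

Lemma traceB u v : trace (u - v) = trace u - trace v.
Proof. by rewrite traceD traceN. Qed.

Lemma aone_neq0 : (aone : T) != 0.
Proof.
apply/eqP => h; have := trace1; rewrite h -(scale0r 0) traceZ mul0r.
by move=> /eqP; rewrite eq_sym oner_eq0.
Qed.

Lemma nrm_U k : nrm (U k) = 1.
Proof. by apply: nrm_unitary; [exact: aone_neq0|exact: U_unitary]. Qed.

Lemma star_U k : phase_eq (star (U k)) (U (- k)).
Proof.
have [c c1 h] := U_mul k (- k); rewrite addrN U0 in h.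
have := congr1 (amul (star (U k))) h.
rewrite amulA (proj1 (U_unitary k)) amul1l amulZr amul1r => ->.
by apply: phase_eq_sym; exists c.
Qed.

Lemma U_mul_star k l : phase_eq (U k ** star (U l)) (U (k - l)).
Proof. exact: phase_eq_trans (phase_eqM (phase_eq_refl _) (star_U l))
  (U_mul _ _). Qed.

Lemma star_U_mul k l : phase_eq (star (U k) ** U l) (U (l - k)).
Proof.
by rewrite addrC; exact: phase_eq_trans (phase_eqM (star_U k)
  (phase_eq_refl _)) (U_mul _ _).
Qed.

Lemma coef_U j k : coef (U j) k = (j == k)%:R.
Proof.
rewrite /coef; case: eqVneq => [->|jk].
  by rewrite (proj2 (U_unitary k)) trace1.
have [c _ ->] := U_mul_star j k.
by rewrite traceZ trace_monomial subr_eq0 (negbTE jk) mulr0.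
Qed.

Lemma trace_bounded : exists2 C : R, 0 < C & forall u,
  nrm (trace u) <= C * nrm u.
Proof.
apply: (@lin_bounded R T R[i]^o (@trace _ _ _ T)); last exact: trace_continuous.
exact: trace_scalar.
Qed.

Lemma coefD u v k : coef (u + v) k = coef u k + coef v k.
Proof. by rewrite /coef amulDl traceD. Qed.

Lemma coefZ a u k : coef (a *: u) k = a * coef u k.
Proof. by rewrite /coef amulZl traceZ. Qed.

Lemma coefB u v k : coef (u - v) k = coef u k - coef v k.
Proof. by rewrite /coef amulBl traceB. Qed.

Lemma nrm_coef : exists2 C : R, 0 < C & forall u k, nrm (coef u k) <= C * nrm u.
Proof.
have [C C0 hC] := trace_bounded; exists C => // u k.
rewrite (le_trans (hC _))// ler_wpM2l ?(ltW C0)// (le_trans (nrm_amul _ _))//.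
by rewrite nrm_star nrm_U mulr1.
Qed.

(** Traciality brings [U l] next to [star (U k)], where the two combine into one monomial up to a
    phase. *)
Lemma nrm_coef_Ul u k l : nrm (coef (U l ** u) k) = nrm (coef u (k - l)).
Proof.
rewrite /coef traceC amulA traceC.
have [c c1 ->] : phase_eq (star (U k) ** U l) (star (U (k - l))).
  by rewrite -[X in phase_eq X]starK starM starK; apply: phase_eq_star;
    exact: star_U_mul.
by rewrite amulZr traceZ nrmM c1 mul1r.
Qed.

Lemma nrm_coef_Ur u k l : nrm (coef (u ** U l) k) = nrm (coef u (k - l)).
Proof.
rewrite /coef -amulA.
have [c c1 ->] : phase_eq (U l ** star (U k)) (star (U (k - l))).
  by rewrite -[X in phase_eq X]starK starM starK; apply: phase_eq_star;
    exact: U_mul_star.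
by rewrite amulZr traceZ nrmM c1 mul1r.
Qed.

End Monomials.

(** * Smooth elements *)

Section Comparison.
Variables (R : realType) (n : nat).
Implicit Types (x : 'rV[R]_n) (k : 'rV[int]_n).

Lemma enorm_ge0 x : 0 <= enorm x.
Proof. exact: sqrtr_ge0. Qed.

Lemma le_enorm x i : `|x 0 i| <= enorm x.
Proof.
rewrite -sqrtr_sqr ler_wsqrtr// (bigD1 i)//= lerDl sumr_ge0// => j _.
exact: sqr_ge0.
Qed.

Lemma enorm_le x : enorm x <= \sum_i `|x 0 i|.
Proof.
have S0 : 0 <= \sum_i `|x 0 i| by apply: sumr_ge0.
rewrite -(ger0_norm S0) -sqrtr_sqr ler_wsqrtr//.
suff : 0 <= \sum_i `|x 0 i| /\ \sum_(i < n) x 0 i ^+ 2 <= (\sum_i `|x 0 i|)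
  ^+ 2 by case.
elim/big_rec2: _ => [|i a b _ [a0 ba]]; first by rewrite expr0n.
split; first by rewrite addr_ge0.
by rewrite sqrrD -normrX ger0_norm ?sqr_ge0// -addrA lerD2l (le_trans ba)//
  lerDr mulrn_wge0// mulr_ge0.
Qed.

Lemma wtE k : (wt k)%:R = 1 + \sum_i `|zvec R k 0 i|.
Proof.
rewrite /wt -natr1 addrC natr_sum; congr (_ + _); apply: eq_bigr => i _.
by rewrite mxE -intr_norm -abszE.
Qed.

Lemma enorm_le_wt k : 1 + enorm (zvec R k) <= (wt k)%:R.
Proof. by rewrite wtE lerD2l enorm_le. Qed.

Lemma wt_le_enorm k : (wt k)%:R <= n.+1%:R * (1 + enorm (zvec R k)).
Proof.
rewrite wtE (@le_trans _ _ (1 + \sum_(i < n) enorm (zvec R k)))//.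
  by rewrite lerD2l ler_sum// => i _; exact: le_enorm.
rewrite sumr_const card_ord -natr1 -[_ *+ n]mulr_natr.
have : 0 <= n%:R :> R by []; have := enorm_ge0 (zvec R k).
by move: (enorm _) (n%:R) => a b; nra.
Qed.

End Comparison.

Section Smooth.
Variables (R : realType) (n : nat) (theta : 'M[R]_n) (T : ncTorus theta).
Implicit Types (k l : 'rV[int]_n) (u v : T) (c : 'rV[int]_n -> R[i]).
Local Notation U := (Uk T).

Definition rapid_decay c := forall N : nat, exists M : R, forall k,
  nrm (c k) <= M * pw k (- N%:R).

Lemma rapid_decay_rapid c : rapid_decay c <-> rapid c.
Proof.
split=> h N; have [M hM] := h N.
  exists M%:C => k; rewrite nrmE -rmorphM /= lecR.
  have := hM k; rewrite pwV ler_pdivlMr ?pw_gt0// mulrC => /(le_trans _); apply.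
  rewrite ler_wpM2r ?nrm_ge0// pw_nat natrX lerXn2r ?nnegrE//.
    by rewrite addr_ge0 ?enorm_ge0.
  exact: enorm_le_wt.
exists (complex.Re M * n.+1%:R ^+ N) => k.
rewrite pwV ler_pdivlMr ?pw_gt0// mulrC pw_nat natrX.
have := hM k; rewrite nrmE -rmorphM => /le_ReC /= hk.
apply: (@le_trans _ _ ((n.+1%:R * (1 + enorm (zvec R k))) ^+ N * nrm (c k))).
  rewrite ler_wpM2r ?nrm_ge0// lerXn2r ?nnegrE ?mulr_ge0 ?addr_ge0 ?enorm_ge0//.
  exact: wt_le_enorm.
by rewrite exprMn -mulrA mulrC ler_wpM2r ?exprn_ge0.
Qed.

Lemma hassum_coef_map u (f : 'rV[int]_n -> T) l :
  hassum f u -> hassum (fun k => coef (f k) l) (coef u l).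
Proof.
have [C C0 hC] := nrm_coef T; move=> fu.
apply: (hassum_map (A := fun x => coef x l) (C := C)) fu => [x y|x //].
exact: coefB.
Qed.

Lemma hassum_coefE u c : hassum (fun k => c k *: U k) u -> coef u = c.
Proof.
move=> cu; apply/funext => l; apply: hassum_uniq (hassum_coef_map l cu) _.
apply: eq_hassum (hassum1 l (c l)) => k; rewrite coefZ coef_U.
by case: eqVneq => [->|]; rewrite ?mulr1 ?mulr0.
Qed.

Lemma smoothP u :
  smooth u <-> rapid_decay (coef u) /\ hassum (fun k => coef u k *: U k) u.
Proof.
split=> [[c cr /hassum_cvg cu]|[cr cu]].
  by rewrite (hassum_coefE cu) rapid_decay_rapid.
by exists (coef u); [exact/rapid_decay_rapid|exact/hassum_cvg].
Qed.

Lemma cinf_smooth (u : cinf T) : smooth (u : T).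
Proof. by case: u => u /= /asboolP. Qed.

Lemma cinf_hassum (u : cinf T) : hassum (fun k => coef u k *: U k) (u : T).
Proof. by have /smoothP[] := cinf_smooth u. Qed.

Lemma cinf_rapid_decay (u : cinf T) : rapid_decay (coef u).
Proof. by have /smoothP[] := cinf_smooth u. Qed.

Lemma to_cinfK u : smooth u -> (to_cinf u : T) = u.
Proof. by move=> su; rewrite /to_cinf insubdK//; apply/asboolP. Qed.

Lemma bsum_rapid_decay c N (M : R) : (2 * n <= N)%N ->
  0 <= M -> (forall k, nrm (c k) <= M * pw k (- N%:R)) ->
  bsum (fun k => nrm (c k)) (M * 3 ^+ n).
Proof.
move=> nN M0 hc A; have h := ler_wpM2l M0 (@bsum_pw R n A).
apply: le_trans h; rewrite mulr_sumr; apply: ler_sum => k _;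
  rewrite (le_trans (hc k))//.
by rewrite ler_wpM2l// ler_pw// lerN2 ler_nat.
Qed.

Lemma rapid_decay_smooth c : rapid_decay c ->
  exists2 u : T, smooth u & coef u = c.
Proof.
move=> cd; have [M hM] := cd (2 * n)%N.
have M0 : 0 <= M.
  by have := hM 0; rewrite pw0l mulr1; exact: (le_trans (nrm_ge0 _)).
have nU k : nrm (c k *: U k) <= nrm (c k) by rewrite nrmZ nrm_U mulr1.
have [u cu] := hassum_ex nU (bsum_rapid_decay (leqnn _) M0 hM).
exists u; last exact: hassum_coefE.
by exists c; [exact/rapid_decay_rapid|exact/hassum_cvg].
Qed.

Lemma smooth_sumE c : rapid_decay c ->
  smooth (summability.sum (fun k => c k *: U k)) /\
  coef (summability.sum (fun k => c k *: U k)) = c.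
Proof.
move=> /rapid_decay_smooth[u su <-].
by have /smoothP[_ /hassum_sum ->] := su.
Qed.

Lemma cinf_eq (u v : cinf T) : coef u =1 coef v -> u = v.
Proof.
move=> uv; apply: val_inj => /=; apply: hassum_uniq (cinf_hassum u) _.
by apply: eq_hassum (cinf_hassum v) => k; rewrite uv.
Qed.

Lemma nrm_cinf_le (u : cinf T) (g : 'rV[int]_n -> R) M :
  (forall k, nrm (coef u k) <= g k) -> bsum g M -> nrm (u : T) <= M.
Proof.
move=> ug; apply: hassum_le (cinf_hassum u) _ => k.
by rewrite nrmZ nrm_U mulr1.
Qed.

Lemma rapid_decay_le c c' : rapid_decay c ->
  (exists m, forall k, nrm (c' k) <= pw k m * nrm (c k)) ->
  rapid_decay c'.
Proof.
move=> cd [m hm] N; have [N' hN'] : exists N' : nat, m + N%:R <= N'%:R.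
  by exists (Num.truncn `|m + N%:R|).+1;
    rewrite (le_trans (ler_norm _))// ltW// truncnS_gt.
have [M hM] := cd N'; exists M => k.
have M0 : 0 <= M.
  have := hM k; move/(le_trans (nrm_ge0 _)).
  by rewrite pmulr_lge0 ?pw_gt0.
rewrite (le_trans (hm k))// (le_trans (ler_wpM2l (pw_ge0 _ _) (hM k)))//.
by rewrite mulrCA ler_wpM2l// -pwD ler_pw// lerBlDr addrC lerBrDr.
Qed.

Lemma nrm_int (z : int) : nrm (z%:~R : R[i]) = `|z|%N%:R.
Proof. by rewrite -[z%:~R](rmorph_int (real_complex R))
  nrm_real -intr_norm -abszE. Qed.

Lemma nrm_coord k i : nrm ((k 0 i)%:~R : R[i]) <= pw k 1.
Proof.
rewrite nrm_int !pwE powRr1// ler_nat /wt (bigD1 i)//= ltnW// ltnS leq_addr//.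
Qed.

Lemma coef_delta i (u : cinf T) k : coef (delta i u) k = (k 0 i)%:~R * coef u k.
Proof.
have dd : rapid_decay (fun k => (k 0 i)%:~R * coef u k).
  apply: rapid_decay_le (cinf_rapid_decay u) _; exists 1 => l;
    rewrite nrmM ler_wpM2r ?nrm_ge0//.
  exact: nrm_coord.
by have [s e] := smooth_sumE dd; rewrite /delta to_cinfK// e.
Qed.

Lemma coef_mdelta a (u : cinf T) k :
  coef (mdelta a u) k = (\prod_(i < n) (k 0 i)%:~R ^+ a i) * coef u k.
Proof.
rewrite /mdelta -[\prod_(_ < _) _]big_enum /=.
elim: (enum 'I_n) => [|i s IH] /=; first by rewrite big_nil mul1r.
rewrite big_cons -mulrA -IH; elim: (a i) => [|m IHm] /=;
  first by rewrite expr0 mul1r.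
by rewrite coef_delta IHm exprS mulrA.
Qed.

Lemma nrm_prod_coord a k :
  nrm (\prod_(i < n) (k 0 i)%:~R ^+ a i : R[i]) <= pw k (msize a)%:R.
Proof.
rewrite /msize natr_sum.
suff H (s : seq 'I_n) : nrm (\prod_(i <- s) (k 0 i)%:~R ^+ a i : R[i])
    <= pw k (\sum_(i <- s) (a i)%:R) by exact: H.
elim: s => [|i s IH]; first by rewrite !big_nil nrm1 pw0.
rewrite !big_cons nrmM pwD; apply: ler_pM; rewrite ?nrm_ge0// nrmX.
rewrite pw_nat natrX lerXn2r ?nnegrE ?nrm_ge0//.
by have := nrm_coord k i; rewrite !pwE powRr1.
Qed.

Lemma snormE a (u : cinf T) : snorm a u = (nrm (mdelta a u : T))%:C.
Proof. by rewrite /snorm nrmE. Qed.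

Lemma nrm_mdelta_le a (u : cinf T) (c : R) : 0 <= c ->
  (forall k, nrm (coef u k) <= c * pw k (- (msize a + 2 * n)%:R)) ->
  nrm (mdelta a u : T) <= c * 3 ^+ n.
Proof.
move=> c0 h; apply: (nrm_cinf_le (g := fun k => nrm (coef (mdelta a u) k)))
  => //.
apply: (bsum_rapid_decay (leqnn (2 * n))) => // k.
rewrite coef_mdelta nrmM (le_trans (ler_pM _ _ (nrm_prod_coord a k) (h k)))
  ?nrm_ge0// mulrCA ler_wpM2l// -pwD ler_pw// natrD opprD addrA subrr add0r//.
Qed.

(** The pure powers [delta_i ^ N], together with the norm itself for [None]. These [n + 1] seminorms
    already control the decay of order [N] of all Fourier coefficients, since the weight is
    comparable to its largest coordinate or to 1. *)
Definition axis_index (N : nat) (o : option 'I_n) : mindex n :=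
  if o is Some i then fun j => if j == i then N else 0%N else fun=> 0%N.

Lemma prod_axis_index N i k : \prod_(j < n)
  (k 0 j)%:~R ^+ axis_index N (Some i) j = (k 0 i)%:~R ^+ N :> R[i].
Proof.
rewrite (bigD1 i)//= eqxx big1 ?mulr1// => j /negbTE ->; exact: expr0.
Qed.

(* [wt k <= (n + 1) max(1, |k_1|, ..., |k_n|)] *)
Lemma coef_decay (N : nat) : exists2 C : R, 0 < C & forall (u : cinf T) (d : R),
  (forall o, nrm (mdelta (axis_index N o) u : T) <= d) ->
  forall k, nrm (coef u k) <= C * d * pw k (- N%:R).
Proof.
have [C C0 hC] := nrm_coef T.
exists (n.+1%:R ^+ N * C); first by rewrite mulr_gt0 ?exprn_gt0.
move=> u d hd k; rewrite pwV ler_pdivlMr ?pw_gt0// mulrC pw_nat natrX.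
suff : exists o, ((wt k)%:R : R) ^+ N <= n.+1%:R ^+ N *
    nrm (\prod_(j < n) (k 0 j)%:~R ^+ axis_index N o j : R[i]).
  case=> o ho; apply: (le_trans (ler_wpM2r (nrm_ge0 _) ho)).
  rewrite -!mulrA ler_wpM2l ?exprn_ge0//
    -nrmM -coef_mdelta (le_trans (hC _ _))//.
  by rewrite ler_wpM2l ?(ltW C0).
have [/existsP[i ki]|/existsPn nk] := boolP [exists i,
  wt k <= n.+1 * `|k ord0 i|]%N.
  exists (Some i); rewrite prod_axis_index nrmX nrm_int -exprMn lerXn2r
    ?nnegrE//.
  by rewrite -natrM ler_nat.
exists None => /=; rewrite big1 ?nrm1 ?mulr1 ?lerXn2r ?nnegrE ?ler_nat//.
rewrite leqNgt; apply/negP => nw.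
have : (n.+1 * (\sum_(i < n) `|k ord0 i|) <= \sum_(i < n) (wt k).-1)%N.
  rewrite big_distrr /= leq_sum// => i _.
  by have := nk i; rewrite -ltnNge /wt ltnS.
rewrite sum_nat_const card_ord /=.
move: nw; rewrite /wt; set s := (\sum_i _)%N => ns.
by rewrite mulSn -[X in (_ <= X)%N]add0n leq_add2r leqn0 => /eqP s0;
  rewrite s0 in ns.
Qed.

Lemma smooth_U k : smooth (U k).
Proof.
apply/smoothP; rewrite (_ : coef (U k) = fun l => (k == l)%:R); last first.
  by apply/funext => l; rewrite coef_U.
split; last first.
  apply: eq_hassum (hassum1 k (U k)) => l; rewrite [k == l]eq_sym.
  by case: eqVneq => [->|]; rewrite ?scale1r ?scale0r.
move=> N; exists (pw k N%:R) => l; case: eqVneq => [->|_].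
  by rewrite nrm1 -pwD addrN pw0.
by rewrite nrm0 mulr_ge0 ?pw_ge0.
Qed.

Lemma smoothZ a u : smooth u -> smooth (a *: u).
Proof. by move=> /asboolP su; apply/asboolP;
  exact: (@GRing.rpredZ _ _ (smooth_pred T)). Qed.

Lemma smoothD u v : smooth u -> smooth v -> smooth (u + v).
Proof. by move=> /asboolP su /asboolP sv; apply/asboolP;
  exact: (@GRing.rpredD _ (smooth_pred T)). Qed.

Lemma smooth_phase_eq u v : phase_eq u v -> smooth v -> smooth u.
Proof. by move=> [c _ ->]; exact: smoothZ. Qed.

Lemma smooth_star_U k : smooth (star (U k)).
Proof. exact: smooth_phase_eq (star_U T k) (smooth_U _). Qed.

Lemma hassum_mull (f : 'rV[int]_n -> T) u v : hassum f u ->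
  hassum (fun k => v ** f k) (v ** u).
Proof.
apply: (hassum_map (A := amul v) (C := nrm v)) => [x y|x]; first exact: amulBr.
exact: nrm_amul.
Qed.

Lemma hassum_mulr (f : 'rV[int]_n -> T) u v : hassum f u ->
  hassum (fun k => f k ** v) (u ** v).
Proof.
apply: (hassum_map (A := fun x => x ** v) (C := nrm v)) => [x y|x];
  first exact: amulBl.
by rewrite mulrC nrm_amul.
Qed.

(* Left and right multiplications by a monomial are both of this form. *)
Lemma smooth_shift u (f : T -> T) l :
  (forall v w : T, f (v - w) = f v - f w) ->
    (forall a v, f (a *: v) = a *: f v) ->
  (forall v, nrm (f v) <= nrm v) ->
  (forall k, phase_eq (f (U k)) (U (k + l))) -> smooth u -> smooth (f u).
Proof.
move=> fB fZ fN fU /smoothP[ud us].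
have /choice[ph phE] k : exists c : R[i], nrm c = 1 /\ f (U k) = c *: U (k + l).
  by have [c ? ?] := fU k; exists c.
exists (fun k => coef u (k - l) * ph (k - l)).
  apply/rapid_decay_rapid => N; have [M hM] := ud N;
    exists (M * pw l N%:R) => k.
  rewrite nrmM (proj1 (phE _)) mulr1 (le_trans (hM _))// -mulrA ler_wpM2l//.
    have := hM 0; rewrite pw0l mulr1; exact: (le_trans (nrm_ge0 _)).
  have := pw_peetre k (- l) (- N%:R : R).
  by rewrite pwN normrN ger0_norm.
apply/hassum_cvg.
have fs : hassum (fun k => f (coef u k *: U k)) (f u).
  apply: (hassum_map (A := f) (C := 1)) us; first exact: fB.
  by move=> y; rewrite mul1r.
have := hassum_reindex (h := fun k => k - l) (h' := fun k => k + l) (subrK l)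
  (addrK l) fs.
by apply: eq_hassum => k; rewrite fZ (proj2 (phE _)) scalerA subrK.
Qed.

Lemma smooth_Ul k u : smooth u -> smooth (U k ** u).
Proof.
apply: (smooth_shift (f := amul (U k)) (l := k)).
- exact: amulBr.
- by move=> a v; rewrite amulZr.
- by move=> v; rewrite (le_trans (nrm_amul _ _))// nrm_U mul1r.
- by move=> l; rewrite addrC; exact: U_mul.
Qed.

Lemma smooth_Ur k u : smooth u -> smooth (u ** U k).
Proof.
apply: (smooth_shift (f := fun v => v ** U k) (l := k)).
- by move=> v w; rewrite amulBl.
- by move=> a v; rewrite amulZl.
- by move=> v; rewrite (le_trans (nrm_amul _ _))// nrm_U mulr1.
- by move=> l; exact: U_mul.
Qed.

Lemma smooth_star_Ul k u : smooth u -> smooth (star (U k) ** u).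
Proof.
move=> su; apply: (@smooth_phase_eq _ (U (- k) ** u)); last exact: smooth_Ul.
by apply: phase_eqM; [exact: star_U|exact: phase_eq_refl].
Qed.

(** Trigonometric polynomials. The inductive form lets linear identities and regularity pass from
    monomials by induction. *)
Inductive tpoly : T -> Prop :=
| tpoly0 : tpoly 0
| tpolyS a k p : tpoly p -> tpoly (a *: U k + p).

Lemma tpoly_smooth p : tpoly p -> smooth p.
Proof.
elim=> [|a k q _ sq]; last by apply: smoothD => //; apply: smoothZ;
  exact: smooth_U.
by rewrite -(scale0r (U 0)); apply: smoothZ; exact: smooth_U.
Qed.

Lemma tpolyD p r : tpoly p -> tpoly r -> tpoly (p + r).
Proof.
by move=> tp tr; elim: tp => [|a k q _ IH]; rewrite ?add0r// -addrA;
  exact: tpolyS.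
Qed.

Lemma tpolyU a k : tpoly (a *: U k).
Proof. by rewrite -[_ *: _]addr0; do 2!constructor. Qed.

Lemma tpolyZ a p : tpoly p -> tpoly (a *: p).
Proof.
elim=> [|b k q _ IH]; first by rewrite scaler0; exact: tpoly0.
by rewrite scalerDr scalerA; exact: tpolyS.
Qed.

Lemma tpoly_phase_eq p k : phase_eq p (U k) -> tpoly p.
Proof. by move=> [c _ ->]; exact: tpolyU. Qed.

Lemma tpolyM p r : tpoly p -> tpoly r -> tpoly (p ** r).
Proof.
move=> tp tr; elim: tp => [|a k q _ IH]; first by rewrite amul0l; exact: tpoly0.
rewrite amulDl; apply: tpolyD => //; rewrite amulZl; apply: tpolyZ.
elim: tr => [|b l s _ IHs]; first by rewrite amul0r; exact: tpoly0.
rewrite amulDr amulZr; apply: tpolyD => //; apply: tpolyZ.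
exact: tpoly_phase_eq (U_mul T _ _).
Qed.

Lemma tpoly_star p : tpoly p -> tpoly (star p).
Proof.
elim=> [|a k q _ IH]; first by rewrite star0; exact: tpoly0.
rewrite starD starZ; apply: tpolyD => //; apply: tpolyZ.
exact: tpoly_phase_eq (star_U T k).
Qed.

Lemma gen_U i : nct_gen T i = U (delta_mx 0 i).
Proof.
rewrite /Uk /monomial.
have H (s : seq 'I_n) : uniq s ->
  \big[amul/aone]_(j <- s) upow (nct_gen T j) (delta_mx 0 i 0 j) =
  if i \in s then nct_gen T i else aone.
  elim: s => [|j s IH] /=; first by rewrite big_nil.
  move=> /andP[js us]; rewrite big_cons IH// mxE eqxx inE /=.
  rewrite [j == i]eq_sym; case: eqVneq => [ij|_] /=; last by rewrite amul1l.
  by rewrite amul1r -ij in js *; rewrite (negbTE js) amul1r.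
by rewrite H ?index_enum_uniq// mem_index_enum.
Qed.

(** The closure of the trigonometric polynomials is a closed star-subalgebra containing the
    generators, so [nct_generated] identifies it with the whole algebra. *)
Lemma tpoly_dense u (e : R) : 0 < e -> exists2 p, tpoly p & nrm (u - p) < e.
Proof.
pose S := [set u : T | forall e : R, 0 < e ->
  exists2 p, tpoly p & nrm (u - p) < e].
suff : S = setT by move=> ST e0; have : S u by [rewrite ST|]; apply.
have Spol p : tpoly p -> S p by move=> tp d d0; exists p; rewrite ?subrr ?nrm0.
apply: (@nct_generated _ _ _ T).
- move=> x clx d d0; have d2 : 0 < d / 2 by rewrite divr_gt0.
  have d2c : 0 < (d / 2)%:C by rewrite ltcR.
  have [y [Sy /= xy]] := clx _ (nbhsx_ballx x _ d2c).
  have [p tp yp] := Sy _ d2; exists p => //.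
  move: xy; rewrite -ball_normE /ball_ /= -nrm_lt => xy.
  by rewrite -(subrKA y) (le_lt_trans (nrmD _ _))// [d]splitr ltrD.
- by apply: Spol; rewrite -U0 -[U 0]scale1r; exact: tpolyU.
- move=> a x y Sx Sy d d0.
  have d1 : 0 < d / 2 / (nrm a + 1) by rewrite !divr_gt0// ltr_wpDl ?nrm_ge0.
  have [p tp xp] := Sx _ d1.
  have [r tr yr] := Sy _ (divr_gt0 d0 (ltr0n R 2)).
  exists (a *: p + r); first by apply: tpolyD => //; exact: tpolyZ.
  rewrite opprD addrACA -scalerBr (le_lt_trans (nrmD _ _))//
    [ltRHS]splitr ltrD// nrmZ.
  move: xp; rewrite ltr_pdivlMr ?ltr_wpDl ?nrm_ge0//; apply: le_lt_trans.
  by rewrite mulrC ler_wpM2l ?nrm_ge0// lerDl.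
- move=> x y Sx Sy d d0.
  pose d1 := d / 2 / (nrm y + 1).
  have d10 : 0 < d1 by rewrite !divr_gt0// ltr_wpDl ?nrm_ge0.
  have [p tp xp] := Sx _ d10.
  (* The tolerance for [y] depends on the norm of [p], so [p] is chosen first. *)
  have d20 : 0 < d / 2 / (nrm p + 1) by rewrite !divr_gt0// ltr_wpDl ?nrm_ge0.
  have [r tr yr] := Sy _ d20.
  exists (p ** r); first exact: tpolyM.
  have -> : x ** y - p ** r = (x - p) ** y + p ** (y - r).
    by rewrite amulBl amulBr subrKA.
  rewrite (le_lt_trans (nrmD _ _))// [d]splitr ltrD//.
    move: xp; rewrite /d1 ltr_pdivlMr ?ltr_wpDl ?nrm_ge0//; apply: le_lt_trans.
    by rewrite (le_trans (nrm_amul _ _))// ler_wpM2l ?nrm_ge0// lerDl.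
  move: yr; rewrite ltr_pdivlMr ?ltr_wpDl ?nrm_ge0//; apply: le_lt_trans.
  by rewrite (le_trans (nrm_amul _ _))// mulrC ler_wpM2l ?nrm_ge0// lerDl.
- move=> x Sx d d0; have [p tp xp] := Sx _ d0.
  by exists (star p); [exact: tpoly_star|rewrite -starB nrm_star].
- by move=> i; apply: Spol; rewrite gen_U -[U _]scale1r; exact: tpolyU.
Qed.

End Smooth.

(** * The inverse of the principal symbol *)

Section Generic.
Variable R : realType.

(** Domination by the norm lets subadditivity pass from finite sums to series. It is applied to
    finite truncations of the weighted Wiener norm, to norms of powers of the resolvent, and to
    pairings with a test function. *)
Lemma hassum_seminorm (K : choiceType) (V : normedZmodType R[i]) (p : V -> R)
    (D : R) (f : K -> V) x (g : K -> R) M :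
  (forall y z, p (y + z) <= p y + p z) -> (forall y, p y <= D * nrm y) ->
  (forall k, p (f k) <= g k) -> bsum g M -> hassum f x -> p x <= M.
Proof.
move=> pD pN pf gM fx; apply: le_epsilon => e e0.
have D0 : 0 < `|D| + 1 by rewrite ltr_wpDl.
have [A hA] := fx _ (divr_gt0 e0 D0).
have := hA A (fsubset_refl A); rewrite nrmB ltr_pdivlMr// => hx.
rewrite -[x](subrK (\sum_(k <- A) f k)) addrC (le_trans (pD _ _))// lerD//.
  apply: le_trans (gM A).
  have p0 : p 0 <= 0 by rewrite (le_trans (pN _))// nrm0 mulr0.
  elim/big_rec2: _ => // k a b _ ab.
  by rewrite (le_trans (pD _ _))// lerD.
rewrite (le_trans (pN _))// (le_trans _ (ltW hx))// mulrC ler_wpM2l ?nrm_ge0//.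
by rewrite (le_trans (ler_norm _))// lerDl.
Qed.

Lemma bsum_reindex (K L : choiceType) (h : L -> K) (g : K -> R) M :
  injective h -> bsum g M -> bsum (fun l => g (h l)) M.
Proof.
move=> hi gM A; have := gM [fset h l | l in A]%fset.
by rewrite big_imfset//= => ? ? _ _; exact: hi.
Qed.

Lemma bsum_ge0 (K : choiceType) (g : K -> R) M : bsum g M -> 0 <= M.
Proof. by move=> /(_ fset0); rewrite big_seq_fset0. Qed.

(** Compactness in its near-covering form, with the parameter [M] tending to infinity, plays the
    part of a finite subcover followed by a maximum. It serves both the unit sphere of symbols and
    the circle of integration. *)
Lemma compact_bound (X : topologicalType) (K : set X) (Q : R -> X -> Prop) :
  (forall M M' x, M <= M' -> Q M x -> Q M' x) -> compact K ->
  (forall x, K x -> exists M, \forall x' \near x, K x' -> Q M x') ->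
  exists M, forall x, K x -> Q M x.
Proof.
move=> Qmon /compact_near_coveringP/near_covering_withinP Kc Kl.
have H := Kc R (pinfty_nbhs R) Q _ _.
have /filter_ex[M hM] : pinfty_nbhs R (fun M => K `<=` Q M).
  apply: H => x /Kl[M hM].
  exists ([set x' | K x' -> Q M x'], [set M' | M <= M']) => /=.
    by split=> //; exists M; split=> [|M' /ltW//]; rewrite num_real.
  by move=> [x' M'] /= [hx MM'] Kx'; apply: Qmon MM' _; exact: hx.
by exists M.
Qed.

End Generic.

(** * Weighted Wiener algebras *)

Section WeightedL1.
Variables (R : realType) (n : nat) (theta : 'M[R]_n) (T : ncTorus theta).
Implicit Types (k l : 'rV[int]_n) (x y : T) (u v w : cinf T) (N : nat).
Local Notation U := (Uk T).

(* A bound [B] for the norm of [x] in the Wiener algebra weighted by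
   [pw k N]. *)
Definition wiener_le N x (B : R) :=
  bsum (fun k => pw k N%:R * nrm (coef x k)) B.

Lemma wiener_le_ge0 N x B : wiener_le N x B -> 0 <= B.
Proof. exact: bsum_ge0. Qed.

Lemma wiener_le_coef N x B k : wiener_le N x B ->
  nrm (coef x k) <= B * pw k (- N%:R).
Proof.
move=> /(_ [fset k]%fset); rewrite big_seq_fset1 pwV ler_pdivlMr ?pw_gt0//.
by rewrite mulrC.
Qed.

Lemma coef_wiener_le N x (c : R) : 0 <= c ->
  (forall k, nrm (coef x k) <= c * pw k (- (N + 2 * n)%:R)) ->
    wiener_le N x (c * 3 ^+ n).
Proof.
move=> c0 hc A; have h := ler_wpM2l c0 (@bsum_pw R n A).
apply: le_trans h; rewrite mulr_sumr; apply: ler_sum => k _.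
rewrite (le_trans (ler_wpM2l (pw_ge0 _ _) (hc k)))// mulrCA ler_wpM2l//.
by rewrite -pwD natrD opprD addrA subrr add0r.
Qed.

Lemma wiener_le_cinf N u : exists B, wiener_le N (u : T) B.
Proof.
have [M hM] := cinf_rapid_decay u (N + 2 * n).
exists (M * 3 ^+ n); apply: coef_wiener_le => //.
by have := hM 0; rewrite pw0l mulr1; exact: (le_trans (nrm_ge0 _)).
Qed.

Lemma wiener_leD N x y B B' : wiener_le N x B -> wiener_le N y B' ->
  wiener_le N (x + y) (B + B').
Proof.
move=> xB yB A; apply: le_trans (lerD (xB A) (yB A)).
rewrite -big_split /=; apply: ler_sum => k _; rewrite -mulrDr coefD.
by rewrite ler_wpM2l// nrmD.
Qed.

Lemma coefN x k : coef (- x) k = - coef x k.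
Proof. by rewrite -scaleN1r coefZ mulN1r. Qed.

Lemma wiener_leN N x B : wiener_le N x B -> wiener_le N (- x) B.
Proof.
by move=> xB A; apply: le_trans (xB A); apply: ler_sum => k _;
  rewrite coefN nrmN.
Qed.

(** The Fourier series of [u] turns the product into a sum of shifts of [y], and by Peetre's
    inequality a shift by [k] costs at most [pw k N%:R]. Restricting to a finite set [F] of
    coefficients makes the weighted sum a seminorm dominated by the norm. *)
Lemma wiener_le_mul N u y B B' : wiener_le N (u : T) B -> wiener_le N y B' ->
  wiener_le N ((u : T) ** y) (B * B').
Proof.
move=> uB yB F.
have B'0 := wiener_le_ge0 yB.
have [C C0 hC] := nrm_coef T.
pose p (z : T) : R := \sum_(l <- F) pw l N%:R * nrm (coef z l).
have hs := hassum_mulr y (cinf_hassum u).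
apply: (@hassum_seminorm R _ _ p (\sum_(l <- F) pw l N%:R * C) _ _
  (fun k => pw k N%:R * nrm (coef u k) * B') (B * B') _ _ _ _ hs).
- move=> a b; rewrite /p -big_split /=; apply: ler_sum => l _.
  by rewrite -mulrDr coefD ler_wpM2l// nrmD.
- move=> a; rewrite /p mulr_suml; apply: ler_sum => l _.
  by rewrite -mulrA ler_wpM2l.
- move=> k; rewrite /p.
  have sh : bsum (fun l => pw (l - k) N%:R * nrm (coef y (l - k))) B'.
    exact: (bsum_reindex (h := fun l => l - k) (addIr (- k)) yB).
  apply: le_trans (ler_wpM2l _ (sh F)); last by rewrite mulr_ge0 ?nrm_ge0.
  rewrite mulr_sumr; apply: ler_sum => l _.
  rewrite amulZl coefZ nrmM nrm_coef_Ul.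
  have : pw l N%:R <= pw k N%:R * pw (l - k) N%:R :> R.
    by have := pw_peetre (l - k) k (N%:R : R); rewrite subrK ger0_norm.
  move=> h; have hc : 0 <= nrm (coef u k) * nrm (coef y (l - k)).
    by rewrite mulr_ge0 ?nrm_ge0.
  apply: le_trans (ler_wpM2r hc h) _; rewrite le_eqVlt; apply/orP; left;
    apply/eqP; ring.
- by move=> A; rewrite -mulr_suml ler_wpM2r.
Qed.

(** An absorption argument: the least bound [S] is finite by the first hypothesis, hence satisfies
    [S <= b + S / 2]. It is meant for an inverse already known to be smooth, whose size is to be
    controlled. *)
Lemma wiener_le_half N x b : (exists B, wiener_le N x B) ->
  (forall X, wiener_le N x X -> wiener_le N x (b + X / 2)) ->
    wiener_le N x (2 * b).
Proof.
move=> [B0 hB0] step.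
pose E := [set \sum_(k <- A) pw k N%:R * nrm (coef x k)
  | A in [set: {fset 'rV[int]_n}]].
have supE : has_sup E.
  split; first by exists (\sum_(k <- fset0) pw k N%:R * nrm (coef x k)), fset0.
  by exists B0 => _ [A _ <-]; exact: hB0.
have nS : wiener_le N x (sup E) by move=> A; apply: sup_upper_bound => //;
  exists A.
have S2 : sup E <= b + sup E / 2.
  apply: ge_sup; first by case: supE.
  by move=> _ [A _ <-]; exact: step nS A.
by move=> A; apply: le_trans (nS A) _; lra.
Qed.

Lemma cinf_subE u v : ((u - v : cinf T) : T) = (u : T) - (v : T).
Proof. exact: (raddfB (\val : cinf T -> T)). Qed.

Lemma cinf_scaleE (a : R[i]) u : ((a *: u : cinf T) : T) = a *: (u : T).
Proof. exact: (linearZZ (\val : cinf T -> T)). Qed.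

(* [w = w0 - w0 (u - u0) w], and [w0 (u - u0)] has norm at most 1/2. *)
Lemma wiener_le_inverse N u0 w0 : (w0 : T) ** u0 = aone ->
  exists B d : R, 0 < d /\ forall u w, (u : T) ** w = aone ->
    (forall o, nrm (mdelta (axis_index (N + 2 * n) o) (u - u0) : T) <= d) ->
      wiener_le N (w : T) B.
Proof.
move=> wu0; have [b hb] := wiener_le_cinf N w0; have b0 := wiener_le_ge0 hb.
have [C C0 hC] := coef_decay T (N + 2 * n).
pose D := C * 3 ^+ n; have D0 : 0 < D by rewrite mulr_gt0 ?exprn_gt0.
(* [D] converts the axis seminorms into a Wiener bound, so within this radius [w0 (u - u0)] has
   bound [b / (2 (b + 1))], below 1/2; the [+ 1] keeps the radius defined when [b = 0]. *)
exists (2 * b), ((2 * (b + 1) * D)^-1).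
have d0 : 0 < 2 * (b + 1) * D by rewrite !mulr_gt0// ltr_wpDl.
split=> [|u w uw hu]; first by rewrite invr_gt0.
set d := (_)^-1 in hu.
have nu : wiener_le N ((u - u0 : cinf T) : T) (D * d).
  rewrite /D mulrAC; apply: coef_wiener_le;
    first by rewrite mulr_ge0 ?(ltW C0)// invr_ge0 ltW.
  exact: hC.
have wE : (w : T) = (w0 : T) - (w0 : T) ** (((u - u0 : cinf T) : T) ** w).
  by rewrite cinf_subE amulBl amulBr uw amul1r amulA wu0 amul1l subKr.
apply: wiener_le_half; first exact: wiener_le_cinf.
move=> X wX; rewrite wE.
have h := wiener_leD hb (wiener_leN (wiener_le_mul hb (wiener_le_mul nu wX))).
move=> A; apply: le_trans (h A) _; rewrite lerD2l.
have -> : b * (D * d * X) = (b * (D * d)) * X by ring.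
rewrite [X / 2]mulrC ler_wpM2r ?(wiener_le_ge0 wX)//.
have -> : D * d = (2 * (b + 1))^-1.
  by rewrite /d invfM mulrCA divff ?mulr1// gt_eqF.
by rewrite ler_pdivrMr ?mulr_gt0 ?ltr_wpDl//; lra.
Qed.

End WeightedL1.

Section Sphere.
Variables (R : realType) (n : nat) (theta : 'M[R]_n) (T : ncTorus theta).
Implicit Types (xi : 'rV[R]_n).

Lemma enorm_continuous : continuous (@enorm R n).
Proof.
move=> xi; rewrite /enorm; apply: (continuous_comp (f := fun x : 'rV[R]_n =>
  \sum_i x 0 i ^+ 2)); last first.
  exact: sqrt_continuous.
suff H (s : seq 'I_n) : {for xi,
  continuous (fun x : 'rV[R]_n => \sum_(i <- s) x 0 i ^+ 2)} by exact: H.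
elim: s => [|i s IH].
  rewrite (_ : (fun _ => _) = fun=> 0); first exact: cst_continuous.
  by apply/funext => x; rewrite big_nil.
rewrite (_ : (fun _ => _) = fun x : 'rV[R]_n => x 0 i ^+ 2 + \sum_(j <- s)
  x 0 j ^+ 2); last first.
  by apply/funext => x; rewrite big_cons.
apply: continuousD => //; rewrite (_ : (fun _ => _)
  = fun x : 'rV[R]_n => x 0 i * x 0 i)//.
apply: continuousM; exact: coord_continuous.
Qed.

Lemma sphere_compact : compact [set xi : 'rV[R]_n | enorm xi = 1].
Proof.
apply: bounded_closed_compact.
  exists 1; split=> [|M M1 xi /= x1]; first by rewrite num_real.
  rewrite (le_trans _ (ltW M1))// /Num.norm /= mx_normrE; apply/bigmax_leP;
    split=> // -[i j] _ /=.
  by rewrite (ord1 i) -x1 le_enorm.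
have -> : [set xi : 'rV[R]_n | enorm xi = 1] = @enorm R n @^-1` [set x | x = 1]
  by [].
by apply: preimage_closed (@closed_eq R 1) => x _; exact: enorm_continuous.
Qed.

Lemma nrm_expi (t : R) : nrm (expi t) = 1.
Proof. by rewrite /nrm normc_def /= cos2Dsin2 sqrtr1. Qed.

Lemma nrm_cpow (t : R) q : nrm (cpow t q) = t `^ complex.Re q.
Proof. by rewrite /cpow nrmM nrm_expi mulr1 nrm_real ger0_norm// powR_ge0. Qed.

(** The bound concerns every right inverse in the smooth algebra, so that no map from [xi] to an
    inverse has to be chosen or shown to be continuous; only the symbol itself has to vary
    continuously. *)
Lemma homogeneous_inverse_sphere q (rq : 'rV[R]_n -> cinf T) (N : nat) :
  homogeneous_symbol q rq -> (forall xi, xi != 0 -> cinf_invertible (rq xi)) ->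
  exists B : R, forall xi (w : cinf T), enorm xi = 1 ->
    (rq xi : T) ** w = aone -> wiener_le N (w : T) B.
Proof.
move=> [rs _] rinv.
have [B hB] : exists B : R, forall xi, enorm xi = 1 ->
    forall w : cinf T, (rq xi : T) ** w = aone -> wiener_le N (w : T) B.
  apply: compact_bound sphere_compact _.
    by move=> M M' xi MM' h w wu A; rewrite (le_trans (h w wu A)).
  move=> xi x1; have xi0 : xi != 0.
    apply/eqP => x0; move: x1; rewrite /= x0 /enorm big1 => [|i _];
      last by rewrite mxE expr0n.
    by rewrite sqrtr0 => /eqP; rewrite eq_sym oner_eq0.
  have [w0 [_ wu0]] := rinv _ xi0.
  have [B [d [d0 hBd]]] := wiener_le_inverse N wu0.
  exists B; have [cont _] := rs [::] xi xi0.
  have dc : 0 < d%:C by rewrite ltcR.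
  have : \forall x \near xi, forall o,
    snorm (axis_index (N + 2 * n) o) (rq x - rq xi) < d%:C.
    apply: (@filter_forall _ (option 'I_n : finType)
      (fun o x => snorm (axis_index (N + 2 * n) o) (rq x - rq xi) < d%:C)
        (nbhs xi) (nbhs_filter xi)).
    by move=> o; exact: cont.
  apply: filterS => x hx _ w uw; apply: (hBd (rq x)) => // o.
  by have := hx o; rewrite snormE ltcR => /ltW.
by exists B => xi w x1; exact: hB.
Qed.

Lemma zvec_neq0 (k : 'rV[int]_n) : k != 0 -> zvec R k != 0.
Proof.
apply: contraNneq => /rowP k0; apply/eqP/rowP => i; rewrite mxE.
by have := k0 i; rewrite !mxE => /eqP; rewrite intr_eq0 => /eqP.
Qed.

Lemma enorm_gt0 xi : xi != 0 -> 0 < enorm xi.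
Proof.
move=> x0; rewrite lt_def enorm_ge0 andbT; apply: contra x0 => /eqP e0.
apply/eqP/rowP => i; rewrite mxE; apply/eqP; rewrite -normr_le0 -e0.
exact: le_enorm.
Qed.

Lemma enormZ (t : R) xi : 0 <= t -> enorm (t *: xi) = t * enorm xi.
Proof.
move=> t0; rewrite /enorm -{2}(ger0_norm t0) -sqrtr_sqr -sqrtrM ?sqr_ge0//
  mulr_sumr.
by congr Num.sqrt; apply: eq_bigr => i _; rewrite mxE exprMn.
Qed.

Lemma enorm_zvec_ge1 (k : 'rV[int]_n) : k != 0 -> 1 <= enorm (zvec R k).
Proof.
move=> k0; have [i ki] : exists i, k 0 i != 0.
  apply/existsP; rewrite -negb_forall; apply: contra k0 => /forallP k0.
  by apply/eqP/rowP => i; rewrite mxE; exact/eqP.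
apply: le_trans (le_enorm _ i); rewrite mxE -intr_norm -[1]/(1%:~R) ler_int;
  lia.
Qed.

(** A nonzero lattice point has Euclidean norm at least 1, so [1 + |k| <= 2 |k|]; the other factor
    [n.+1] comes from [wt_le_enorm]. *)
Lemma enorm_pw (k : 'rV[int]_n) (s : R) : k != 0 ->
  enorm (zvec R k) `^ s <= (2 * n.+1%:R) `^ `|s| * pw k s /\
  pw k s <= (2 * n.+1%:R) `^ `|s| * enorm (zvec R k) `^ s.
Proof.
move=> k0; have e1 := enorm_zvec_ge1 k0.
have e0 : 0 < enorm (zvec R k) by rewrite (lt_le_trans ltr01).
have n1 : 1 <= n.+1%:R :> R by rewrite ler1n.
have h1 := enorm_le_wt R k; have h2 := wt_le_enorm R k.
have w1 := wt_ge1 R k.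
by rewrite !pwE; split; apply: powR_compare => //; rewrite ?wt_gt0//; nra.
Qed.

Lemma homogeneous_inverse q (rq : 'rV[R]_n -> cinf T) (N : nat) :
  homogeneous_symbol q rq -> (forall xi, xi != 0 -> cinf_invertible (rq xi)) ->
  exists2 C : R, 0 <= C & forall k (w : cinf T) i, k != 0 ->
    (rq (zvec R k) : T) ** w = aone ->
    nrm (coef w i) <= C * pw i (- N%:R) * pw k (- complex.Re q).
Proof.
move=> rh rinv; have [B0 hB0] := homogeneous_inverse_sphere N rh rinv.
pose B := `|B0|.
exists (B * (2 * n.+1%:R) `^ `|- complex.Re q|);
  first by rewrite mulr_ge0 ?powR_ge0 /B.
move=> k w i k0 rw.
have x0 := zvec_neq0 k0; have t0 := enorm_gt0 x0.
set xi := zvec R k in rw x0 t0 *; set t := enorm xi in t0 *.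
pose om := t^-1 *: xi.
have xE : xi = t *: om by rewrite /om scalerA divff ?scale1r// gt_eqF.
have om1 : enorm om = 1 by rewrite /om enormZ ?invr_ge0 ?(ltW t0)// mulVf//
  gt_eqF.
have om0 : om != 0 by rewrite scaler_eq0 invr_eq0 negb_or gt_eqF.
have [_ hom] := rh.
have rx : rq xi = cpow t q *: rq om by rewrite {1}xE hom.
(* By homogeneity [t ^ q w] is a right inverse of the symbol at the unit vector [om], so the bound
   on the sphere applies to it. *)
have := hB0 om (cpow t q *: w) om1.
rewrite cinf_scaleE amulZr -amulZl -cinf_scaleE -rx rw => /(_ erefl)
  /(wiener_le_coef i).
rewrite coefZ nrmM nrm_cpow mulrC -ler_pdivlMr ?powR_gt0// -powRN => h.
have [hp _] := enorm_pw (- complex.Re q) k0.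
set K := _ `^ `|_| in hp *.
apply: (@le_trans _ _ (B * pw i (- N%:R) * (K * pw k (- complex.Re q))));
  last first.
  by rewrite le_eqVlt; apply/orP; left; apply/eqP; ring.
apply: (le_trans h); apply: le_trans (ler_wpM2l _ hp);
  last by rewrite mulr_ge0 /B.
by rewrite !ler_wpM2r ?powR_ge0// ler_norm.
Qed.

End Sphere.

(** * Differences of symbols *)

Section Symbols.
Variables (R : realType) (n : nat) (theta : 'M[R]_n) (T : ncTorus theta).
Implicit Types (xi : 'rV[R]_n) (k l h : 'rV[int]_n) (f : 'rV[R]_n ->
  cinf T) (N : nat).

Lemma pderivP f i xi : (exists w, has_pderiv f i xi w) ->
  has_pderiv f i xi (pderiv i f xi).
Proof. by move=> ex; rewrite /pderiv; exact: xgetPex. Qed.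

Lemma mdelta0 (u : cinf T) : mdelta (fun=> 0%N) u = u.
Proof. by rewrite /mdelta; elim: (enum 'I_n) => //= i s ->. Qed.

(** Fixing one Fourier coefficient makes the symbol scalar, but the mean value theorem needs real
    values: [p] stands for the real or the imaginary part. Adding the two parts produces the factor
    2 of [coef_MVT]. *)
Lemma coef_MVT_part (p : R[i] -> R) f i l xi (M : R) :
  (forall y z, p (y - z) = p y - p z) ->
    (forall (a : R) z, p (a%:C * z) = a * p z) ->
  (forall z, `|p z| <= nrm z) ->
  smooth_on setT f ->
  (forall c : R, 0 <= c <= 1 ->
    nrm (coef (pderiv i f (xi + c *: delta_mx 0 i)) l) <= M) ->
  `|p (coef (f (xi + delta_mx 0 i)) l) - p (coef (f xi) l)| <= M.
Proof.
move=> pB pZ pN fs hM.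
pose x t := xi + t *: delta_mx 0 i : 'rV[R]_n.
pose g t := p (coef (f (x t)) l); pose dg t := p (coef (pderiv i f (x t)) l).
have [C C0 hC] := nrm_coef T.
have gd (t : R) : is_derive t (1 : R) g (dg t).
  have [_ /(_ i)/pderivP hd] := fs [::] (x t) Logic.I.
  have lim : (fun h : R => h^-1 *: ((g \o shift t) (h *: (1 : R)) - g t))
    @ 0^' --> dg t.
    apply/cvgrPdist_lt => e e0.
    have eC : 0 < (e / C)%:C by rewrite ltcR divr_gt0.
    have := hd (fun=> 0%N) _ eC; apply: filterS => s.
    rewrite snormE mdelta0 ltcR ltr_pdivlMr// => hs.
    rewrite distrC; apply: le_lt_trans hs.
    rewrite mulrC (le_trans _ (hC _ l))// (le_trans _ (pN _))//.
    rewrite cinf_subE cinf_scaleE cinf_subE coefB coefZ coefB pB pZ pB.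
    rewrite /g /dg /= /x -addrA -scalerDl.
    by rewrite [t + s]addrC [s *: 1]mulr1.
  by apply: DeriveDef; [apply/cvg_ex; exists (dg t)|exact: cvg_lim].
have gc : continuous g.
  by move=> t; apply: differentiable_continuous; apply/derivable1_diffP;
    have [] := gd t.
have [c cI gE] := MVT_segment (ler01 : 0 <= 1 :> R) (fun t _ => gd t)
  (continuous_subspaceT gc).
have -> : p (coef (f (xi + delta_mx 0 i)) l) - p (coef (f xi) l) = dg c.
  move: gE; rewrite subr0 mulr1 => <-; rewrite /g /x scale1r scale0r addr0 //.
rewrite (le_trans (pN _))// hM//; move: cI; rewrite in_itv //.
Qed.

Lemma coef_MVT f i l xi (M : R) :
  smooth_on setT f ->
  (forall c : R, 0 <= c <= 1 ->
    nrm (coef (pderiv i f (xi + c *: delta_mx 0 i)) l) <= M) ->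
  nrm (coef (f (xi + delta_mx 0 i)) l - coef (f xi) l) <= 2 * M.
Proof.
move=> fs hM; set z := _ - _.
have nRe (y : R[i]) : `|complex.Re y| <= nrm y.
  by rewrite /nrm normc_def /= -sqrtr_sqr ler_wsqrtr// lerDl sqr_ge0.
have nIm (y : R[i]) : `|complex.Im y| <= nrm y.
  by rewrite /nrm normc_def /= -sqrtr_sqr ler_wsqrtr// lerDr sqr_ge0.
have hRe := @coef_MVT_part (@complex.Re R) f i l xi M.
have hIm := @coef_MVT_part (@complex.Im R) f i l xi M.
have : nrm z <= `|complex.Re z| + `|complex.Im z|.
  rewrite {1}(complexE z) (le_trans (nrmD _ _))// nrmM !nrm_real.
  by rewrite nrm_i mul1r.
move=> /le_trans; apply; rewrite mulr2n mulrDl !mul1r; apply: lerD.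
  rewrite /z raddfB; apply: hRe => //; first by case=> a b [c d].
  by move=> a [c d] /=; rewrite mul0r subr0.
rewrite /z raddfB; apply: hIm => //; first by case=> a b [c d].
by move=> a [c d] /=; rewrite mul0r addr0.
Qed.

Lemma mpderiv0 f : mpderiv (fun=> 0%N) f = f.
Proof. by rewrite /mpderiv; elim: (enum 'I_n) => //= i s ->. Qed.

Lemma mpderiv1 i f : mpderiv (fun j => (j == i)%N : nat) f = pderiv i f.
Proof.
rewrite /mpderiv.
have H (s : seq 'I_n) : uniq s ->
  foldr (fun j => iter (j == i) (pderiv j))
    f s = if i \in s then pderiv i f else f.
  elim: s => //= j s IH /andP[js us]; rewrite IH// inE [i == j]eq_sym.
  by case: eqVneq => [ji|_] //=; rewrite -ji (negbTE js) /=.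
by rewrite H ?enum_uniq// mem_enum.
Qed.

Lemma msize1 i : msize (fun j : 'I_n => (j == i)%N : nat) = 1%N.
Proof. by rewrite /msize (bigD1 i)//= eqxx big1 ?addn0// => j /negbTE ->. Qed.

Lemma msize0 : msize (fun _ : 'I_n => 0%N) = 0%N.
Proof. by rewrite /msize big1. Qed.

Lemma fin_bound (I : finType) (Q : I -> R -> Prop) :
  (forall i M M', M <= M' -> Q i M -> Q i M') -> (forall i, exists M, Q i M) ->
  exists2 M, 0 <= M & forall i, Q i M.
Proof.
move=> mon /choice[M hM]; exists (\sum_i `|M i|); first exact: sumr_ge0.
move=> i; apply: mon (hM i); rewrite (le_trans (ler_norm _))//
  (bigD1 i)//= lerDl.
exact: sumr_ge0.
Qed.

Variables (q : R[i]) (rho : 'rV[R]_n -> cinf T) (rhos : nat -> 'rV[R]_n ->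
  cinf T).
Hypothesis rhoC : classical_symbol q rho rhos.
Local Notation m := (complex.Re q).

(** Applied to the axis seminorms of order [N], the asymptotic expansion yields decay of order [N]
    in the Fourier index, for arbitrary [N], with the same order in [xi]. *)
Lemma symbol_coef (J : nat) (b : mindex n) N : exists2 C : R,
  0 <= C & forall xi i,
  1 <= enorm xi ->
  nrm (coef (mpderiv b (fun x => rho x - \sum_(j < J) rhos j x) xi) i) <=
    C * pw i (- N%:R) * enorm xi `^ (m - J%:R - (msize b)%:R).
Proof.
have [_ _ asy] := rhoC; have [C C0 hC] := coef_decay T N.
have [M M0 hM] : exists2 M : R, 0 <= M & forall (o : option 'I_n) xi,
  1 <= enorm xi ->
    snorm (axis_index N o) (mpderiv b (fun x => rho x - \sum_(j < J) rhos j x)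
      xi) <=
      (M * enorm xi `^ (m - J%:R - (msize b)%:R))%:C.
  apply: fin_bound => [io M M' MM' h xi x1|io]; last exact: asy.
  by apply: (le_trans (h xi x1)); rewrite lecR ler_wpM2r ?powR_ge0.
exists (C * M); first by rewrite mulr_ge0 ?(ltW C0).
move=> xi i x1; set e := _ `^ _.
apply: (le_trans (hC _ (M * e) _ i)).
  by move=> o; have := hM o xi x1; rewrite snormE lecR.
by rewrite le_eqVlt; apply/orP; left; apply/eqP; ring.
Qed.

Lemma symbol_coef_wt (J : nat) N : exists2 C : R, 0 <= C & forall k i, k != 0 ->
  nrm (coef (rho (zvec R k) - \sum_(j < J) rhos j (zvec R k)) i) <=
    C * pw i (- N%:R) * pw k (m - J%:R).
Proof.
have [C C0 hC] := symbol_coef J (fun=> 0%N) N.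
exists (C * (2 * n.+1%:R) `^ `|m - J%:R|); first by rewrite mulr_ge0 ?powR_ge0.
move=> k i k0; have := hC (zvec R k) i (enorm_zvec_ge1 R k0).
rewrite mpderiv0 msize0 subr0 => /le_trans; apply.
have [h _] := enorm_pw (m - J%:R) k0.
apply: (le_trans (ler_wpM2l _ h)); first by rewrite mulr_ge0.
by rewrite le_eqVlt; apply/orP; left; apply/eqP; ring.
Qed.

Lemma symbol_bound N : exists2 C : R, 0 <= C & forall k i,
  nrm (coef (rho (zvec R k)) i) <= C * pw i (- N%:R) * pw k m.
Proof.
have [C C0 hC] := symbol_coef_wt 0 N.
have [M hM] := cinf_rapid_decay (rho (zvec R 0)) N.
exists (C + `|M|); first by rewrite addr_ge0.
move=> k i; have [->|k0] := eqVneq k 0.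
  rewrite pw0l mulr1 (le_trans (hM i))// ler_wpM2r//.
  by rewrite (le_trans (ler_norm _))// lerDr.
have := hC k i k0; rewrite big_ord0 !subr0 => /le_trans; apply.
by rewrite !ler_wpM2r// lerDl.
Qed.

Lemma zvecD k h : zvec R (k + h) = zvec R k + zvec R h.
Proof. by apply/rowP => i; rewrite !mxE rmorphD. Qed.

Lemma zvec_delta i : zvec R (delta_mx 0 i : 'rV[int]_n) = delta_mx 0 i.
Proof. by apply/rowP => j; rewrite !mxE; case: (_ && _). Qed.

Lemma wt_delta i : wt (delta_mx 0 i : 'rV[int]_n) = 2%N.
Proof.
rewrite /wt (bigD1 i)//= mxE !eqxx /= big1 ?addn0// => j /negbTE ji.
by rewrite mxE ji andbF.
Qed.

(* Far from the origin the segment stays where the estimates of the symbol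
   hold, so that the mean value theorem applies. *)
Lemma symbol_step_far N : exists2 C : R, 0 <= C & forall k i a,
  (n.+2 <= wt k)%N ->
  nrm (coef (rho (zvec R (k + delta_mx 0 i))) a - coef (rho (zvec R k)) a)
    <= C * pw a (- N%:R) * pw k (m - 1).
Proof.
have [rs _ _] := rhoC.
have [C C0 hC] : exists2 C : R, 0 <= C & forall (i : 'I_n) xi a,
  1 <= enorm xi ->
    nrm (coef (pderiv i rho xi) a) <= C * pw a (- N%:R) * enorm xi `^ (m - 1).
  apply: fin_bound => [i M M' MM' h xi a x1|i].
    by apply: (le_trans (h xi a x1)); rewrite !ler_wpM2r ?powR_ge0.
  have [C C0 hC] := symbol_coef 0 (fun j => (j == i)%N : nat) N;
    exists C => xi a x1.
  have := hC xi a x1; rewrite mpderiv1 msize1 subr0.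
  rewrite (_ : (fun x => rho x - _) = rho)//.
  by apply/funext => x; rewrite big_ord0 subr0.
exists (2 * (C * n.+2%:R `^ `|m - 1|)); first by rewrite !mulr_ge0 ?powR_ge0.
move=> k i a kn.
pose K := C * pw a (- N%:R) * (n.+2%:R `^ `|m - 1| * pw k (m - 1)).
apply: (@le_trans _ _ (2 * K)); last first.
  by rewrite le_eqVlt; apply/orP; left; apply/eqP; rewrite /K; ring.
rewrite zvecD zvec_delta; apply: coef_MVT => // c c01.
set xi := _ + _.
have l1 : `|\sum_j `|xi 0 j| - \sum_j `|zvec R k 0 j| | <= 1.
  rewrite -sumrB (bigD1 i)//= big1 => [|j /negbTE ji]; last first.
    by rewrite /xi !mxE ji andbF mulr0 addr0 subrr.
  rewrite addr0 (le_trans (ler_dist_dist _ _))//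
    /xi !mxE !eqxx /= mulr1 addrAC subrr add0r.
  by case/andP: c01 => c0 c1; rewrite ger0_norm.
have wE := wtE R k; set s := \sum_j `|zvec R k 0 j| in l1 wE.
set s' := \sum_j `|xi 0 j| in l1.
have es : enorm xi <= s' by exact: enorm_le.
have se : s' <= n%:R * enorm xi.
  rewrite /s' (le_trans (ler_sum _ (fun j _ => le_enorm xi j)))//.
  by rewrite sumr_const card_ord mulr_natl.
have kw : n.+2%:R <= (wt k)%:R :> R by rewrite ler_nat.
have n2 : n.+2%:R = n%:R + 2 :> R by rewrite -natr1 -natr1 -addrA.
have n0 : 0 <= n%:R :> R by [].
have e0 := enorm_ge0 xi.
move: l1; rewrite ler_norml => /andP[l1 l2].
(* The l1 norm changes by at most 1 along the segment, so it stays at least [wt k - 2 >= n]; were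
   [enorm xi] below 1, it would be smaller than [n]. Hence the threshold [n.+2]. *)
have e1 : 1 <= enorm xi.
  rewrite leNgt; apply/negP => e1.
  have : n%:R * enorm xi <= n%:R by rewrite -[leRHS]mulr1 ler_wpM2l// ltW.
  have : n%:R <= s' by rewrite wE n2 in kw; lra.
  move=> h1 h2.
  have npos : 0 < n%:R :> R by rewrite ltr0n (leq_ltn_trans _ (ltn_ord i)).
  have : n%:R * enorm xi < n%:R by rewrite -[ltRHS]mulr1 ltr_pM2l.
  by lra.
apply: (le_trans (hC i xi a e1)); rewrite /K ler_wpM2l ?mulr_ge0//.
(* The weights at [xi] and [k] agree up to [n + 2]: [enorm xi] is at most [wt k], and [wt k <= n
   enorm xi + 2 <= (n + 2) enorm xi]. *)
rewrite pwE; apply: powR_compare; rewrite ?wt_gt0 ?ler1n//; first by lra.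
  have w1 := wt_ge1 R k; have : enorm xi <= (wt k)%:R + 1 by lra.
  by rewrite n2; nra.
by rewrite n2 mulrDl; lra.
Qed.

Lemma symbol_step N : exists2 C : R, 0 <= C & forall k i a,
  nrm (coef (rho (zvec R (k + delta_mx 0 i))) a - coef (rho (zvec R k)) a)
    <= C * pw a (- N%:R) * pw k (m - 1).
Proof.
have [C C0 hC] := symbol_step_far N; have [D D0 hD] := symbol_bound N.
pose E := (D * 2 `^ `|m| + D) * n.+2%:R.
have E0 : 0 <= E by rewrite /E mulr_ge0// addr_ge0// mulr_ge0// powR_ge0.
exists (C + E); first by rewrite addr_ge0.
move=> k i a; have [kn|kn] := leqP n.+2 (wt k).
  by apply: (le_trans (hC k i a kn)); rewrite !ler_wpM2r// lerDl.
have h1 : pw (k + delta_mx 0 i) m <= 2 `^ `|m| * pw k m.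
  by have := pw_peetre k (delta_mx 0 i) m;
    rewrite [X in _ <= X * _]pwE wt_delta.
have h2 : pw k m <= n.+2%:R * pw k (m - 1).
  have -> : pw k m = pw k 1 * pw k (m - 1) by rewrite -pwD addrCA subrr addr0.
  by rewrite ler_wpM2r// !pwE powRr1// ler_nat ltnW.
apply: (@le_trans _ _ (E * pw a (- N%:R) * pw k (m - 1))); last first.
  by rewrite !ler_wpM2r// lerDr.
rewrite (le_trans (nrmD _ _))// nrmN.
apply: (le_trans (lerD (hD _ _) (hD _ _))).
have pa := pw_ge0 a (- N%:R : R); have pk := pw_ge0 k (m - 1).
apply: (@le_trans _ _ (D * pw a (- N%:R)
  * (2 `^ `|m| * (n.+2%:R * pw k (m - 1))) + D * pw a (- N%:R)
  * (n.+2%:R * pw k (m - 1)))).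
  apply: lerD; apply: ler_wpM2l; rewrite ?mulr_ge0//.
  by rewrite (le_trans h1)// ler_wpM2l ?powR_ge0.
by rewrite le_eqVlt; apply/orP; left; apply/eqP; rewrite /E; ring.
Qed.

(* The lattice points are joined by a path of unit steps. *)
Lemma symbol_diff N : exists2 C : R, 0 <= C & forall h k a,
  nrm (coef (rho (zvec R (k + h))) a - coef (rho (zvec R k)) a)
    <= C * pw a (- N%:R) * pw h (1 + `|m - 1|) * pw k (m - 1).
Proof.
have [C C0 hC] := symbol_step N; exists C => //.
(* The factor [wt h - 1] is the number of unit steps from [k] to [k + h]. The power of [pw h]
   compares the weight at intermediate points with the weight at [k]. *)
pose P h k a := nrm (coef (rho (zvec R (k + h))) a - coef (rho (zvec R k)) a)
    <= ((wt h)%:R - 1) * (C * pw a (- N%:R) * pw h `|m - 1| * pw k (m - 1)).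
suff key h k a : P h k a.
  move=> h k a; apply: (le_trans (key h k a)); rewrite (pwD h).
  have -> : pw h 1 = (wt h)%:R :> R by rewrite !pwE powRr1.
  set K := C * _ * pw h _ * _.
  have K0 : 0 <= K by rewrite /K !mulr_ge0.
  apply: (@le_trans _ _ ((wt h)%:R * K)); first by rewrite ler_wpM2r// gerBl.
  by rewrite le_eqVlt; apply/orP; left; apply/eqP; rewrite /K; ring.
(* One unit step between [h'] and [g]. The point [p] is the end with the smaller [i]-th coordinate,
   so that [symbol_step] covers both directions. *)
have step g h' p (i : 'I_n) : (wt h').+1 = wt g -> (wt (p - k) <= wt g)%N ->
    P h' k a ->
    nrm (coef (rho (zvec R (k + g))) a - coef (rho (zvec R (k + h'))) a) =
    nrm (coef (rho (zvec R (p + delta_mx 0 i))) a - coef (rho (zvec R p)) a) ->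
    P g k a.
  move=> wh wp IH E; rewrite /P.
  rewrite -(subrKA (coef (rho (zvec R (k + h'))) a)) (le_trans (nrmD _ _))//.
  set X := C * pw a (- N%:R) * pw g `|m - 1| * pw k (m - 1).
  rewrite -wh -natr1 addrK -[X in _ <= X * _](subrK 1)
    mulrDl mul1r addrC lerD//.
    apply: (le_trans IH); rewrite ler_wpM2l ?subr_ge0 ?wt_ge1//.
    rewrite /X ler_wpM2r// ler_wpM2l ?mulr_ge0//.
    by rewrite !pwE ge0_ler_powR ?nnegrE// ler_nat -wh.
  rewrite E (le_trans (hC p i a))// /X -[leRHS]mulrA ler_wpM2l ?mulr_ge0//.
  apply: (le_trans (pw_peetreB p k _)); rewrite ler_wpM2r//.
  by rewrite !pwE ge0_ler_powR ?nnegrE// ler_nat.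
have [w wh] := ubnP (wt h); elim: w h wh => // w IH h wh.
have [->|h0] := eqVneq h 0.
  by rewrite /P addr0 subrr nrm0 wt0 subrr mul0r.
have [i hi] : exists i, h ord0 i != 0.
  apply/existsP; rewrite -negb_forall; apply: contra h0 => /forallP h0.
  by apply/eqP/rowP => i; rewrite mxE; exact: (eqP (h0 i)).
have wtdec (e : int) : `|h ord0 i|%N = `|(h ord0 i + e)%R|%N.+1 ->
    (wt (h + e *: delta_mx 0 i)).+1 = wt h.
  move=> he; rewrite /wt (bigD1 i)//= [in RHS](bigD1 i)//= !mxE !eqxx mulr1.
  congr S; rewrite [in RHS](_ : `|h ord0 i|%N = `|(h ord0 i + e)%R|%N.+1)//
    addSn.
  congr (_ + _).+1; apply: eq_bigr => j /negbTE ji.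
  by rewrite !mxE ji andbF mulr0 addr0.
have [hpos|hneg] := ltP 0 (h ord0 i).
  have wd := wtdec (-1) ltac:(lia).
  apply: (step h (h + (-1) *: delta_mx 0 i) (k + (h + (-1) *: delta_mx 0 i))
    i wd).
  - by rewrite addrC addKr -wd.
  - by apply: IH; rewrite -ltnS wd.
  - by rewrite -addrA scaleN1r subrK.
have wd := wtdec 1 ltac:(lia).
apply: (step h (h + 1 *: delta_mx 0 i) (k + h) i wd).
- by rewrite addrC addKr.
- by apply: IH; rewrite -ltnS wd.
- by rewrite nrmB scale1r addrA.
Qed.

(** Moving the argument from [j] to [k] loses one order by [symbol_diff], and so does replacing
    [rho] by its leading term at [k]. *)
Lemma symbol_principal_diff N : exists2 C : R, 0 <= C & forall j k a, k != 0 ->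
  nrm (coef (rho (zvec R j) - rhos 0%N (zvec R k)) a)
    <= C * pw a (- N%:R) * pw (j - k) (1 + `|m - 1|) * pw k (m - 1).
Proof.
have [C C0 hC] := symbol_diff N; have [D D0 hD] := symbol_coef_wt 1 N.
exists (C + D); first by rewrite addr_ge0.
move=> j k a k0; rewrite cinf_subE coefB -(subrKA (coef (rho (zvec R k)) a)).
rewrite (le_trans (nrmD _ _))// !mulrDl lerD//.
  by have := hC (j - k) k a; rewrite [k + _]addrC subrK.
have := hD k a k0; rewrite big_ord1 cinf_subE coefB => /le_trans; apply.
rewrite ler_wpM2r// ler_peMr ?mulr_ge0//.
by rewrite pw_ge1// addr_ge0.
Qed.

End Symbols.

(** * The Hilbert space *)

Section Hilbert.
Variables (R : realType) (V : hilbertType R).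
Implicit Types (x y z : V) (a : R[i]).

Lemma ipDl x y z : ip (x + y) z = ip x z + ip y z.
Proof. by have := ip_scalar z 1 x y; rewrite scale1r mul1r. Qed.

Lemma ip0l x : ip 0 x = 0 :> R[i].
Proof. by apply: (addrI (ip 0 x)); rewrite -ipDl !addr0. Qed.

Lemma ipZl a x y : ip (a *: x) y = a * ip x y.
Proof. by have := ip_scalar y a x 0; rewrite ip0l !addr0. Qed.

Lemma ipNl x y : ip (- x) y = - ip x y.
Proof. by rewrite -scaleN1r ipZl mulN1r. Qed.

Lemma ipBl x y z : ip (x - y) z = ip x z - ip y z.
Proof. by rewrite ipDl ipNl. Qed.

Lemma ipDr x y z : ip x (y + z) = ip x y + ip x z.
Proof. by rewrite ip_conj ipDl rmorphD /= -!ip_conj. Qed.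

Lemma ipZr a x y : ip x (a *: y) = a^*%C * ip x y.
Proof. by rewrite ip_conj ipZl rmorphM /= -ip_conj. Qed.

Lemma ipNr x y : ip x (- y) = - ip x y.
Proof. by rewrite ip_conj ipNl rmorphN /= -ip_conj. Qed.

Lemma ipBr x y z : ip x (y - z) = ip x y - ip x z.
Proof. by rewrite ipDr ipNr. Qed.

Lemma ip_nrm x : ip x x = (nrm x ^+ 2)%:C.
Proof. by rewrite ip_norm nrmE rmorphXn. Qed.

Lemma sqr_nrm_mul (c : R[i]) : c * c^*%C = (nrm c ^+ 2)%:C.
Proof. by rewrite -sqr_normc nrmE rmorphXn. Qed.

(** With [d = |y|^2] and [s = (x|y)], the vector [d x - s y] has squared norm [d (d |x|^2 - |s|^2)],
    which is nonnegative. *)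
Lemma cauchy_schwarz x y : nrm (ip x y) <= nrm x * nrm y.
Proof.
have [->|y0] := eqVneq y 0.
  by rewrite -(scale0r 0) ipZr rmorph0 mul0r nrm0 mulr_ge0.
have ny : 0 < nrm y by rewrite -ltcR -nrmE normr_gt0.
set s := ip x y; set d := nrm y ^+ 2.
have d0 : 0 < d by rewrite exprn_gt0.
have sE : ip y x = s^* by rewrite ip_conj.
have dC : d%:C != 0 by rewrite gt_eqF// ltcR.
have h : (nrm (d%:C *: x - s *: y)
  ^+ 2)%:C = (d * (d * nrm x ^+ 2 - nrm s ^+ 2))%:C.
  rewrite -ip_nrm ipBl !ipBr !ipZl !ipZr !ip_nrm sE -/s.
  have conjR (r : R) : (r%:C)^*%C = r%:C by exact: conjc_real.
  have hS := sqr_nrm_mul s.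
  have -> : (d * (d * nrm x ^+ 2 - nrm s ^+ 2))%:C =
      d%:C * (d%:C * (nrm x ^+ 2)%:C - (nrm s ^+ 2)%:C).
    by rewrite -!rmorphM -rmorphB -rmorphM.
  by rewrite conjR -hS -/d; ring.
have : 0 <= d * (d * nrm x ^+ 2 - nrm s ^+ 2).
  by move/complexI: h => <-; exact: sqr_ge0.
rewrite pmulr_rge0// subr_ge0 /d -exprMn => h2.
by rewrite mulrC -(@ler_pXn2r _ 2) ?nnegrE ?mulr_ge0.
Qed.

End Hilbert.

Section Series.
Variables (R : realType) (n : nat) (V : normedModType R[i]).
Implicit Types (k : 'rV[int]_n) (t : R) (N : nat).

(** The last clause is continuity, which lets the seminorm pass through convergent series. *)
Definition seminorm (p : V -> R) :=
  [/\ forall y z, p (y + z) <= p y + p z,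
      forall a y, p (a *: y) = nrm a * p y &
      exists D, forall y, p y <= D * nrm y].

Lemma seminorm_ge0 p y : seminorm p -> 0 <= p y.
Proof.
move=> [pD pZ _]; have := pD y ((-1) *: y).
rewrite scaleN1r subrr -(scale0r 0) pZ nrm0 mul0r -scaleN1r pZ nrmN nrm1 mul1r.
by move=> h; lra.
Qed.

(** Coefficients concentrated near [k] beat terms growing like a power [t] of the distance to [k];
    what remains is the summable weight [pw (j - k) (- (2 * n)%:R)]. The bound is thus uniform in
    [k]. *)
Lemma series_bound p (c : 'rV[int]_n -> R[i]) z y k (M B t : R) N :
  seminorm p -> hassum (fun j => c j *: z j) y -> t + (2 * n)%:R <= N%:R ->
  (forall j, nrm (c j) <= M * pw (j - k) (- N%:R)) ->
  (forall j, p (z j) <= B * pw (j - k) t) -> p y <= M * B * 3 ^+ n.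
Proof.
move=> sp cy tN cM zB; have [pD pZ [D pN]] := sp.
have M0 : 0 <= M by have := cM k; rewrite subrr pw0l mulr1; exact: le_trans.
have B0 : 0 <= B.
  by have := zB k; rewrite subrr pw0l mulr1; apply: le_trans;
    exact: seminorm_ge0.
apply: (hassum_seminorm (g := fun j => M * B * pw (j - k) (- (2 * n)%:R))
  pD pN _ _ cy).
  move=> j; rewrite pZ (le_trans (ler_pM _ _ (cM j) (zB j)))//;
    first exact: seminorm_ge0.
  have -> : M * pw (j - k) (- N%:R) * (B * pw (j - k) t) =
      M * B * (pw (j - k) (- N%:R) * pw (j - k) t) by ring.
  rewrite ler_wpM2l ?mulr_ge0// -pwD ler_pw//; lra.
move=> A; rewrite -mulr_sumr ler_wpM2l ?mulr_ge0//.
exact: (bsum_reindex (h := fun j => j - k) (addIr (- k)) (@bsum_pw R n) A).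
Qed.

End Series.

Lemma nat_above (R : realType) (t : R) : exists N : nat, t <= N%:R.
Proof.
by exists (Num.truncn `|t|).+1;
  rewrite (le_trans (ler_norm _))// ltW// truncnS_gt.
Qed.

(** * Fourier coefficients and density in the Hilbert space *)

Section L2.
Variables (R : realType) (n : nat) (theta : 'M[R]_n) (T : ncTorus theta).
Variable H : L2completion T.
Implicit Types (k l : 'rV[int]_n) (x y : H) (u v : T).
Local Notation U := (Uk T).
Local Notation E := (L2_in H).

Definition fcoef l x : R[i] := ip x (E (U l)).

Lemma fcoef_in u l : fcoef l (E u) = coef u l.
Proof. by rewrite /fcoef L2_ip. Qed.

Lemma L2_in_bounded : exists2 C : R, 0 < C & forall u, nrm (E u) <= C * nrm u.
Proof.
have [C C0 hC] := trace_bounded T.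
exists (Num.sqrt C); first by rewrite sqrtr_gt0.
move=> u; rewrite -(@ler_pXn2r _ 2) ?nnegrE ?mulr_ge0 ?sqrtr_ge0//.
rewrite exprMn sqr_sqrtr ?(ltW C0)//.
have : nrm (ip (E u) (E u)) = nrm (E u) ^+ 2.
  by rewrite ip_nrm nrm_real ger0_norm// sqr_ge0.
rewrite L2_ip => <-; rewrite (le_trans (hC _))// ler_wpM2l ?(ltW C0)//.
by rewrite (le_trans (nrm_amul _ _))// nrm_star -expr2.
Qed.

Lemma nrm_L2_in_U l : nrm (E (U l)) = 1.
Proof.
have : nrm (E (U l)) ^+ 2 = 1.
  apply: complexI; rewrite -ip_nrm L2_ip.
  by have := coef_U T l l; rewrite /coef eqxx.
by move=> /eqP; rewrite sqrp_eq1 ?nrm_ge0// => /eqP.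
Qed.

Lemma nrm_fcoef l x : nrm (fcoef l x) <= nrm x.
Proof. by rewrite (le_trans (cauchy_schwarz _ _))// nrm_L2_in_U mulr1. Qed.

Lemma L2_inB u v : E (u - v) = E u - E v.
Proof. exact: raddfB. Qed.

Lemma L2_inD u v : E (u + v) = E u + E v.
Proof. exact: raddfD. Qed.

Lemma L2_inZ a u : E (a *: u) = a *: E u.
Proof. exact: linearZ. Qed.

Lemma L2_approx x (e : R) : 0 < e -> exists2 p : T, tpoly p & nrm (x - E p) < e.
Proof.
move=> e0; have [C C0 hC] := L2_in_bounded.
have e2 : 0 < e / 2 by rewrite divr_gt0.
have e2c : 0 < (e / 2)%:C by rewrite ltcR.
have [y [/= xu [u _ ue]]] : exists y, ball x (e / 2)%:C y /\ range E y.
  apply: (@L2_dense _ _ _ _ H (ball x (e / 2)%:C)); last exact: ball_open.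
  by exists x; exact: ballxx.
move: xu; rewrite -ue -ball_normE /ball_ /= -nrm_lt => xu.
have [p tp up] := tpoly_dense u (divr_gt0 e2 C0).
exists p => //; rewrite -(subrKA (E u)) -L2_inB (le_lt_trans (nrmD _ _))//.
rewrite [e]splitr ltrD// (le_lt_trans (hC _))// mulrC -ltr_pdivlMr//.
Qed.

Lemma L2_approx_cinf x (e : R) : 0 < e ->
  exists p : cinf T, nrm (x - E (p : T)) < e.
Proof.
move=> /(L2_approx x)[p tp xp]; exists (to_cinf p).
by rewrite to_cinfK//; exact: tpoly_smooth.
Qed.

(** Such an [x] is orthogonal to all trigonometric polynomials [p], so [|x|^2] is the scalar product
    of [x] with [x - p], which is arbitrarily small by density. *)
Lemma fcoef_inj x : (forall l, fcoef l x = 0) -> x = 0.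
Proof.
move=> x0; have xp p : tpoly p -> ip x (E p) = 0.
  elim=> [|a k r _ IH]; first by rewrite raddf0 -(scale0r 0) ipZr rmorph0 mul0r.
  by rewrite L2_inD L2_inZ ipDr ipZr IH addr0 -/(fcoef k x) x0 mulr0.
apply: nrm_eq0; apply/eqP; rewrite -[_ == 0]sqrf_eq0 eq_le sqr_ge0 andbT.
apply: le_epsilon => e e0; rewrite add0r.
have e1 : 0 < e / (nrm x + 1) by rewrite divr_gt0// ltr_wpDl.
have [p tp] := L2_approx x e1; rewrite ltr_pdivlMr ?ltr_wpDl// => h.
have -> : nrm x ^+ 2 = nrm (ip x (x - E p)).
  by rewrite ipBr xp// subr0 ip_nrm nrm_real ger0_norm// sqr_ge0.
rewrite (le_trans (cauchy_schwarz _ _))// mulrC (le_trans _ (ltW h))//.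
by rewrite ler_wpM2l// lerDl.
Qed.

Lemma fcoefB l x y : fcoef l (x - y) = fcoef l x - fcoef l y.
Proof. exact: ipBl. Qed.

Lemma fcoefZ l a x : fcoef l (a *: x) = a * fcoef l x.
Proof. exact: ipZl. Qed.

Lemma fcoefD l x y : fcoef l (x + y) = fcoef l x + fcoef l y.
Proof. exact: ipDl. Qed.

Lemma L2_distE u : L2_dist (E u) = alg_dist u.
Proof. by apply/funext => v; rewrite /L2_dist L2_ip starK. Qed.

Lemma fcoef_dist l x : fcoef l x = L2_dist x (to_cinf (star (U l))).
Proof. by rewrite /L2_dist to_cinfK ?starK//; exact: smooth_star_U. Qed.

Lemma seminorm_dist x : seminorm (fun u : T => nrm (ip x (E (star u)))).
Proof.
have [C C0 hC] := L2_in_bounded.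
split=> [u v|a u|]; first by rewrite starD L2_inD ipDr nrmD.
  rewrite starZ L2_inZ ipZr nrmM [X in nrm X * _](_ : _ = a)//; exact: conjcK.
exists (nrm x * C) => u; rewrite (le_trans (cauchy_schwarz _ _))//.
by rewrite -mulrA ler_wpM2l// (le_trans (hC _))// nrm_star.
Qed.

Lemma cinf_addE (u v : cinf T) : ((u + v : cinf T) : T) = (u : T) + (v : T).
Proof. exact: (raddfD (\val : cinf T -> T)). Qed.

Lemma distribution_alg (u : T) : Defs.distribution (alg_dist u : cinf T ->
  R[i]).
Proof.
split=> [a v w|u0 e /gt0_ReC[-> e0]].
  by rewrite /alg_dist cinf_addE cinf_scaleE amulDr amulZr traceD traceZ.
have [C C0 hC] := trace_bounded T.
have d0 : 0 < complex.Re e / (C * (nrm u + 1)) by rewrite divr_gt0// mulr_gt0//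
  ltr_wpDl.
exists 0%N, (complex.Re e / (C * (nrm u + 1)))%:C; split; first by rewrite ltcR.
move=> v /(_ (fun=> 0%N)); rewrite msize0 => /(_ isT).
rewrite snormE mdelta0 ltcR ltr_pdivlMr ?mulr_gt0 ?ltr_wpDl// => h.
rewrite -nrm_lt /alg_dist -traceB -amulBr -cinf_subE (le_lt_trans (hC _))//.
apply: le_lt_trans h; rewrite [leRHS]mulrCA ler_wpM2l ?(ltW C0)//.
rewrite (le_trans (nrm_amul _ _))// mulrC ler_wpM2l//.
by rewrite lerDl.
Qed.

Lemma sobolev_smooth (s : R) (u : cinf T) : sobolev s (L2_dist (E (u : T))).
Proof.
rewrite L2_distE; split; first exact: distribution_alg.
(* The Sobolev weight of order [s] is at most [pw k (2 |s|)]; the further [2 n] orders make the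
   series summable. *)
have [N hN] := nat_above (2 * `|s| + (2 * n)%:R).
have [M hM] := cinf_rapid_decay u N.
have M0 : 0 <= M by have := hM 0; rewrite pw0l mulr1; exact: le_trans.
apply: (@le_lt_trans _ _ (M ^+ 2 * 3 ^+ n)%:E); last by rewrite ltry.
apply: ge_ereal_sup => _ [A [fA _] <-].
rewrite fsbig_finite//= sumEFin lee_fin.
have h := ler_wpM2l (sqr_ge0 M) (@bsum_pw R n (fset_set A)).
apply: le_trans h; rewrite mulr_sumr; apply: ler_sum => k _.
rewrite (_ : alg_dist _ _ = coef u k);
  last by rewrite -fcoef_in fcoef_dist L2_distE.
rewrite -/(nrm _).
have h1 : (1 + enorm (zvec R k) ^+ 2) `^ s <= pw k (2 * `|s|).
  have e0 := enorm_ge0 (zvec R k).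
  have e1 : 1 <= 1 + enorm (zvec R k) ^+ 2 by rewrite lerDl sqr_ge0.
  apply: (@le_trans _ _ ((1 + enorm (zvec R k) ^+ 2) `^ `|s|)).
    by rewrite ler_powR// ler_norm.
  rewrite !pwE powRrM (powR_mulrn 2)//.
  apply: ge0_ler_powR; rewrite ?nnegrE ?exprn_ge0//; first exact: le_trans e1.
  by have := enorm_le_wt R k; nra.
have h2 : nrm (coef u k) ^+ 2 <= (M * pw k (- N%:R)) ^+ 2.
  by rewrite lerXn2r ?nnegrE ?mulr_ge0.
apply: (le_trans (ler_pM (powR_ge0 _ _) (sqr_ge0 _) h1 h2)).
rewrite exprMn mulrCA ler_wpM2l ?sqr_ge0//.
have pN : pw k (- N%:R) <= 1 :> R by rewrite pw_le1// oppr_le0.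
have p0 := pw_ge0 k (- N%:R : R).
apply: (@le_trans _ _ (pw k (2 * `|s|) * pw k (- N%:R))).
  by rewrite ler_wpM2l// expr2 ler_piMr.
by rewrite -pwD ler_pw//; lra.
Qed.

End L2.

(** * Approximate inverses and the resolvent *)

Lemma seminorm_phase_eq (R : realType) (A : cstarType R) (p : A -> R)
    (x y : A) :
  seminorm p -> phase_eq x y -> p x = p y.
Proof. by move=> [_ pZ _] [c c1 ->]; rewrite pZ c1 mul1r. Qed.

Lemma le_of_eq (R : realType) (x y : R) : x = y -> x <= y.
Proof. by move->. Qed.

Section Parametrix.
Variables (R : realType) (n : nat) (theta : 'M[R]_n) (T : ncTorus theta).
Implicit Types (k l j : 'rV[int]_n) (u v : cinf T) (N : nat) (t : R).
Local Notation U := (Uk T).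

(** Left multiplication by [u] spreads [U j] over the monomials [U (i + j)]. Peetre's inequality
    compares their weights with that of [j] at the cost [pw i t], which the decay of [u] absorbs, so
    the rate [t] survives. *)
Lemma mul_U_bound (p : T -> R) u j (c B t : R) N : seminorm p ->
  (forall j, p (U j) <= B * pw j (- t)) -> 0 <= t -> t + (2 * n)%:R <= N%:R ->
  (forall i, nrm (coef u i) <= c * pw i (- N%:R)) ->
  p ((u : T) ** U j) <= c * (B * pw j (- t)) * 3 ^+ n.
Proof.
move=> sp pB t0 tN uc.
have B0 : 0 <= B by have := pB 0; rewrite pw0l mulr1; apply: le_trans;
  exact: seminorm_ge0.
have hs := hassum_mulr (U j) (cinf_hassum u).
apply: (@series_bound R n T p (coef u) (fun i => U i ** U j)
  _ 0 c (B * pw j (- t)) t N sp _ tN).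
- by apply: eq_hassum hs => i; rewrite amulZl.
- by move=> i; rewrite subr0.
- move=> i; rewrite subr0 (seminorm_phase_eq sp (U_mul T i j))
  (le_trans (pB _))//.
  rewrite -mulrA ler_wpM2l// addrC mulrC.
  by have := pw_peetre j i (- t); rewrite normrN ger0_norm.
Qed.

Lemma star_U_bound (p : T -> R) u l (c B t : R) N : seminorm p ->
  (forall j, p (star (U j)) <= B * pw j (- t)) -> 0 <= t ->
    t + (2 * n)%:R <= N%:R ->
  (forall i, nrm (coef u i) <= c * pw i (- N%:R)) ->
  p (star (U l) ** (u : T)) <= c * (B * pw l (- t)) * 3 ^+ n.
Proof.
move=> sp pB t0 tN uc.
have B0 : 0 <= B by have := pB 0; rewrite pw0l mulr1; apply: le_trans;
  exact: seminorm_ge0.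
have hs := hassum_mull (star (U l)) (cinf_hassum u).
apply: (@series_bound R n T p (coef u) (fun i => star (U l) ** U i)
  _ 0 c (B * pw l (- t)) t N sp _ tN).
- by apply: eq_hassum hs => i; rewrite amulZr.
- by move=> i; rewrite subr0.
- move=> i; rewrite subr0.
  have e : phase_eq (star (U l) ** U i) (star (U (l - i))).
    by rewrite -[X in phase_eq X]starK starM starK; apply: phase_eq_star;
      exact: star_U_mul.
  rewrite (seminorm_phase_eq sp e) (le_trans (pB _))//.
  rewrite -mulrA ler_wpM2l// mulrC.
  by have := pw_peetre l (- i) (- t); rewrite normrN ger0_norm// pwN.
Qed.

Variables (q : R[i]) (rho : 'rV[R]_n -> cinf T) (rhos : nat -> 'rV[R]_n ->
  cinf T).
Hypothesis rhoC : classical_symbol q rho rhos.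
Hypothesis rhoI : forall xi, xi != 0 -> cinf_invertible (rhos 0%N xi).
Local Notation m := (complex.Re q).
Local Notation rq k := (rhos 0%N (zvec R k)).

Lemma cinf_coef_bound u N : exists2 C : R, 0 <= C & forall k,
  nrm (coef u k) <= C * pw k (- N%:R).
Proof.
have [M hM] := cinf_rapid_decay u N; exists M => //.
by have := hM 0; rewrite pw0l mulr1; exact: le_trans.
Qed.

Lemma rho_norm : exists2 C : R, 0 <= C & forall k,
  nrm (rho (zvec R k) : T) <= C * pw k m.
Proof.
have [C C0 hC] := symbol_bound rhoC (2 * n).
exists (C * 3 ^+ n); first by rewrite mulr_ge0.
move=> k; rewrite mulrAC; apply: (nrm_cinf_le (g := fun i => nrm (coef (rho
  (zvec R k)) i))) => //.
apply: (bsum_rapid_decay (leqnn (2 * n))); first by rewrite mulr_ge0.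
by move=> i; rewrite mulrAC.
Qed.

(** The symbol grows at most like [|k|^m] while the coefficients of [u] decay rapidly, so the [sum]
    in [quantize] is the value of a convergent series. *)
Lemma quantize_hassum u :
  hassum (fun k => coef u k *: ((rho (zvec R k) : T) ** U k)) (quantize rho u).
Proof.
have [C C0 hC] := rho_norm.
have [N hN] := nat_above (`|m| + (2 * n)%:R).
have [M M0 hM] := cinf_coef_bound u N.
suff [x hx] : exists x : T, hassum (fun k => coef u k *: ((rho (zvec R k) : T)
  ** U k)) x.
  by rewrite /quantize (hassum_sum hx).
apply: (@hassum_ex R _ T _ (fun k => C * M * pw k (- (2 * n)%:R))
  (C * M * 3 ^+ n)) => [k|A].
  rewrite nrmZ.
  have h : nrm ((rho (zvec R k) : T) ** U k) <= C * pw k m.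
    by rewrite (le_trans (nrm_amul _ _))// nrm_U mulr1.
  rewrite (le_trans (ler_pM _ _ (hM k) h))//.
  have -> : M * pw k (- N%:R) * (C * pw k m) = C * M * (pw k (- N%:R) * pw k m)
    by ring.
  rewrite ler_wpM2l ?mulr_ge0// -pwD ler_pw//.
  by have := ler_norm m; lra.
by rewrite -mulr_sumr ler_wpM2l ?mulr_ge0//; exact: bsum_pw.
Qed.

(** Freezing the symbol: [P] is compared with left multiplication by the principal symbol at one
    fixed [k]. Both the column and the row remainders are estimated from this series. *)
Lemma quantize_diff u k :
  hassum (fun j => coef u j *: (((rho (zvec R j) - rq k : cinf T) : T) ** U j))
    (quantize rho u - (rq k : T) ** u).
Proof.
have h := hassumB (quantize_hassum u) (hassum_mull (rq k : T) (cinf_hassum u)).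
by apply: eq_hassum h => j; rewrite amulZr -scalerBr -amulBl cinf_subE.
Qed.

Variable sig : 'rV[int]_n -> cinf T.
Hypothesis sigP : forall k, k != 0 ->
  (rq k : T) ** sig k = aone /\ (sig k : T) ** rq k = aone.

Lemma sig_coef N : exists2 C : R, 0 <= C & forall k i, k != 0 ->
  nrm (coef (sig k) i) <= C * pw i (- N%:R) * pw k (- m).
Proof.
have [_ /(_ 0%N) + _] := rhoC; rewrite subr0 => rh.
have [C C0 hC] := homogeneous_inverse N rh rhoI.
by exists C => // k i k0; apply: hC => //; have [] := sigP k0.
Qed.

(** The constant is chosen before [p] and [B], because the lemma is used for the norms of successive
    powers of the resolvent. The gain [m] is the size of [sig k]. *)
Lemma sig_U_bound t : 0 <= t -> exists2 C : R, 0 <= C & forall (p : T -> R) B,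
  seminorm p -> (forall j, p (U j) <= B * pw j (- t)) ->
  forall k, k != 0 -> p ((sig k : T) ** U k) <= C * B * pw k (- t - m).
Proof.
move=> t0; have [N tN] := nat_above (t + (2 * n)%:R).
have [C C0 hC] := sig_coef N; exists (C * 3 ^+ n); first by rewrite mulr_ge0.
move=> p B sp pB k k0.
have h := @mul_U_bound p (sig k) k (C * pw k (- m)) B t N sp pB t0 tN _.
apply: (le_trans (h _)); first by move=> i; rewrite mulrAC; exact: hC.
by apply: le_of_eq; rewrite (pwD k (- t)); ring.
Qed.

Lemma star_U_sig_bound t : 0 <= t -> exists2 C : R, 0 <= C & forall (p : T ->
  R) B,
  seminorm p -> (forall j, p (star (U j)) <= B * pw j (- t)) ->
  forall k, k != 0 -> p (star (U k) ** (sig k : T)) <= C * B * pw k (- t - m).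
Proof.
move=> t0; have [N tN] := nat_above (t + (2 * n)%:R).
have [C C0 hC] := sig_coef N; exists (C * 3 ^+ n); first by rewrite mulr_ge0.
move=> p B sp pB k k0.
have h := @star_U_bound p (sig k) k (C * pw k (- m)) B t N sp pB t0 tN _.
apply: (le_trans (h _)); first by move=> i; rewrite mulrAC; exact: hC.
by apply: le_of_eq; rewrite (pwD k (- t)); ring.
Qed.

Definition col_test k : cinf T := to_cinf ((sig k : T) ** U k).
Definition row_test k : cinf T := to_cinf (star (U k) ** (sig k : T)).

Lemma col_testE k : (col_test k : T) = (sig k : T) ** U k.
Proof. by rewrite /col_test to_cinfK//; apply: smooth_Ur;
  exact: cinf_smooth. Qed.

Lemma row_testE k : (row_test k : T) = star (U k) ** (sig k : T).
Proof. by rewrite /row_test to_cinfK//; apply: smooth_star_Ul;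
  exact: cinf_smooth. Qed.

Lemma col_remainder t : 0 <= t -> exists2 C : R, 0 <= C & forall (p : T -> R) B,
  seminorm p -> (forall j, p (U j) <= B * pw j (- t)) ->
  forall k, k != 0 -> p (quantize rho (col_test k) - U k)
    <= C * B * pw k (- t - 1).
Proof.
move=> t0; have [N2 tN2] := nat_above (t + (2 * n)%:R).
pose L := 1 + `|m - 1|.
have [N LN] := nat_above (L + t + (2 * n)%:R).
have [C1 C10 hC1] := sig_coef N.
have [C2 C20 hC2] := symbol_principal_diff rhoC N2.
exists (C1 * (C2 * 3 ^+ n) * 3 ^+ n); first by rewrite !mulr_ge0.
move=> p B sp pB k k0.
have B0 : 0 <= B by have := pB 0; rewrite pw0l mulr1; apply: le_trans;
  exact: seminorm_ge0.
have := quantize_diff (col_test k) k;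
  rewrite {2}col_testE amulA (proj1 (sigP k0)) amul1l => hs.
have := @series_bound R n T p _ _ _ k (C1 * pw k (- m))
  (C2 * 3 ^+ n * B * (pw k (m - 1) * pw k (- t))) (L + t) N sp hs LN.
move=> h; apply: (le_trans (h _ _)).
- move=> j; rewrite col_testE nrm_coef_Ur mulrAC; exact: hC1.
- move=> j.
  have h1 := @mul_U_bound p (rho (zvec R j) - rq k) j
    (C2 * pw (j - k) L * pw k (m - 1)) B t N2 sp pB t0 tN2 _.
  apply: (le_trans (h1 _)).
    by move=> i; apply: (le_trans (hC2 j k i k0)); apply: le_of_eq; rewrite /L;
      ring.
  have h2 : pw j (- t) <= pw (j - k) t * pw k (- t).
    by have := pw_peetreB j k (- t); rewrite normrN ger0_norm.
  apply: (@le_trans _ _ (C2 * pw (j - k) L * pw k (m - 1) *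
    (B * (pw (j - k) t * pw k (- t))) * 3 ^+ n)).
    by rewrite ler_wpM2r ?exprn_ge0// ler_wpM2l ?mulr_ge0// ler_wpM2l.
  by apply: le_of_eq; rewrite (pwD _ L); ring.
apply: le_of_eq.
rewrite (_ : - t - 1 = - m + ((m - 1) + - t)); last by ring.
by rewrite !pwD; ring.
Qed.

(** By traciality this is, up to a phase, the coefficient at [l - j] of [sig l ** (rho j - rq l)].
    The product estimate in the weighted Wiener algebra gives the decay in [j - l], and the orders
    [- m] and [m - 1] add up to [- 1]. *)
Lemma row_kernel N : exists2 C : R, 0 <= C & forall j l, l != 0 ->
  nrm (trace ((((rho (zvec R j) - rq l : cinf T) : T) ** U j)
    ** (row_test l : T)))
    <= C * pw (j - l) (- N%:R) * pw l (- 1).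
Proof.
pose L := 1 + `|m - 1|; have [N' LN] := nat_above (L + N%:R).
have [C1 C10 hC1] := sig_coef (N' + 2 * n).
have [C2 C20 hC2] := symbol_principal_diff rhoC (N' + 2 * n).
exists (C1 * 3 ^+ n * (C2 * 3 ^+ n)); first by rewrite !mulr_ge0.
move=> j l l0; rewrite row_testE; set D := (_ - _ : cinf T).
have -> : nrm (trace (((D : T) ** U j) ** (star (U l) ** (sig l : T)))) =
    nrm (coef ((sig l : T) ** D) (l - j)).
  have [c c1 e] : phase_eq (U j ** star (U l)) (star (U (l - j))).
    by rewrite -[X in phase_eq X]starK starM starK; apply: phase_eq_star;
      exact: U_mul_star.
  rewrite amulA -[_ ** _ ** star _]amulA traceC amulA /coef e amulZr traceZ.
  by rewrite nrmM c1 mul1r.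
have nsig : wiener_le N' (sig l : T) (C1 * pw l (- m) * 3 ^+ n).
  by apply: coef_wiener_le; [rewrite mulr_ge0|move=> i; rewrite mulrAC;
    exact: hC1].
have nD : wiener_le N' (D : T) (C2 * pw (j - l) L * pw l (m - 1) * 3 ^+ n).
  apply: coef_wiener_le; first by rewrite !mulr_ge0.
  by move=> i; apply: (le_trans (hC2 j l i l0)); apply: le_of_eq; rewrite /L;
    ring.
apply: (le_trans (wiener_le_coef _ (wiener_le_mul nsig nD))).
rewrite -(opprB j l) pwN.
have h : pw (j - l) L * pw (j - l) (- N'%:R) <= pw (j - l) (- N%:R).
  by rewrite -pwD ler_pw//; lra.
have K0 : 0 <= C1 * 3 ^+ n * (C2 * 3 ^+ n) by rewrite !mulr_ge0.
have h2 : 0 <= pw l (- m) * pw l (m - 1) by rewrite mulr_ge0.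
apply: (@le_trans _ _ (C1 * 3 ^+ n * (C2 * 3 ^+ n) * (pw l (- m)
  * pw l (m - 1)) *
    (pw (j - l) L * pw (j - l) (- N'%:R)))); first by apply: le_of_eq; ring.
apply: (le_trans (ler_wpM2l _ h)); first by rewrite mulr_ge0.
rewrite -pwD (_ : - m + (m - 1) = - 1); last by ring.
by apply: le_of_eq; ring.
Qed.

(** The additive [e] is there for approximation: a smooth [u] close to a vector in [L2] inherits its
    coefficient bounds only up to an error uniform in [j]. It tends to 0 in [graph_row]. *)
Lemma trace_quantize_row t : 0 <= t -> exists2 C : R, 0 <= C &
  forall l (u : cinf T) (b e : R), l != 0 -> 0 <= b -> 0 <= e ->
  (forall j, nrm (coef u j) <= b * pw j (- t) + e) ->
  nrm (trace (quantize rho u ** (row_test l : T)) - coef u l)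
    <= C * (b * pw l (- t) + e) * pw l (- 1).
Proof.
move=> t0; have [N tN] := nat_above (t + (2 * n)%:R).
have [C C0 hC] := row_kernel N; exists (C * 3 ^+ n); first by rewrite mulr_ge0.
move=> l u b e l0 b0 e0 hu.
have [D D0 hD] := trace_bounded T.
pose s (y : T) := nrm (trace (y ** (row_test l : T))).
have -> : trace (quantize rho u ** (row_test l : T)) - coef u l =
    trace ((quantize rho u - (rq l : T) ** u) ** (row_test l : T)).
  rewrite amulBl traceB; congr (_ - _).
  (* Cyclicity of the trace places [sig l] to the left of the principal symbol, which it cancels. *)
  rewrite row_testE traceC -amulA [(sig l : T) ** _]amulA (proj2 (sigP l0))
    amul1l.
  by rewrite traceC.
rewrite -/(s _).
set K := C * (b * pw l (- t) + e) * pw l (- 1).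
have K0 : 0 <= K by rewrite /K !mulr_ge0 ?addr_ge0 ?mulr_ge0.
apply: (@le_trans _ _ (K * 3 ^+ n)); last by apply: le_of_eq; rewrite /K; ring.
apply: (hassum_seminorm (p := s) (D := D * nrm (row_test l : T))
  (g := fun j => K * pw (j - l) (- (2 * n)%:R)) _ _ _ _ (quantize_diff u l)).
- by move=> y z; rewrite /s amulDl traceD nrmD.
- move=> y; rewrite /s (le_trans (hD _))// -mulrA ler_wpM2l ?(ltW D0)//.
  by rewrite mulrC nrm_amul.
- move=> j; rewrite /s amulZl traceZ nrmM.
  apply: (le_trans (ler_pM _ _ (hu j) (hC j l l0))) => //.
  have h1 : pw j (- t) <= pw (j - l) t * pw l (- t).
    by have := pw_peetreB j l (- t); rewrite normrN ger0_norm.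
  have h2 : b * pw j (- t) + e <= (b * pw l (- t) + e) * pw (j - l) t.
    rewrite mulrDl lerD//; last by rewrite ler_peMr// pw_ge1.
    by rewrite -mulrA ler_wpM2l// mulrC.
  have h3 : pw (j - l) t * pw (j - l) (- N%:R) <= pw (j - l) (- (2 * n)%:R).
    by rewrite -pwD ler_pw//; lra.
  apply: (le_trans (ler_wpM2r _ h2)); first by rewrite !mulr_ge0.
  apply: (@le_trans _ _ (K * (pw (j - l) t * pw (j - l) (- N%:R)))).
    by apply: le_of_eq; rewrite /K; ring.
  by rewrite ler_wpM2l.
- move=> A; rewrite -mulr_sumr ler_wpM2l//.
  exact: (bsum_reindex (h := fun j => j - l) (addIr (- l)) (@bsum_pw R n) A).
Qed.

Variable P : (cinf T -> R[i]) -> (cinf T -> R[i]).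
Hypothesis rhoP : is_pdo rho P.
Variable H : L2completion T.
Local Notation E := (L2_in H).

Lemma graph_smooth u : L2_graph P m (E (u : T)) (E (quantize rho u)).
Proof.
split; first exact: sobolev_smooth.
by rewrite !L2_distE; have [_ ->] := rhoP.
Qed.

(** For [x] in the domain, [P] is known only by continuity on distributions. A smooth [u] close to
    [x] in [L2] is close to it uniformly on bounded sets of test functions, so [P u] and [z] nearly
    agree on the single function [row_test l]; the smooth case then passes to the limit. *)
Lemma graph_row t : 0 <= t -> exists2 C : R, 0 <= C &
  forall l (x z : H) b, l != 0 -> L2_graph P m x z -> 0 <= b ->
  (forall j, nrm (fcoef j x) <= b * pw j (- t)) ->
  nrm (L2_dist z (row_test l) - fcoef l x) <= C * b * pw l (- t - 1).
Proof.
move=> t0; have [C C0 hC] := trace_quantize_row t0; exists C => //.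
move=> l x z b l0 [[dx _] Pxz] b0 hx.
have [[_ _ Pc] PE] := rhoP.
have [D D0 hD] := L2_in_bounded H.
apply: le_epsilon => e' e'0.
(* Three errors are to be absorbed: [C * e] from the perturbed coefficient bound, [e] from the
   continuity of [P], and [e] from the [l]-th coefficient of [x]. *)
pose e := e' / (C + 2).
have C2 : 0 < C + 2 by rewrite ltr_wpDl.
have e0 : 0 < e by rewrite divr_gt0.
have eC : 0 < e%:C by rewrite ltcR.
have brow : bounded_cinf [set row_test l].
  by move=> a; exists (snorm a (row_test l)) => _ ->.
have [B' [d' [bB' /gt0_ReC[-> d0] hd]]] := Pc _ _ _ dx brow eC.
set d := complex.Re d' in d0 hd.
have [M' hM'] := bB' (fun=> 0%N); pose M := `|complex.Re M'| + 1.
have M0 : 0 < M by rewrite ltr_wpDl.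
have hM u : B' u -> nrm (u : T) < M.
  move=> /hM'; rewrite snormE mdelta0 => /le_ReC /= /le_lt_trans; apply.
  by rewrite (le_lt_trans (ler_norm _))// ltrDl.
(* The first bound keeps the coefficients of [u] within [e] of those of [x]. The second one keeps
   the two distributions within [d] on [B'], whose elements have norm below [M], hence [L2] norm at
   most [D * M]. *)
pose eta := Num.min e (d / (D * M)).
have eta0 : 0 < eta by rewrite lt_min e0 divr_gt0// mulr_gt0.
have [u hu] := L2_approx_cinf x eta0.
have etae : eta <= e by rewrite ge_min lexx.
have near_u : dist_near B' d%:C (L2_dist x) (alg_dist (u : T)).
  move=> v Bv; rewrite -(L2_distE H) -nrm_lt /L2_dist -ipBl.
  rewrite (le_lt_trans (cauchy_schwarz _ _))// nrmB.
  have h1 : nrm (E (star (v : T))) <= D * M.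
    rewrite (le_trans (hD _))// nrm_star ler_wpM2l ?(ltW D0)//.
    exact/ltW/hM.
  have h2 : nrm (x - E (u : T)) < d / (D * M).
    by rewrite (lt_le_trans hu)// ge_min lexx orbT.
  rewrite (le_lt_trans (ler_wpM2l (nrm_ge0 _) h1))//.
  by rewrite -ltr_pdivlMr// mulr_gt0.
have := hd _ (distribution_alg (u : T)) near_u (row_test l) erefl.
rewrite PE Pxz -nrm_lt /alg_dist => h1.
have h2 j : nrm (fcoef j x - coef u j) <= eta.
  by rewrite -(fcoef_in H) -fcoefB (le_trans (nrm_fcoef _ _))// ltW.
have h3 : nrm (trace (quantize rho u ** (row_test l : T)) - coef u l) <=
    C * (b * pw l (- t) + eta) * pw l (- 1).
  apply: hC => //; first exact: ltW.
  move=> j; rewrite -[coef u j](subKr (fcoef j x)) (le_trans (nrmD _ _))//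
    nrmN lerD//.
have -> : L2_dist z (row_test l) - fcoef l x =
    (trace (quantize rho u ** (row_test l : T)) - coef u l)
    - (trace (quantize rho u ** (row_test l : T)) - L2_dist z (row_test l))
    - (fcoef l x - coef u l) by ring.
rewrite (le_trans (nrmD _ _))// nrmN.
have h4 : nrm ((trace (quantize rho u ** (row_test l : T)) - coef u l)
    - (trace (quantize rho u ** (row_test l : T)) - L2_dist z (row_test l))) <=
    C * (b * pw l (- t) + eta) * pw l (- 1) + e.
  by rewrite (le_trans (nrmD _ _))// nrmN lerD// ltW.
have p1 : pw l (- 1) <= 1 :> R by rewrite pw_le1// oppr_le0.
have h5 : C * (b * pw l (- t) + eta) * pw l (- 1) <= C * b * pw l (- t - 1)
  + C * e.
  have h6 : eta * pw l (- 1) <= e.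
    by rewrite (le_trans _ etae)// ler_piMr// ltW.
  have -> : C * (b * pw l (- t) + eta) * pw l (- 1) =
      C * b * (pw l (- t) * pw l (- 1)) + C * (eta * pw l (- 1)) by ring.
  by rewrite -pwD lerD2l ler_wpM2l.
have ee : e' = C * e + e + e by rewrite /e; field; rewrite gt_eqF.
have h2l := h2 l; move: h4 h5 h2l etae ee.
move: (nrm (_ - _ - _)) (nrm (fcoef l x - coef u l)) => a1 a2; lra.
Qed.

(** * Decay of the powers of the resolvent *)

Variables (mu : R[i]) (R0 : H -> H).
Hypothesis R0P : is_resolvent P m mu R0.
Hypothesis m0 : 0 < m.
(** The gain per application of the resolvent: test vectors are smaller by [m] orders, remainders by
    one. *)
Let eps := Num.min 1 m.

Lemma eps_gt0 : 0 < eps.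
Proof. by rewrite lt_min ltr01. Qed.

Lemma eps_le1 : eps <= 1.
Proof. by rewrite ge_min lexx. Qed.

Lemma eps_lem : eps <= m.
Proof. by rewrite ge_min lexx orbT. Qed.

Lemma resolvent_bounded : exists2 C : R, 0 < C & forall x,
  nrm (R0 x) <= C * nrm x.
Proof. by have [Rl Rc _ _] := R0P; exact: lin_bounded. Qed.

Lemma iter_resolventP J a x y : iter J R0 (a *: x + y)
  = a *: iter J R0 x + iter J R0 y.
Proof. by have [Rl _ _ _] := R0P; elim: J => //= J ->; rewrite Rl. Qed.

Lemma iter_resolvent0 J : iter J R0 0 = 0.
Proof. by have := iter_resolventP J (-1) 0 0;
  rewrite scaler0 addr0 scaleN1r addNr. Qed.

Lemma iter_resolventZ J a x : iter J R0 (a *: x) = a *: iter J R0 x.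
Proof. by have := iter_resolventP J a x 0; rewrite iter_resolvent0 !addr0. Qed.

Lemma iter_resolventD J x y : iter J R0 (x + y) = iter J R0 x + iter J R0 y.
Proof. by have := iter_resolventP J 1 x y; rewrite !scale1r. Qed.

Lemma iter_resolventB J x y : iter J R0 (x - y) = iter J R0 x - iter J R0 y.
Proof. by rewrite iter_resolventD -scaleN1r iter_resolventZ scaleN1r. Qed.

Lemma iter_resolvent_bounded J :
  exists2 C : R, 0 < C & forall x, nrm (iter J R0 x) <= C * nrm x.
Proof.
have [C C0 hC] := resolvent_bounded.
elim: J => [|J [D D0 hD]]; first by exists 1 => // x; rewrite mul1r.
exists (C * D) => [|x]; first exact: mulr_gt0.
by rewrite /= (le_trans (hC _))// -mulrA ler_wpM2l// ltW.
Qed.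

Lemma seminorm_iter J : seminorm (fun u : T => nrm (iter J R0 (E u))).
Proof.
have [C C0 hC] := iter_resolvent_bounded J; have [D D0 hD] := L2_in_bounded H.
split=> [u v|a u|]; first by rewrite L2_inD iter_resolventD nrmD.
  by rewrite L2_inZ iter_resolventZ nrmZ.
exists (C * D) => u; rewrite (le_trans (hC _))// -mulrA ler_wpM2l// ltW//.
Qed.

(** With [c] the test column, [U^k = mu c - (P c - U^k) - (mu - P) c]. Applying [R0^(J+1)], the last
    term becomes [R0^J c] and gains [m] orders by induction. The other two keep all [J + 1] factors
    but gain [m] and 1 from [c] and from the remainder. *)
Lemma resolvent_col J : exists2 C : R, 0 <= C & forall k,
  nrm (iter J R0 (E (U k))) <= C * pw k (- (J%:R * eps)).
Proof.
elim: J => [|J [B B0 hB]].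
  by exists 1 => // k; rewrite /= nrm_L2_in_U mul0r oppr0 pw0 mulr1.
set t := J%:R * eps in hB.
have t0 : 0 <= t by rewrite /t mulr_ge0// ltW// eps_gt0.
have [CR CR0 hCR] := resolvent_bounded.
(* At this stage the additional factor is merely bounded: it keeps the rate [t] already known, and
   the gain comes from the test column. *)
have hB2 j : nrm (iter J.+1 R0 (E (U j))) <= CR * B * pw j (- t).
  by rewrite /= (le_trans (hCR _))// -mulrA ler_wpM2l// ltW.
have [C1 C10 hC1] := sig_U_bound t0.
have [C2 C20 hC2] := col_remainder t0.
have p1 := seminorm_iter J; have p2 := seminorm_iter J.+1.
exists (nrm mu * (C1 * (CR * B)) + C2 * (CR * B) + C1 * B + CR * B).
  by rewrite !addr_ge0 ?mulr_ge0// ltW.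
move=> k; set G := _ + CR * B.
have [->|k0] := eqVneq k 0.
  rewrite pw0l mulr1 (le_trans (hB2 0))// pw0l mulr1 /G lerDr.
  by rewrite !addr_ge0 ?mulr_ge0// ltW.
have -> : - (J.+1%:R * eps) = - t - eps by rewrite -natr1 mulrDl mul1r opprD.
have [_ _ _ /(_ _ _ (graph_smooth (col_test k))) hR] := R0P.
have key : iter J.+1 R0 (E (U k)) = mu *: iter J.+1 R0 (E (col_test k : T))
    - iter J.+1 R0 (E (quantize rho (col_test k) - U k))
      - iter J R0 (E (col_test k : T)).
  have -> : E (U k) = mu *: E (col_test k : T) - E (quantize rho (col_test k)
    - U k)
      - (mu *: E (col_test k : T) - E (quantize rho (col_test k))).
    by rewrite L2_inB !opprB [RHS]addrC addrA subrK [RHS]addrC subrK.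
  by rewrite iter_resolventB [X in X - _]iter_resolventB iter_resolventZ [X in
    _ - X = _]iterSr hR.
have e1 := eps_le1; have em := eps_lem.
have w1 : pw k (- t - m) <= pw k (- t - eps) by rewrite ler_pw// lerD2l lerN2.
have w2 : pw k (- t - 1) <= pw k (- t - eps) by rewrite ler_pw// lerD2l lerN2.
have b1 : nrm (iter J R0 (E (col_test k : T))) <= C1 * B * pw k (- t - eps).
  rewrite col_testE; apply: (le_trans (hC1 _ B p1 hB k k0)).
  by rewrite ler_wpM2l ?mulr_ge0.
have b2 : nrm (iter J.+1 R0 (E (col_test k : T))) <= C1 * (CR * B)
  * pw k (- t - eps).
  rewrite col_testE; apply: (le_trans (hC1 _ (CR * B) p2 hB2 k k0)).
  by rewrite ler_wpM2l ?mulr_ge0// ltW.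
have b3 : nrm (iter J.+1 R0 (E (quantize rho (col_test k) - U k))) <=
    C2 * (CR * B) * pw k (- t - eps).
  apply: (le_trans (hC2 _ (CR * B) p2 hB2 k k0)).
  by rewrite ler_wpM2l ?mulr_ge0// ltW.
rewrite key /G 3!mulrDl.
apply: (@le_trans _ _ (nrm mu * (C1 * (CR * B)) * pw k (- t - eps) +
    C2 * (CR * B) * pw k (- t - eps) + C1 * B * pw k (- t - eps))); last first.
  by rewrite lerDl mulr_ge0// mulr_ge0// ltW.
rewrite (le_trans (nrmD _ _))// nrmN lerD// (le_trans (nrmD _ _))// nrmN lerD//.
by rewrite nrmZ -mulrA ler_wpM2l.
Qed.

(** Pairing [mu x - z = y] with the test row isolates the [l]-th coefficient of [x]: the pairings of
    [x] and [y] are small by [m] orders, and the defect of [z] by one order through [graph_row]. The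
    rate [t] is required of both [x] and [y]. *)
Lemma graph_row_gain t : 0 <= t -> exists2 C : R, 0 <= C &
  forall l (x z y : H) b, L2_graph P m x z -> mu *: x - z = y -> 0 <= b ->
  (forall j, nrm (fcoef j x) <= b * pw j (- t)) ->
  (forall j, nrm (fcoef j y) <= b * pw j (- t)) ->
  nrm (fcoef l x) <= C * b * pw l (- t - eps).
Proof.
move=> t0; have [C1 C10 hC1] := graph_row t0.
have [C2 C20 hC2] := star_U_sig_bound t0.
exists (nrm mu * C2 + C2 + C1 + 1); first by rewrite !addr_ge0 ?mulr_ge0.
move=> l x z y b gxz zE b0 hx hy.
have [->|l0] := eqVneq l 0.
  rewrite pw0l mulr1 (le_trans (hx 0))// pw0l mulr1 mulrDl mul1r lerDr.
  by rewrite mulr_ge0 ?addr_ge0 ?mulr_ge0.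
have e1 := eps_le1; have em := eps_lem.
have w1 : pw l (- t - m) <= pw l (- t - eps) by rewrite ler_pw// lerD2l lerN2.
have w2 : pw l (- t - 1) <= pw l (- t - eps) by rewrite ler_pw// lerD2l lerN2.
have bd (x' : H) : (forall j, nrm (fcoef j x') <= b * pw j (- t)) ->
    nrm (L2_dist x' (row_test l)) <= C2 * b * pw l (- t - eps).
  move=> hx'; rewrite /L2_dist row_testE.
  apply: (le_trans (hC2 _ b (seminorm_dist x') _ l l0)).
    move=> j; rewrite starK; exact: hx'.
  by rewrite ler_wpM2l ?mulr_ge0.
have h1 := hC1 l x z b l0 gxz b0 hx.
have -> : fcoef l x = mu * L2_dist x (row_test l) - L2_dist y (row_test l) -
    (L2_dist z (row_test l) - fcoef l x).
  by rewrite -zE /L2_dist ipBl ipZl; ring.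
rewrite (le_trans (nrmD _ _))// nrmN.
apply: (@le_trans _ _ (nrm mu * (C2 * b * pw l (- t - eps))
  + C2 * b * pw l (- t - eps) +
    C1 * b * pw l (- t - eps))); last first.
  rewrite -subr_ge0 (_ : _ - _ = b * pw l (- t - eps)); last by ring.
  by rewrite mulr_ge0.
rewrite lerD//; last by apply: (le_trans h1); rewrite ler_wpM2l ?mulr_ge0.
rewrite (le_trans (nrmD _ _))// nrmN lerD ?bd// nrmM ler_wpM2l ?bd//.
Qed.

Lemma resolvent_row J : exists2 C : R, 0 <= C & forall l (y : H),
  nrm (fcoef l (iter J R0 y)) <= C * nrm y * pw l (- (J%:R * eps)).
Proof.
elim: J => [|J [B B0 hB]].
  by exists 1 => // l y; rewrite mul0r oppr0 pw0 mulr1 mul1r nrm_fcoef.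
set t := J%:R * eps in hB.
have t0 : 0 <= t by rewrite /t mulr_ge0// ltW// eps_gt0.
have [CR CR0 hCR] := resolvent_bounded.
have [C C0 hC] := graph_row_gain t0.
exists (C * (B * (CR + 1))); first by rewrite !mulr_ge0 ?addr_ge0// ltW.
move=> l y; have -> : - (J.+1%:R * eps)
  = - t - eps by rewrite -natr1 mulrDl mul1r opprD.
have [_ _ /(_ (iter J R0 y))[z gz zE] _] := R0P.
have := hC l _ z _ (B * (CR + 1) * nrm y) gz zE; rewrite -!mulrA => h.
rewrite iterS; apply: h; first by rewrite !mulr_ge0 ?addr_ge0// ltW.
  (* Read as [R0^J (R0 y)], the vector [R0^(J+1) y] already has the rate [t], which is the a priori
     decay that [graph_row_gain] asks of [x]. *)
  move=> j; rewrite -iterS iterSr (le_trans (hB _ _))//.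
  rewrite -!mulrA ler_wpM2l// mulrA ler_wpM2r//.
  by rewrite (le_trans (hCR _))// ler_wpM2r// lerDl.
move=> j; rewrite (le_trans (hB _ _))// -!mulrA ler_wpM2l// mulrA ler_wpM2r//.
by rewrite ler_peMl// lerDr ltW.
Qed.

End Parametrix.

(** * The contour integral *)

Section RootsOfUnity.
Variable R : realType.

Lemma expiD (x y : R) : expi (x + y) = expi x * expi y.
Proof.
rewrite /expi cosD sinD; apply/eqP; rewrite eq_complex /= eqxx /=.
by rewrite addrC eqxx.
Qed.

Lemma expi0 : expi (0 : R) = 1.
Proof. by rewrite /expi cos0 sin0. Qed.

Lemma expi_nat (x : R) p : expi (p%:R * x) = expi x ^+ p.
Proof.
elim: p => [|p IH]; first by rewrite mul0r expi0 expr0.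
by rewrite -natr1 mulrDl mul1r expiD IH exprSr.
Qed.

Lemma expi_neq1 (x : R) : 0 < x < 2 * pi -> expi x != 1.
Proof.
move=> /andP[x0 x2]; apply/eqP => /(congr1 (@complex.Re R)) /=.
have xE : x = x / 2 *+ 2 by rewrite -mulr_natr divfK.
rewrite xE cos_mulr2n => h.
have s0 : 0 < sin (x / 2) by rewrite sin_gt0_pi// divr_gt0//= ltr_pdivrMr//
  mulrC.
have := cos2Dsin2 (x / 2); rewrite -mulr_natr in h.
have : 0 < sin (x / 2) ^+ 2 by rewrite exprn_gt0.
move: (cos _ ^+ 2) (sin _ ^+ 2) h => a b h; lra.
Qed.

Definition node (M p : nat) : R := 2 * pi * p%:R / M%:R.

Lemma sum_roots M j : (0 < j < M)%N -> \sum_(p < M) expi (node M p) ^+ j = 0.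
Proof.
move=> /andP[j0 jM]; have M0 : 0 < M%:R :> R by rewrite ltr0n (leq_ltn_trans _
  jM).
pose w := expi (node M j).
have wp p : expi (node M p) ^+ j = w ^+ p.
  by rewrite /w -!expi_nat /node; congr expi; ring.
under eq_bigr => p _ do rewrite wp.
have w1 : w - 1 != 0.
  rewrite subr_eq0; apply: expi_neq1; rewrite /node; apply/andP; split.
    by rewrite divr_gt0// mulr_gt0 ?ltr0n// mulr_gt0// pi_gt0.
  by rewrite ltr_pdivrMr// ltr_pM2l ?ltr_nat// mulr_gt0// pi_gt0.
have wM : w ^+ M = 1.
  rewrite /w -expi_nat /node mulrC divfK ?gt_eqF// mulrC expi_nat.
  rewrite (_ : expi (2 * pi) = 1) ?expr1n//.
  by rewrite /expi mulrC mulr_natr cos2pi sin2pi.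
apply: (mulfI w1); rewrite mulr0 -subrX1 wM subrr//.
Qed.

(** Writing [z^(j+1) (1 - z)^(i+1)] as [z^(j+1) (1 - z)^i - z^(j+2) (1 - z)^i] lowers [i]; the
    condition keeps every power of [z] between 1 and [M - 1], where [sum_roots] applies. The factor
    [z^(j+1)] with [j = 0] is the one from the derivative of the parametrization. *)
Lemma sum_roots_poly M i j : (i + j.+1 < M)%N ->
  \sum_(p < M) expi (node M p) ^+ j.+1 * (1 - expi (node M p)) ^+ i = 0.
Proof.
elim: i j => [|i IH] j ijM.
  under eq_bigr => p _ do rewrite expr0 mulr1.
  by apply: sum_roots; rewrite /= (leq_ltn_trans _ ijM)// leq_addl.
have := IH j; rewrite (leq_ltn_trans _ ijM) ?addSn// => /(_ isT) h1.
have := IH j.+1; rewrite addnS -addSn ijM => /(_ isT) h2.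
transitivity (\sum_(p < M) expi (node M p) ^+ j.+1 * (1 - expi (node M p)) ^+ i
    - \sum_(p < M) expi (node M p) ^+ j.+2 * (1 - expi (node M p)) ^+ i).
  by rewrite -sumrB; apply: eq_bigr => p _; rewrite !exprS; ring.
by rewrite h1 h2 subrr.
Qed.

End RootsOfUnity.

(** * The resolvent on the circle and its Riemann sums *)

Section Circle.
Variables (R : realType) (n : nat) (theta : 'M[R]_n) (T : ncTorus theta).
Variable H : L2completion T.
Variables (P : (cinf T -> R[i]) -> (cinf T -> R[i])) (m : R).

Lemma resolvent_identity (z mu : R[i]) (S S' : H -> H) y :
  is_resolvent P m z S -> is_resolvent P m mu S' ->
  S y = S' y + (mu - z) *: S (S' y).
Proof.
move=> [Sl _ _ Sr] [_ _ /(_ y)[w gw wE] _].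
have := Sr _ _ gw.
have -> : z *: S' y - w = (z - mu)
  *: S' y + y by rewrite -[X in _ = _ + X]wE scalerBl addrA subrK.
by rewrite Sl -opprB scaleNr => /esym {1}->; rewrite addrAC addNr add0r.
Qed.

Lemma resolvent_comm (z mu : R[i]) (S S' : H -> H) y :
  is_resolvent P m z S -> is_resolvent P m mu S' -> S (S' y) = S' (S y).
Proof.
move=> zS mS; have h1 := resolvent_identity y zS mS.
have h2 := resolvent_identity y mS zS.
have [zm|zm] := eqVneq z mu.
  have SS' x : S x = S' x by rewrite (resolvent_identity x zS mS)
    zm subrr scale0r addr0.
  by rewrite !SS'.
have d0 : mu - z != 0 by rewrite subr_eq0 eq_sym.
apply: (scalerI d0); move: h1; rewrite h2 -addrA => /esym/eqP.
rewrite -subr_eq0 addrAC subrr add0r -opprB scaleNr addrC subr_eq0 => /eqP ->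
  //.
Qed.

Lemma resolvent_comm_iter (z mu : R[i]) (S S' : H -> H) J y :
  is_resolvent P m z S -> is_resolvent P m mu S' ->
  S (iter J S' y) = iter J S' (S y).
Proof. by move=> zS mS; elim: J => //= J <-;
  exact: (resolvent_comm _ zS mS). Qed.

Lemma resolvent_expansion (z mu : R[i]) (S S' : H -> H) J y :
  is_resolvent P m z S -> is_resolvent P m mu S' ->
  S y = \sum_(i < J) (mu - z) ^+ i *: iter i.+1 S' y
        + (mu - z) ^+ J *: S (iter J S' y).
Proof.
move=> zS mS; elim: J => [|J IH]; first by rewrite big_ord0 add0r expr0 scale1r.
rewrite big_ord_recr /= {1}IH -addrA; congr (_ + _).
by rewrite (resolvent_identity (iter J S' y) zS mS) scalerDr scalerA exprSr.
Qed.

Variables (lam : R[i]) (r : R).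
Hypothesis iso : isolating_radius H P m lam r.
Local Notation Rz := (resolvent P m).
Local Notation zeta s := (lam + r%:C * expi s).

(** A spectral point on the circle would have to equal [lam], while its distance to [lam] is
    [r > 0]. So a resolvent exists there and [xget] selects one. *)
Lemma circle_resolvent s : is_resolvent P m (zeta s) (Rz (zeta s) : H -> H).
Proof.
have [r0 isol] := iso; apply: (@xgetPex _ (fun=> 0)
  [set S | is_resolvent P m (zeta s) S]).
apply: contrapT => nex; have := isol (zeta s) nex.
rewrite [lam + _]addrC addrK -nrm_le nrmM nrm_expi mulr1 nrm_real gtr0_norm//
  lexx.
move=> /(_ isT) h.
have h0 : r%:C * expi s = 0 by apply: (addrI lam); rewrite addr0 addrC h.
have := nrm_expi s; have : nrm (r%:C * expi s) = 0 by rewrite h0 nrm0.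
by rewrite nrmM nrm_real gtr0_norm// => + e; rewrite e mulr1 => r00;
  rewrite r00 ltxx in r0.
Qed.

Lemma resolvent_linear s : linear (Rz (zeta s) : H -> H).
Proof. by have [] := circle_resolvent s. Qed.

Lemma expi_continuous (s e : R) : 0 < e ->
  \forall s' \near s, nrm (expi s' - expi s) < e.
Proof.
move=> e0; have e2 : 0 < e / 2 by rewrite divr_gt0.
have := @continuous_cos R s; move=> /cvgrPdist_lt /(_ _ e2) hc.
have := @continuous_sin R s; move=> /cvgrPdist_lt /(_ _ e2) hs.
near=> s'.
have h (a b : R) : nrm (a +i* b) <= `|a| + `|b|.
  rewrite (complexE (a +i* b)) (le_trans (nrmD _ _))// nrmM !nrm_real /=.
  by rewrite nrm_i mul1r.
rewrite (le_lt_trans (h _ _))// [e]splitr ltrD//.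
  by rewrite distrC; near: s'.
by rewrite distrC; near: s'.
Unshelve. all: by end_near.
Qed.

(** If [C] bounds the resolvent at [zeta s], the resolvent identity at a point closer than
    [1 / (2 C)] bounds [v] by [w] plus half of [v], so [2 C] is a local bound; compactness of the
    interval makes it uniform. *)
Lemma circle_bound : exists2 C : R, 0 < C & forall s, 0 <= s <= 2 * pi ->
  forall y : H, nrm (Rz (zeta s) y) <= C * nrm y.
Proof.
have [r0 _] := iso.
have [C hC] : exists C : R, forall s, `[0, 2 * pi]%classic s ->
    forall y : H, nrm (Rz (zeta s) y) <= C * nrm y.
  apply: compact_bound; last 2 first.
  - exact: segment_compact.
  - move=> s _; have zS := circle_resolvent s.
    have [Sl Sc _ _] := zS; have [C C0 hC] := lin_bounded Sl Sc.
    exists (2 * C).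
    have e0 : 0 < (2 * C * r)^-1 by rewrite invr_gt0 !mulr_gt0.
    have := expi_continuous s e0; apply: filterS => s' hs' _ y.
    have := resolvent_identity y zS (circle_resolvent s').
    set w := Rz _ y; set v := Rz _ y => h.
    have : nrm v <= nrm w + nrm v / 2.
      rewrite -[X in nrm X <= _](addrK ((zeta s' - zeta s) *: Rz (zeta s) v) v)
        -h.
      rewrite (le_trans (nrmD _ _))// nrmN lerD// nrmZ.
      apply: (le_trans (ler_wpM2l (nrm_ge0 _) (hC v))).
      rewrite mulrA mulrC ler_wpM2l//.
      rewrite opprD addrACA subrr add0r -mulrBr nrmM nrm_real gtr0_norm//.
      rewrite -ler_pdivlMr// mulrC -ler_pdivlMr// (le_trans (ltW hs'))//.
      by rewrite !invfM.
    have := hC y; rewrite -/w; lra.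
  - by move=> M M' s MM' h y; rewrite (le_trans (h y))// ler_wpM2r.
exists (`|C| + 1) => [|s s01 y]; first by rewrite ltr_wpDl.
rewrite (le_trans (hC s _ y)) ?ler_wpM2r// ?in_itv//.
by rewrite (le_trans (ler_norm _))// lerDl.
Qed.

Definition integrand (s : R) (v : H) : H :=
  ('i * r%:C * expi s) *: Rz (zeta s) v.

(** Equispaced nodes tagged at their left ends: among all Riemann sums, these integrate polynomials
    of low degree over the circle without error. *)
Definition riemann (M : nat) (v : H) : H :=
  \sum_(p < M) (2 * pi / M%:R)%:C *: integrand (node R M p) v.

Lemma riemann_linear M : linear (riemann M).
Proof.
move=> a x y; rewrite /riemann scaler_sumr -big_split /=; apply: eq_bigr => p _.
rewrite /integrand resolvent_linear !scalerDr !scalerA; congr (_ *: _ + _);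
  ring.
Qed.

Lemma node_itv M p : (p < M)%N -> 0 <= node R M p <= 2 * pi.
Proof.
move=> pM; have M0 : 0 < M%:R :> R by rewrite ltr0n (leq_ltn_trans _ pM).
have pi0 : 0 < 2 * pi :> R by rewrite mulr_gt0// pi_gt0.
rewrite /node; apply/andP; split; first by rewrite divr_ge0// mulr_ge0// ltW.
by rewrite ler_pdivrMr// ler_pM2l// ler_nat ltnW.
Qed.

(* The nodes are the [M]-th roots of unity, whose power sums vanish: the
   polynomial part of the expansion of the resolvent does not contribute to the
   Riemann sum. *)
Lemma riemann_expansion M J v : (J < M)%N ->
  riemann M v = \sum_(p < M) ((2 * pi / M%:R)%:C * ('i * r%:C * expi (node R M
    p)) *
     (zeta 0 - zeta (node R M p)) ^+ J) *: Rz (zeta (node R M p))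
       (iter J (Rz (zeta 0)) v).
Proof.
move=> JM; rewrite /riemann.
have zE s : zeta 0 - zeta s = r%:C * (1 - expi s).
  by rewrite expi0 opprD addrACA subrr add0r mulrBr.
under eq_bigr => p _ do rewrite /integrand
  (resolvent_expansion J v (circle_resolvent (node R M p)) (circle_resolvent 0))
  scalerA scalerDr scaler_sumr scalerA.
rewrite big_split /= exchange_big /= big1 ?add0r// => i _.
under eq_bigr => p _ do rewrite scalerA zE.
rewrite -scaler_suml.
have iM : (i + 0.+1 < M)%N by rewrite addn1 (leq_ltn_trans (ltn_ord i)).
have := @sum_roots_poly R M i 0 iM => h.
rewrite (_ : \sum_(p < M) _ = (2 * pi / M%:R)%:C * ('i * r%:C) * r%:C ^+ i *
   \sum_(p < M) expi (node R M p) ^+ 1 * (1 - expi (node R M p)) ^+ i);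
     last first.
  rewrite mulr_sumr; apply: eq_bigr => p _; rewrite expr1 exprMn; ring.
by rewrite h mulr0 scale0r.
Qed.

(** The expansion is taken to order [J + J]. Half of the resolvents at [zeta 0] are commuted to the
    left, where the hypothesis on [fcoef l] sees them, and the other half stay on [v]. The constant
    does not depend on [M], so it survives the limit. *)
Lemma riemann_fcoef J : exists2 C : R, 0 <= C & forall M l (v : H) (B : R),
  (J + J < M)%N ->
  (forall y : H, nrm (fcoef l (iter J (Rz (zeta 0)) y)) <= B * nrm y) ->
    0 <= B ->
  nrm (fcoef l (riemann M v)) <= C * B * nrm (iter J (Rz (zeta 0)) v).
Proof.
have [r0 _] := iso; have [C C0 hC] := circle_bound.
have pi0 : 0 < 2 * pi :> R by rewrite mulr_gt0// pi_gt0.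
(* Here [2 * pi * r] is the length of the circle, [2 * r] bounds the distance between two of its
   points, and [C] bounds the resolvent on it. *)
exists (2 * pi * r * (2 * r) ^+ (J + J) * C).
  by rewrite !mulr_ge0 ?exprn_ge0 ?mulr_ge0 ?pi_ge0 ?(ltW r0) ?(ltW C0).
move=> M l v B JM hB B0.
have M0 : 0 < M%:R :> R by rewrite ltr0n (leq_ltn_trans _ JM).
rewrite (riemann_expansion _ JM) (morphB_sum (A := @fcoef _ _ _ _ H l));
  last exact: fcoefB.
rewrite (le_trans (nrm_sum _ _ _))//.
set X := nrm (iter J _ v).
apply: (@le_trans _ _ (\sum_(p < M) (2 * pi / M%:R) * (r * (2 * r) ^+ (J + J)
  * (B * (C * X))))); last first.
  rewrite sumr_const card_ord -[_ *+ M]mulr_natr; apply: le_of_eq.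
  by field; rewrite gt_eqF.
apply: ler_sum => p _.
have a0 : 0 < 2 * pi / M%:R :> R by rewrite divr_gt0.
move: a0; generalize (2 * pi / M%:R : R) => a a0.
rewrite fcoefZ 3!nrmM nrm_real gtr0_norm// -!mulrA ler_wpM2l ?(ltW a0)//.
have -> : nrm ('i * (r%:C * expi (node R M p))) = r.
  rewrite !nrmM nrm_expi nrm_real gtr0_norm// mulr1.
  by rewrite nrm_i mul1r.
rewrite ler_wpM2l ?(ltW r0)//; apply: ler_pM => //.
  rewrite nrmX lerXn2r ?nnegrE ?mulr_ge0 ?(ltW r0)//.
  rewrite opprD addrACA subrr add0r -mulrBr nrmM nrm_real gtr0_norm//
    mulrC ler_wpM2r ?(ltW r0)//.
  by rewrite (le_trans (nrmD _ _))// nrmN !nrm_expi.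
rewrite iterD (resolvent_comm_iter _ _ (circle_resolvent _)
  (circle_resolvent 0)).
by rewrite (le_trans (hB _))// ler_wpM2l// hC// node_itv.
Qed.

Lemma riemann_bounded : exists2 C : R, 0 <= C & forall M v,
  nrm (riemann M v) <= C * nrm v.
Proof.
have [r0 _] := iso; have [C C0 hC] := circle_bound.
have pi0 : 0 < 2 * pi :> R by rewrite mulr_gt0// pi_gt0.
exists (2 * pi * r * C); first by rewrite !mulr_ge0 ?pi_ge0 ?(ltW r0) ?(ltW C0).
move=> [|M] v.
  by rewrite /riemann big_ord0 nrm0 !mulr_ge0 ?pi_ge0 ?(ltW r0) ?(ltW C0).
rewrite /riemann (le_trans (nrm_sum _ _ _))//.
apply: (@le_trans _ _ (\sum_(p < M.+1) (2 * pi / M.+1%:R)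
  * (r * (C * nrm v)))); last first.
  rewrite sumr_const card_ord -[_ *+ M.+1]mulr_natr; apply: le_of_eq.
  by rewrite mulrAC divfK ?pnatr_eq0// !mulrA.
apply: ler_sum => p _.
have a0 : 0 < 2 * pi / M.+1%:R :> R by rewrite divr_gt0.
move: a0; generalize (2 * pi / M.+1%:R : R) => a a0.
rewrite /integrand !nrmZ nrm_real gtr0_norm// ler_wpM2l ?(ltW a0)//.
rewrite !nrmM nrm_expi nrm_real gtr0_norm// mulr1.
rewrite nrm_i mul1r.
by rewrite ler_wpM2l ?(ltW r0)// hC// node_itv.
Qed.

Variable I : H -> H.
Hypothesis intI : is_op_integral integrand 0 (2 * pi) I.

(** A large number of nodes is requested along with the accuracy, since the polynomial part vanishes
    only when there are more nodes than terms in the expansion. *)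
Lemma riemann_cvg (J : nat) (e : R) : 0 < e -> exists2 M, (J < M)%N &
  forall v, nrm (riemann M v - I v) <= e * nrm v.
Proof.
move=> e0; have eC : 0 < e%:C by rewrite ltcR.
have [d [d0 hd]] := intI eC.
have pi0 : 0 < 2 * pi :> R by rewrite mulr_gt0// pi_gt0.
have [N hN] := nat_above (2 * pi / d + 1).
have NN : N%:R <= (J + N).+1%:R :> R by rewrite ler_nat leqW// leq_addl.
exists (J + N).+1; first by rewrite ltnS leq_addr.
set M := (J + N).+1 in NN *; have M0 : 0 < M%:R :> R by rewrite ltr0n.
have hM : 2 * pi / M%:R < d.
  by rewrite ltr_pdivrMr// [ltRHS]mulrC -ltr_pdivrMr// (lt_le_trans _ NN)//
    (lt_le_trans _ hN)// ltrDl.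
have st (i : nat) : node R M i.+1 - node R M i = 2 * pi / M%:R.
  by rewrite /node -natr1; ring.
move=> v; rewrite nrm_le rmorphM /= -!nrmE.
have part : tagged_partition 0 (2 * pi) M (node R M) (node R M).
  split; first by rewrite /node mulr0 mul0r.
    by rewrite /node mulfK// gt_eqF.
  by move=> i _; rewrite lexx /= -subr_ge0 st divr_ge0// ltW.
have mesh i : (i < M)%N -> node R M i.+1 - node R M i < d by rewrite st.
have := hd M _ _ part mesh v.
rewrite /riemann (_ : \sum_(i < M) (node R M i.+1 - _)%:C *: _ =
  \sum_(p < M) (2 * pi / M%:R)%:C *: integrand (node R M p) v)//.
by apply: eq_bigr => i _; rewrite st.
Qed.

Lemma integral_bounded : exists2 C : R, 0 <= C & forall v,
  nrm (I v) <= C * nrm v.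
Proof.
have [C C0 hC] := riemann_bounded; exists (C + 1); first by rewrite addr_ge0.
move=> v; have [M _ hM] := riemann_cvg 0 ltr01.
rewrite -[I v](subKr (riemann M v)) (le_trans (nrmD _ _))// nrmN mulrDl lerD//.
Qed.

(** [I] is any function with the limit property, so linearity has to be inherited from the Riemann
    sums. *)
Lemma integral_linear : linear I.
Proof.
move=> a x y; apply/eqP; rewrite -subr_eq0; apply/eqP; apply: nrm_eq0.
apply/eqP; rewrite eq_le nrm_ge0 andbT; apply: le_epsilon => e e0;
  rewrite add0r.
pose K := nrm (a *: x + y) + nrm a * nrm x + nrm y + 1.
have K0 : 0 < K by rewrite ltr_wpDl// !addr_ge0// mulr_ge0.
have [M _ hM] := riemann_cvg 0 (divr_gt0 e0 K0).
have -> : I (a *: x + y) - (a *: I x + I y) =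
    - (riemann M (a *: x + y) - I (a *: x + y)) + a *: (riemann M x - I x)
    + (riemann M y - I y).
  by rewrite riemann_linear scalerBr opprB -[RHS]addrA [X in _ = _ + X]addrACA
    -opprD subrKA.
have eK : e = e / K * K by rewrite divfK// gt_eqF.
have h1 := hM (a *: x + y); have h2 := hM x; have h3 := hM y.
have ek0 : 0 <= e / K by rewrite divr_ge0// ltW.
rewrite (le_trans (nrmD _ _))// eK /K.
apply: (@le_trans _ _ (e / K * (nrm (a *: x + y) + nrm a * nrm x + nrm y)));
  last first.
  by rewrite ler_wpM2l// lerDl.
rewrite 2!mulrDr lerD// (le_trans (nrmD _ _))// nrmN lerD//.
by rewrite nrmZ mulrCA ler_wpM2l.
Qed.

End Circle.

(** * Operators with rapidly decaying kernels *)

Section Kernel.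
Variables (R : realType) (n : nat) (theta : 'M[R]_n) (T : ncTorus theta).
Variable H : L2completion T.
Implicit Types (k l j : 'rV[int]_n) (u v : cinf T) (x y : H).
Local Notation U := (Uk T).
Local Notation E := (L2_in H).
Local Notation dist := (@Defs.distribution R n theta T).

Lemma dist_scale (v : cinf T -> R[i]) (a : R[i]) (u : cinf T) : scalar v ->
  v (a *: u) = a * v u.
Proof.
move=> vl; have v0 : v 0 = 0.
  by have := vl (-1) 0 0; rewrite scaler0 addr0 mulN1r addNr.
by have := vl a u 0; rewrite v0 !addr0.
Qed.

(** A distribution has finite order: continuity at 0 involves finitely many derivatives, and
    rescaling [u] into that neighborhood gives the bound. The additional [2 * n] orders pay for
    summing the Fourier series of the derivatives. *)
Lemma dist_bound (v : cinf T -> R[i]) : dist v ->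
  exists N : nat, exists2 K : R, 0 <= K &
  forall u c, 0 < c -> (forall k, nrm (coef u k) <= c * pw k (- N%:R)) ->
    nrm (v u) <= K * c.
Proof.
move=> [vl /(_ 0 1 ltr01)[N [d' [/gt0_ReC[-> d0] hd]]]].
set d := complex.Re d' in d0 hd; exists (N + 2 * n)%N.
have v0 : v 0 = 0 by rewrite -(scale0r 0) dist_scale// mul0r.
have D0 : 0 < 2 * 3 ^+ n / d by rewrite divr_gt0// mulr_gt0// exprn_gt0.
exists (2 * 3 ^+ n / d); first exact: ltW.
move=> u c c0 hc; pose s := (2 * 3 ^+ n / d * c)^-1.
have s0 : 0 < s by rewrite invr_gt0 mulr_gt0.
have : nrm (v (s%:C *: u)) < 1.
  rewrite -[v _]subr0 -v0 nrm_lt; apply: hd => a aN.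
  rewrite subr0 snormE ltcR.
  apply: (@le_lt_trans _ _ (s * c * 3 ^+ n)).
    apply: nrm_mdelta_le; first by rewrite mulr_ge0// ltW.
    move=> k; rewrite coefZ nrmM nrm_real gtr0_norm//
      -mulrA ler_wpM2l ?(ltW s0)//.
    rewrite (le_trans (hc k))// ler_wpM2l ?(ltW c0)//.
    by rewrite ler_pw// lerN2 ler_nat leq_add2r.
  have -> : s * c * 3 ^+ n = d / 2.
    rewrite /s; field; rewrite ?gt_eqF ?exprn_gt0//.
  by rewrite ltr_pdivrMr// ltr_pMr// ltr1n.
rewrite dist_scale// nrmM nrm_real gtr0_norm// mulrC -ltr_pdivlMr//
  => /ltW/le_trans; apply.
by rewrite /s invrK mul1r.
Qed.

Variable Q : H -> H.
Hypothesis Ql : linear Q.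
Hypothesis Qb : exists2 C : R, 0 <= C & forall x, nrm (Q x) <= C * nrm x.
Hypothesis Qk : forall N : nat, exists2 C : R, 0 <= C & forall k l,
  nrm (fcoef l (Q (E (U k)))) <= C * pw l (- N%:R) * pw k (- N%:R).

Lemma morphB_Q x y : Q (x - y) = Q x - Q y.
Proof. by rewrite addrC -scaleN1r Ql scaleN1r addrC. Qed.

Lemma kernel_bound N N' : exists2 C : R, 0 <= C & forall k l,
  nrm (fcoef l (Q (E (U k)))) <= C * pw l (- N%:R) * pw k (- N'%:R).
Proof.
have [C C0 hC] := Qk (N + N'); exists C => // k l; apply: (le_trans (hC k l)).
apply: ler_pM; rewrite ?mulr_ge0//;
  last by rewrite ler_pw// lerN2 ler_nat leq_addl.
by rewrite ler_wpM2l// ler_pw// lerN2 ler_nat leq_addr.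
Qed.

(** [psi l] is the [l]-th row of the matrix of [Q] made into a test function, the sum over [k] of
    the entry [(l, k)] times [star (U k)]. Rewriting [star (U k)] as a phase times [U (- k)]
    explains the opposite index in [c]. The identity holds on monomials and extends by density, both
    sides being bounded in [x]. *)
Lemma row_functions : exists psi : 'rV[int]_n -> cinf T,
  (forall x l, L2_dist x (psi l) = fcoef l (Q x)) /\
  (forall N N', exists2 C : R, 0 <= C & forall l k,
     nrm (coef (psi l) k) <= C * pw l (- N%:R) * pw k (- N'%:R)).
Proof.
have /choice[ph phE] k : exists c : R[i],
  nrm c = 1 /\ star (U k) = c *: U (- k).
  by have [c c1 e] := star_U T k; exists c.
pose c l k := fcoef l (Q (E (U (- k)))) * ph (- k).
have nc l k : nrm (c l k) = nrm (fcoef l (Q (E (U (- k))))).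
  by rewrite nrmM (proj1 (phE _)) mulr1.
have cb N N' : exists2 C : R, 0 <= C & forall l k,
     nrm (c l k) <= C * pw l (- N%:R) * pw k (- N'%:R).
  have [C C0 hC] := kernel_bound N N'; exists C => // l k.
  by rewrite nc -(pwN k); exact: hC.
have cd l : rapid_decay (c l).
  move=> N; have [C C0 hC] := cb 0%N N; exists (C * pw l (- 0%:R)) => k;
    exact: hC.
have /choice[psi psiE] l : exists u : cinf T, coef u = c l.
  have [u su uc] := rapid_decay_smooth T (cd l).
  by exists (to_cinf u); rewrite to_cinfK.
exists psi; split; last first.
  by move=> N N'; have [C C0 hC] := cb N N'; exists C => // l k; rewrite psiE.
move=> x l.
have onU j : L2_dist (E (U j)) (psi l) = fcoef l (Q (E (U j))).
  rewrite L2_distE /alg_dist.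
  have [C C0 hC] := trace_bounded T.
  have h1 : hassum (fun k => trace (U j ** (coef (psi l) k *: U k)))
    (trace (U j ** (psi l : T))).
    have h := hassum_mull (U j) (cinf_hassum (psi l)).
    apply: (hassum_map (A := @trace _ _ _ T) (C := C)) h => [y z|y];
      last exact: hC.
    exact: traceB.
  apply: hassum_uniq h1 _.
  apply: eq_hassum (hassum1 (- j) (fcoef l (Q (E (U j))))) => k.
  rewrite amulZr traceZ psiE /c -mulrA -traceZ -amulZr.
  have -> : ph (- k) *: U k = star (U (- k)) by rewrite (proj2 (phE _)) opprK.
  rewrite -/(coef _ _) coef_U.
  have -> : (j == - k) = (k == - j) by rewrite -eqr_oppLR eq_sym.
  by case: eqVneq => [->|]; rewrite ?opprK ?mulr1 ?mulr0.
have Q0 : Q 0 = 0 by have := morphB_Q 0 0; rewrite subrr subrr.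
have onP p : tpoly p -> L2_dist (E p) (psi l) = fcoef l (Q (E p)).
  elim=> [|a k r _ IH].
    by rewrite raddf0 Q0 /L2_dist /fcoef !ip0l.
  rewrite L2_inD L2_inZ Ql fcoefD fcoefZ -IH -onU /L2_dist ipDl ipZl//.
have [C C0 hC] := Qb.
have [D D0 hD] := L2_in_bounded H.
apply/eqP; rewrite -subr_eq0; apply/eqP; apply: nrm_lt_eq0 => e e0.
pose K := D * nrm (star (psi l : T)) + C + 1.
have K0 : 0 < K by rewrite ltr_wpDl// addr_ge0// mulr_ge0// ltW.
have [p tp hp] := L2_approx x (divr_gt0 e0 K0).
have -> : L2_dist x (psi l) - fcoef l (Q x) =
    L2_dist (x - E p) (psi l) - fcoef l (Q (x - E p)).
  have -> : L2_dist (x - E p) (psi l) = L2_dist x (psi l) - L2_dist (E p)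
    (psi l).
    exact: ipBl.
  by rewrite morphB_Q fcoefB onP// opprB addrA subrK.
move: hp; rewrite ltr_pdivlMr//; apply: le_lt_trans.
rewrite (le_trans (nrmD _ _))// nrmN.
apply: (@le_trans _ _ (nrm (x - E p) * (D * nrm (star (psi l : T)))
  + nrm (x - E p) * C)).
  apply: lerD.
    by rewrite (le_trans (cauchy_schwarz _ _))// ler_wpM2l.
  by rewrite (le_trans (nrm_fcoef _ _))// mulrC.
by rewrite -mulrDr ler_wpM2l// /K lerDl.
Qed.

(** The extension sends [v] to the element with Fourier coefficients [v (psi l)], which make sense
    for every distribution and decay rapidly because [psi l] does and [v] has finite order. *)
Lemma smoothing_of_kernel : smoothing Q.
Proof.
have [psi [psiE psib]] := row_functions.
have rapid_decay_dist (v : cinf T -> R[i]) : dist v ->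
  rapid_decay (fun l => v (psi l)).
  move=> /dist_bound[N [K K0 hK]] N'.
  have [C C0 hC] := psib N' N; exists (K * (C + 1)) => l.
  rewrite -mulrA; apply: hK; first by rewrite mulr_gt0// ltr_wpDl.
  by move=> k; apply: (le_trans (hC l k)); rewrite !ler_wpM2r// lerDl.
pose S (v : cinf T -> R[i]) : cinf T := to_cinf (summability.sum (fun l => v
  (psi l) *: U l)).
have coefS (v : cinf T -> R[i]) : rapid_decay (fun l => v (psi l)) ->
  coef (S v) = fun l => v (psi l).
  by move=> /(smooth_sumE T)[s e]; rewrite /S to_cinfK.
exists S; split; last first.
  move=> x; have xd : rapid_decay (fun l => L2_dist x (psi l)).
    move=> N; have [C C0 hC] := psib N (2 * n)%N;
      have [D D0 hD] := L2_in_bounded H.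
    exists (nrm x * (D * (C * 3 ^+ n))) => l.
    rewrite (le_trans (cauchy_schwarz _ _))// -mulrA ler_wpM2l//.
    rewrite (le_trans (hD _))// nrm_star -mulrA ler_wpM2l ?(ltW D0)//.
    rewrite mulrAC.
    apply: (nrm_cinf_le (g := fun k => nrm (coef (psi l) k))) => //.
    by apply: (bsum_rapid_decay (leqnn (2 * n))); rewrite ?mulr_ge0.
  apply/eqP; rewrite -subr_eq0; apply/eqP; apply: (@fcoef_inj _ _ _ _ H) => l.
  by rewrite fcoefB fcoef_in coefS// psiE subrr.
split=> [a v w dv dw|v0 b e dv0 /gt0_ReC[-> e0]].
  apply: cinf_eq => l; rewrite cinf_addE cinf_scaleE coefD coefZ.
  rewrite !coefS//; try exact: rapid_decay_dist.
  move=> N; have [M hM] := rapid_decay_dist _ dv N;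
    have [M' hM'] := rapid_decay_dist _ dw N.
  exists (nrm a * M + M') => k; rewrite (le_trans (nrmD _ _))//
    nrmM mulrDl lerD//.
  by rewrite -mulrA ler_wpM2l.
(* [msize b] orders are spent on the derivatives and [2 * n] on the summation, which also yields the
   [3 ^+ n] in [d]; the 2 makes the final inequality strict. *)
pose M := (msize b + 2 * n)%N; pose d := complex.Re e / (2 * 3 ^+ n).
have d0 : 0 < d by rewrite divr_gt0// mulr_gt0// exprn_gt0.
(* Rapid decay of [psi l] in [l] keeps these rescaled rows bounded, and closeness on them bounds the
   [l]-th coefficient of [S v - S v0] by [d * pw l (- M%:R)]. *)
pose f l : cinf T := (pw l M%:R)%:C *: psi l.
exists (range f), d%:C; split; first last.
- move=> v dv near.
  rewrite snormE ltcR.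
  apply: (@le_lt_trans _ _ (d * 3 ^+ n)).
    apply: nrm_mdelta_le; first exact: ltW.
    move=> l; rewrite cinf_subE coefB !coefS//; try exact: rapid_decay_dist.
    have := near (f l) (ex_intro2 _ _ l I erefl).
    have [vl _] := dv; have [v0l _] := dv0.
    rewrite -nrm_lt !dist_scale// -mulrBr nrmM nrm_real ger0_norm//.
    by rewrite pwV ler_pdivlMr// mulrC => /ltW.
  have -> : d * 3 ^+ n = complex.Re e / 2.
    by rewrite /d; field; rewrite gt_eqF// exprn_gt0.
  by rewrite ltr_pdivrMr// ltr_pMr// ltr1n.
- by rewrite ltcR.
move=> a; have [C C0 hC] := psib M (msize a + 2 * n)%N.
exists (C * 3 ^+ n)%:C => _ [l _ <-]; rewrite snormE lecR.
apply: nrm_mdelta_le => // k.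
rewrite /f coefZ nrmM nrm_real ger0_norm//.
apply: (le_trans (ler_wpM2l (pw_ge0 _ _) (hC l k))).
rewrite mulrA [pw l _ * _]mulrCA -pwD addrN pw0 mulr1 //.
Qed.

End Kernel.

(** * The matrix entries of the spectral projection *)

Theorem corollary5p4 (R : realType) (n : nat) (theta : 'M[R]_n)
    (T : ncTorus theta) (H : L2completion T) (q : R[i])
    (P : (cinf T -> R[i]) -> (cinf T -> R[i])) :
  (2 <= n)%N -> theta^T = - theta ->
  Psi q P -> elliptic q P ->
  0 < complex.Re q ->
  spectrum H P (complex.Re q) <> setT ->
  forall lambda : R[i], spectrum H P (complex.Re q) lambda ->
  forall r : R, isolating_radius H P (complex.Re q) lambda r ->
    smoothing (spectral_projection (H := H) P (complex.Re q) lambda r).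
Proof.
move=> _ _ _ [rho_q [[rho [rhos [rhoC rhoP ->]]] inv]] m0 _ lam _ r iso.
set m := complex.Re q in m0 iso *.
pose Is :=
  [set I | is_op_integral (integrand P m lam r : R -> H -> H) 0 (2 * pi) I].
have -> : spectral_projection (H := H) P m lam r =
    fun x => (2 * 'i * pi%:C)^-1 *: xget (fun=> 0) Is x by [].
set a := (_)^-1.
(* The Riemann sums do converge, but this is not needed: otherwise [xget]
   returns the zero operator. *)
have [[I intI]|nI] := pselect (exists I, Is I); last first.
  rewrite xgetPN; last by move=> I II; apply: nI; exists I.
  apply: smoothing_of_kernel.
  - by move=> c x y; rewrite !scaler0 addr0.
  - by exists 0 => // x; rewrite scaler0 nrm0 mul0r.
  - by move=> N; exists 0 => // k l; rewrite scaler0 /fcoef ip0l nrm0 !mul0r.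
have {I intI} intI : Is (xget (fun=> 0) Is) by apply: xgetPex; exists I.
set I := xget _ _ in intI *.
have Il := integral_linear iso intI.
have [CI CI0 hCI] := integral_bounded iso intI.
apply: smoothing_of_kernel.
- by move=> c x y; rewrite Il scalerDr !scalerA mulrC.
- by exists (nrm a * CI) => [|x]; rewrite ?mulr_ge0// nrmZ -mulrA ler_wpM2l.
have /choice[sig sigP] (k : 'rV[int]_n) : exists w : cinf T, k != 0 ->
    (rhos 0%N (zvec R k) : T) ** w = aone /\ (w : T) ** rhos 0%N (zvec R k)
      = aone.
  have [->|k0] := eqVneq k 0; first by exists 0.
  by have [w hw] := inv _ (zvec_neq0 R k0); exists w.
(* The base point [mu] is [lam + r], the point of the circle at angle 0. *)
have R0P := circle_resolvent iso 0.
move=> N; pose eps := Num.min 1 m.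
have eps0 : 0 < eps by rewrite lt_min ltr01.
have [J hJ] := nat_above (N%:R / eps).
have JN : N%:R <= J%:R * eps by rewrite -ler_pdivrMr.
have [C1 C10 hC1] := resolvent_row rhoC inv sigP rhoP R0P m0 J.
have [C2 C20 hC2] := resolvent_col rhoC inv sigP rhoP R0P m0 J.
have [C C0 hC] := riemann_fcoef iso J.
exists (nrm a * (C * C1 * C2)); first by rewrite !mulr_ge0.
move=> k l; rewrite fcoefZ nrmM -!mulrA ler_wpM2l//.
have w k' : pw k' (- (J%:R * eps)) <= pw k' (- N%:R) by rewrite ler_pw// lerN2.
apply: le_epsilon => e e0.
(* [M] may depend on [e]: the bound [hC] holds with the same constant for every number of nodes
   above [J + J], so one close Riemann sum is enough for each [e]. *)
have [M JM hM] := riemann_cvg intI (J + J) e0.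
rewrite -[I _](subKr (riemann P m lam r M (L2_in H (Uk T k))))
  fcoefB (le_trans (nrmD _ _))// nrmN lerD//.
  apply: (le_trans (hC M l _ (C1 * pw l (- (J%:R * eps))) JM _ _)).
  - by move=> y; rewrite mulrAC; exact: hC1.
  - by rewrite mulr_ge0.
  apply: (@le_trans _ _ (C * (C1 * pw l (- N%:R)) * (C2 * pw k (- N%:R)))).
    apply: ler_pM; rewrite ?mulr_ge0//.
      by rewrite !ler_wpM2l.
    by rewrite (le_trans (hC2 k))// ler_wpM2l.
  by apply: le_of_eq; ring.
by rewrite (le_trans (nrm_fcoef _ _))// (le_trans (hM _))// nrm_L2_in_U mulr1.
Qed.
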